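(* Let $\tau=\frac{-b+\sqrt{-d}}{2a}$ where $a,b,c$ are mutually coprime integers with $a>0$, $a\tau^2+b\tau+c=0$ and $-d=b^2-4ac$, and suppose $\tau$ lies in $C_{1/u,\infty}$. Then $$\frac{F^2}{6}\left[(u-1)-\frac{u^2+18u-27}{u-9}s_2(\tau)\right]-u(u-1)\frac{d}{du}F^2=\frac{a}{\pi\sqrt{d}}u^{2/3}(u-1)^{1/3},$$ where $u=u(\tau)$, $F={}_2F_1\!\left(\frac13,\frac13;1;\frac1u\right)$, and $\frac{d}{du}F^2$ denotes the derivative of $x\mapsto{}_2F_1(\frac13,\frac13;1;\frac1x)^2$ evaluated at $x=u(\tau)$.
   Context: $\mathfrak H$ is the upper half-plane, $q=e^{2\pi i\tau}$, $E_2=1-24\sum_{n\ge1}n\frac{q^n}{1-q^n}$, $E_4=1+240\sum_{n\ge1}n^3\frac{q^n}{1-q^n}$, $E_6=1-504\sum_{n\ge1}n^5\frac{q^n}{1-q^n}$, $E_2^*(\tau)=E_2(\tau)-\frac{3}{\pi\mathrm{Im}(\tau)}$, $s_2(\tau)=\frac{E_4(\tau)}{E_6(\tau)}E_2^*(\tau)$. ${}_2F_1$ is the Gauss hypergeometric function. $u(\tau)=-\frac{1}{27}\left(\frac{\eta(\tau)}{\eta(3\tau)}\right)^{12}$ ($\eta$ the Dedekind eta function) is the Hauptmodul of $\Gamma_0(3)$. With $\mathcal{F}_{3B}=\{z\in\mathfrak{H}:|z+1/3|>1/3,|z-1/3|>1/3,|\mathrm{Re}(z)|<1/2\}$, $C_{1/u,\infty}$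 is the connected component of $\{\tau\in\mathcal F_{3B}:|1/u(\tau)|<1\}$ whose closure contains the cusp $\infty$ (i.e. containing points of arbitrarily large imaginary part). *)

(* Defs.v *)
From Stdlib Require Import Reals ZArith.
From Coquelicot Require Import Coquelicot.

Local Open Scope R_scope.
Local Open Scope C_scope.

(* Componentwise limits and sums: these are the usual complex ones whenever
   the sequence, respectively the series, converges. *)
Definition CLim_seq (f : nat -> C) : C :=
  (real (Lim_seq (fun n => Re (f n))), real (Lim_seq (fun n => Im (f n)))).

Definition CSeries (f : nat -> C) : C :=
  (Series (fun n => Re (f n)), Series (fun n => Im (f n))).

Fixpoint Cprod (f : nat -> C) (n : nat) : C :=
  match n with
  | O => 1
  | S m => Cprod f m * f m
  end.

Definition Cexp (z : C) : C :=
  (exp (Re z) * cos (Im z), exp (Re z) * sin (Im z))%R.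

(* Principal branch: the argument lies in (-PI, PI]. *)
Definition Carg (z : C) : R :=
  if Rle_dec 0 (Im z) then acos (Re z / Cmod z) else (- acos (Re z / Cmod z))%R.

Definition Clog (z : C) : C := (ln (Cmod z), Carg z).

Definition Cpower (z : C) (s : R) : C := Cexp (s * Clog z).

Definition connected (A : C -> Prop) : Prop :=
  forall U V : C -> Prop,
    @open C_UniformSpace U -> @open C_UniformSpace V ->
    (forall z, A z -> U z \/ V z) ->
    (exists z, A z /\ U z) -> (exists z, A z /\ V z) ->
    exists z, A z /\ U z /\ V z.

Definition component (A : C -> Prop) (x y : C) : Prop :=
  exists B : C -> Prop,
    connected B /\ (forall z, B z -> A z) /\ B x /\ B y.

Fixpoint pochhammer (a : R) (n : nat) : R :=
  match n with
  | O => 1%R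
  | S m => (pochhammer a m * (a + INR m))%R
  end.

Definition hyp2F1 (a b c : R) (z : C) : C :=
  CSeries (fun n =>
    (pochhammer a n * pochhammer b n / (pochhammer c n * INR (fact n)))%R
      * z ^ n).

Definition nome (tau : C) : C := Cexp (2 * PI * Ci * tau).

(* sum_(n >= 1) n^k q^n / (1 - q^n) *)
Definition lambert (k : nat) (tau : C) : C :=
  CSeries (fun m => let n := S m in
    (INR n ^ k)%R * (nome tau ^ n / (1 - nome tau ^ n))).

Definition E2 (tau : C) : C := 1 - 24 * lambert 1 tau.
Definition E4 (tau : C) : C := 1 + 240 * lambert 3 tau.
Definition E6 (tau : C) : C := 1 - 504 * lambert 5 tau.

Definition E2star (tau : C) : C := E2 tau - (3 / (PI * Im tau))%R.

Definition s2 (tau : C) : C := E4 tau / E6 tau * E2star tau.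

(* The factor q^(1/24) means exp (2 pi i tau / 24). *)
Definition eta (tau : C) : C :=
  Cexp (2 * PI * Ci * tau / 24)
    * CLim_seq (Cprod (fun m => 1 - nome tau ^ S m)).

Definition u_3B (tau : C) : C := - / 27 * (eta tau / eta (3 * tau)) ^ 12.

Definition F_3B (z : C) : Prop :=
  (0 < Im z /\ 1 / 3 < Cmod (z + 1 / 3)%C /\ 1 / 3 < Cmod (z - 1 / 3)%C
   /\ Rabs (Re z) < 1 / 2)%R.

Definition disc_region (tau : C) : Prop :=
  F_3B tau /\ (Cmod (/ u_3B tau) < 1)%R.

(* The component of tau reaches the cusp at infinity.  Only one component of
   disc_region does, since 1/u tends to 0 as Im tau tends to infinity, so this
   predicate describes that component. *)
Definition C_inv_u_infty (tau : C) : Prop :=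
  disc_region tau /\
  forall M : R, exists z, component disc_region tau z /\ (M < Im z)%R.

(* Main.v *)
Require Import Defs.
From Stdlib Require Import Reals ZArith Lra Lia Classical.
From Coquelicot Require Import Coquelicot.

(* Write D = q d/dq, t = 1/u, P = E2, A = (3 E2(3 tau) - E2(tau)) / 2 and
   b = eta(tau)^3 / eta(3 tau).  On the component of the cusp the hypergeometric
   function is an eta quotient, F(t) = b, and A = b^2 (1 - t)^(2/3).  Since D t = A t
   and 12 D b = (P - A) b, the derivative term of the identity equals
   (u - 1) (F^2 / 6) (P / A - 1); since E4 / E6 = (u - 9) (u - 1) / (A (u^2 + 18 u - 27)),
   the left-hand side collapses to (u - 1) (F^2 / A) / (2 pi Im tau).

   No modular transformation is used.  Ramanujan's product formula for the series
   sum u_n sin (n theta), u_n = q^n / (1 - q^n), together with its derivatives in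
   theta at 0 and 2 pi / 3, expresses E4, E6 and D A through a = 1 + 6 sum chi(n) u_n,
   with a^2 = A, and a series e of weight 3.  First order differential equations give
   e = b^3 and a^3 = e (1 - t) near the cusp, then F(t) = b through a vanishing
   Wronskian.  All these identities are open and closed conditions on the set of
   nomes with |t| < 1, so they hold on the whole component.

   The second Frobenius solution inverts t: q = - (t / 27) exp (G(t) / F(t)).  Hence
   u = 9 would make q negative, which |Re tau| < 1/2 excludes; this matters because
   the formula divides by u - 9. *)

Local Open Scope R_scope.
Local Open Scope C_scope.

(** The computations take place among polynomials in [P], [a] and [e]: the Eisenstein series of
    weights 4 and 6, at [q] and at [q^3], are expressed through these three. The elimination in
    weight 6 yields [D e] only in the form [a D e = a e (P - a^2) / 4], so the first order equation
    for [e] is available only where [a] does not vanish, and nothing excludes zeros of [a]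
    beforehand. Conversely, [e = b^3] and [a^3 = e (1 - t)] with [|t| < 1] force [a <> 0], because
    [b] is an exponential. Hence these two relations are propagated jointly and before all others. A
    second obstacle is that D degenerates at the cusp [q = 0]. The defect [a^3 - e (1 - t)] solves
    the same first order equation as [t b^3], which has a simple zero there, so its vanishing is
    decided by its derivative at 0 and not by its value. The branch in the statement comes from
    [F^2 = a^2 (1 - t)^(-2/3)]: since [u] and [u - 1] have the same imaginary part, their principal
    logarithms differ exactly by the series for [- log (1 - 1/u)]. *)

Lemma Cmod_triangle_minus (x y : C) : (Cmod (x - y) <= Cmod x + Cmod y)%R.
Proof. unfold Cminus. rewrite <- (Cmod_opp y). apply Cmod_triangle. Qed.

Lemma Cmod_sym (x y : C) : Cmod (x - y) = Cmod (y - x).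
Proof. rewrite <- Cmod_opp. f_equal. ring. Qed.

Lemma Im_le_Cmod (z : C) : (Rabs (Im z) <= Cmod z)%R.
Proof. eapply Rle_trans; [apply Rmax_r | apply Rmax_Cmod]. Qed.

Lemma Cmod_le_Re_Im (z : C) : (Cmod z <= Rabs (Re z) + Rabs (Im z))%R.
Proof.
  destruct z as [x y]. unfold Re, Im. simpl fst. simpl snd.
  replace (x, y) with (RtoC x + Ci * RtoC y).
  2: { unfold Ci, RtoC, Cmult, Cplus; simpl; f_equal; ring. }
  eapply Rle_trans; [apply Cmod_triangle|].
  rewrite Cmod_mult, Cmod_Ci, !Cmod_R. lra.
Qed.

Lemma Re_plus (x y : C) : Re (x + y) = (Re x + Re y)%R.
Proof. reflexivity. Qed.
Lemma Im_plus (x y : C) : Im (x + y) = (Im x + Im y)%R.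
Proof. reflexivity. Qed.
Lemma Re_minus (x y : C) : Re (x - y) = (Re x - Re y)%R.
Proof. reflexivity. Qed.
Lemma Im_minus (x y : C) : Im (x - y) = (Im x - Im y)%R.
Proof. reflexivity. Qed.
Lemma C_eq (x y : C) : Re x = Re y -> Im x = Im y -> x = y.
Proof. destruct x, y; unfold Re, Im; simpl; intros -> ->; reflexivity. Qed.

(** * Complex derivatives *)

(** Division-free form of the complex derivative: sums, products and compositions become estimates
    of the remainder, and [w = z] is no special case. *)
Definition Cder (f : C -> C) (z l : C) : Prop :=
  forall eps : R, (0 < eps)%R -> exists delta : R, (0 < delta)%R /\
    forall w, (Cmod (w - z) < delta)%R ->
      (Cmod (f w - f z - l * (w - z)) <= eps * Cmod (w - z))%R.

Definition Ccont (f : C -> C) (z : C) : Prop :=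
  forall eps : R, (0 < eps)%R -> exists delta : R, (0 < delta)%R /\
    forall w, (Cmod (w - z) < delta)%R -> (Cmod (f w - f z) < eps)%R.

Lemma Cder_lip f z l : Cder f z l -> exists delta : R, (0 < delta)%R /\
  forall w, (Cmod (w - z) < delta)%R ->
    (Cmod (f w - f z) <= (Cmod l + 1) * Cmod (w - z))%R.
Proof.
  intros H. destruct (H 1%R Rlt_0_1) as [d [Hd H1]].
  exists d; split; [exact Hd|]. intros w Hw. specialize (H1 w Hw).
  replace (f w - f z) with ((f w - f z - l * (w - z)) + l * (w - z)) by ring.
  eapply Rle_trans; [apply Cmod_triangle|]. rewrite Cmod_mult. lra.
Qed.

Lemma Cder_cont f z l : Cder f z l -> Ccont f z.
Proof.
  intros H eps Heps. destruct (Cder_lip _ _ _ H) as [d [Hd H1]].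
  pose proof (Cmod_ge_0 l) as Hl.
  exists (Rmin d (eps / (Cmod l + 2))). split.
  { apply Rmin_pos; [exact Hd|]. apply Rdiv_lt_0_compat; lra. }
  intros w Hw.
  assert (Hw1 : (Cmod (w - z) < d)%R) by (eapply Rlt_le_trans; [exact Hw|apply Rmin_l]).
  assert (Hw2 : (Cmod (w - z) < eps / (Cmod l + 2))%R) by (eapply Rlt_le_trans; [exact Hw|apply Rmin_r]).
  eapply Rle_lt_trans; [apply H1; exact Hw1|].
  apply Rle_lt_trans with ((Cmod l + 2) * Cmod (w - z))%R.
  { pose proof (Cmod_ge_0 (w - z)). nra. }
  apply Rmult_lt_reg_l with (/ (Cmod l + 2))%R; [apply Rinv_0_lt_compat; lra|].
  field_simplify; [|lra|lra]. unfold Rdiv in Hw2. field_simplify in Hw2; lra.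
Qed.

Lemma Cder_ext_loc f g z l (r : R) : (0 < r)%R ->
  (forall w, (Cmod (w - z) < r)%R -> f w = g w) -> Cder f z l -> Cder g z l.
Proof.
  intros Hr Hfg H eps Heps. destruct (H eps Heps) as [d [Hd H1]].
  exists (Rmin d r). split; [apply Rmin_pos; assumption|].
  intros w Hw.
  assert (Hw1 : (Cmod (w - z) < d)%R) by (eapply Rlt_le_trans; [exact Hw|apply Rmin_l]).
  assert (Hw2 : (Cmod (w - z) < r)%R) by (eapply Rlt_le_trans; [exact Hw|apply Rmin_r]).
  rewrite <- (Hfg w Hw2), <- (Hfg z). { apply H1, Hw1. }
  replace (z - z) with (RtoC 0) by ring. rewrite Cmod_0. exact Hr.
Qed.

Lemma Cder_ext f g z l : (forall w, f w = g w) -> Cder f z l -> Cder g z l.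
Proof. intros H. apply Cder_ext_loc with 1%R; [lra|auto]. Qed.

Lemma Cder_const c z : Cder (fun _ => c) z 0.
Proof.
  intros eps Heps. exists 1%R; split; [lra|]. intros w _.
  replace (c - c - 0 * (w - z)) with (RtoC 0) by ring. rewrite Cmod_0.
  apply Rmult_le_pos; [lra|apply Cmod_ge_0].
Qed.

Lemma Cder_id z : Cder (fun x => x) z 1.
Proof.
  intros eps Heps. exists 1%R; split; [lra|]. intros w _.
  replace (w - z - 1 * (w - z)) with (RtoC 0) by ring. rewrite Cmod_0.
  apply Rmult_le_pos; [lra|apply Cmod_ge_0].
Qed.

Lemma Cder_plus f g z l m : Cder f z l -> Cder g z m ->
  Cder (fun x => f x + g x) z (l + m).
Proof.
  intros Hf Hg eps Heps.
  destruct (Hf (eps / 2)%R) as [d1 [Hd1 H1]]; [lra|].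
  destruct (Hg (eps / 2)%R) as [d2 [Hd2 H2]]; [lra|].
  exists (Rmin d1 d2). split; [apply Rmin_pos; assumption|]. intros w Hw.
  specialize (H1 w (Rlt_le_trans _ _ _ Hw (Rmin_l _ _))).
  specialize (H2 w (Rlt_le_trans _ _ _ Hw (Rmin_r _ _))).
  replace (f w + g w - (f z + g z) - (l + m) * (w - z))
    with ((f w - f z - l * (w - z)) + (g w - g z - m * (w - z))) by ring.
  eapply Rle_trans; [apply Cmod_triangle|]. lra.
Qed.

Lemma Cder_mult f g z l m : Cder f z l -> Cder g z m ->
  Cder (fun x => f x * g x) z (l * g z + f z * m).
Proof.
  intros Hf Hg eps Heps.
  pose proof (Cmod_ge_0 (f z)) as Af. pose proof (Cmod_ge_0 (g z)) as Ag.
  pose proof (Cmod_ge_0 l) as Al. pose proof (Cmod_ge_0 m) as Am.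
  set (K := (Cmod (g z) + Cmod (f z) + (Cmod l + 1) * (Cmod m + 1) + 1)%R).
  assert (HK : (0 < K)%R) by (unfold K; nra).
  set (e := (eps / (3 * K))%R).
  assert (He : (0 < e)%R) by (apply Rdiv_lt_0_compat; lra).
  destruct (Hf e He) as [d1 [Hd1 H1]]. destruct (Hg e He) as [d2 [Hd2 H2]].
  destruct (Cder_lip _ _ _ Hf) as [d3 [Hd3 H3]].
  destruct (Cder_lip _ _ _ Hg) as [d4 [Hd4 H4]].
  exists (Rmin (Rmin d1 d2) (Rmin (Rmin d3 d4) e)). split.
  { repeat apply Rmin_pos; assumption. }
  intros w Hw.
  assert (B : forall x, (Rmin (Rmin d1 d2) (Rmin (Rmin d3 d4) e) <= x)%R -> (Cmod (w - z) < x)%R).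
  { intros x Hx. lra. }
  specialize (H1 w (B _ (Rle_trans _ _ _ (Rmin_l _ _) (Rmin_l _ _)))).
  specialize (H2 w (B _ (Rle_trans _ _ _ (Rmin_l _ _) (Rmin_r _ _)))).
  specialize (H3 w (B _ (Rle_trans _ _ _ (Rmin_r _ _) (Rle_trans _ _ _ (Rmin_l _ _) (Rmin_l _ _))))).
  specialize (H4 w (B _ (Rle_trans _ _ _ (Rmin_r _ _) (Rle_trans _ _ _ (Rmin_l _ _) (Rmin_r _ _))))).
  assert (H5 := B _ (Rle_trans _ _ _ (Rmin_r _ _) (Rmin_r _ _))). clear B.
  replace (f w * g w - f z * g z - (l * g z + f z * m) * (w - z))
    with (((f w - f z - l * (w - z)) * g z + f z * (g w - g z - m * (w - z)))
          + (f w - f z) * (g w - g z)) by ring.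
  eapply Rle_trans; [apply Cmod_triangle|].
  eapply Rle_trans; [apply Rplus_le_compat_r, Cmod_triangle|].
  rewrite !Cmod_mult.
  set (h := Cmod (w - z)) in *. assert (Hh : (0 <= h)%R) by apply Cmod_ge_0.
  assert (E : (3 * K * e = eps)%R) by (unfold e; field; lra).
  assert (I1 : (Cmod (f w - f z - l * (w - z)) * Cmod (g z) <= e * h * Cmod (g z))%R)
    by (apply Rmult_le_compat_r; assumption).
  assert (I2 : (Cmod (f z) * Cmod (g w - g z - m * (w - z)) <= Cmod (f z) * (e * h))%R)
    by (apply Rmult_le_compat_l; assumption).
  assert (I3 : (Cmod (f w - f z) * Cmod (g w - g z) <= ((Cmod l + 1) * h) * ((Cmod m + 1) * h))%R)
    by (apply Rmult_le_compat; auto using Cmod_ge_0).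
  assert (I4 : (((Cmod l + 1) * h) * ((Cmod m + 1) * h) <= ((Cmod l + 1) * (Cmod m + 1)) * e * h)%R).
  { replace (((Cmod l + 1) * h) * ((Cmod m + 1) * h))%R with (((Cmod l + 1) * (Cmod m + 1) * h) * h)%R by ring.
    replace ((Cmod l + 1) * (Cmod m + 1) * e * h)%R with (((Cmod l + 1) * (Cmod m + 1) * h) * e)%R by ring.
    apply Rmult_le_compat_l; [|lra]. apply Rmult_le_pos; [nra|exact Hh]. }
  apply Rle_trans with (K * e * h)%R.
  { unfold K. lra || nra. }
  rewrite <- E. assert (0 <= K * e * h)%R by (apply Rmult_le_pos; [nra|lra]). lra.
Qed.

Lemma Cder_scal c f z l : Cder f z l -> Cder (fun x => c * f x) z (c * l).
Proof.
  intros H. pose proof (Cder_mult _ _ _ _ _ (Cder_const c z) H) as H1.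
  replace (c * l) with (0 * f z + c * l) by ring. exact H1.
Qed.

Lemma Cder_opp f z l : Cder f z l -> Cder (fun x => - f x) z (- l).
Proof.
  intros H. apply (Cder_scal (-(1))) in H.
  replace (- l) with (-(1) * l) by ring. eapply Cder_ext; [|exact H].
  intros; simpl; ring.
Qed.

Lemma Cder_minus f g z l m : Cder f z l -> Cder g z m ->
  Cder (fun x => f x - g x) z (l - m).
Proof. intros Hf Hg. exact (Cder_plus _ _ _ _ _ Hf (Cder_opp _ _ _ Hg)). Qed.

Lemma Cder_comp f g z l m : Cder g z m -> Cder f (g z) l ->
  Cder (fun x => f (g x)) z (l * m).
Proof.
  intros Hg Hf eps Heps.
  pose proof (Cmod_ge_0 l) as Al. pose proof (Cmod_ge_0 m) as Am.
  set (e := (eps / (2 * (Cmod m + Cmod l + 1)))%R).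
  assert (He : (0 < e)%R) by (apply Rdiv_lt_0_compat; lra).
  assert (E : (2 * (Cmod m + Cmod l + 1) * e = eps)%R) by (unfold e; field; lra).
  destruct (Hf e He) as [d1 [Hd1 H1]]. destruct (Hg e He) as [d2 [Hd2 H2]].
  destruct (Cder_lip _ _ _ Hg) as [d3 [Hd3 H3]].
  destruct (Cder_cont _ _ _ Hg d1 Hd1) as [d4 [Hd4 H4]].
  exists (Rmin d2 (Rmin d3 d4)). split; [repeat apply Rmin_pos; assumption|].
  intros w Hw.
  assert (Hw2 : (Cmod (w - z) < d2)%R) by (eapply Rlt_le_trans; [exact Hw|apply Rmin_l]).
  assert (Hw3 : (Cmod (w - z) < d3)%R) by
    (eapply Rlt_le_trans; [exact Hw|eapply Rle_trans; [apply Rmin_r|apply Rmin_l]]).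
  assert (Hw4 : (Cmod (w - z) < d4)%R) by
    (eapply Rlt_le_trans; [exact Hw|eapply Rle_trans; [apply Rmin_r|apply Rmin_r]]).
  specialize (H2 w Hw2). specialize (H3 w Hw3). specialize (H4 w Hw4).
  specialize (H1 (g w) H4).
  replace (f (g w) - f (g z) - l * m * (w - z))
    with ((f (g w) - f (g z) - l * (g w - g z)) + l * (g w - g z - m * (w - z))) by ring.
  eapply Rle_trans; [apply Cmod_triangle|]. rewrite Cmod_mult.
  set (h := Cmod (w - z)) in *. assert (Hh : (0 <= h)%R) by apply Cmod_ge_0.
  assert (I1 : (e * Cmod (g w - g z) <= e * ((Cmod m + 1) * h))%R)
    by (apply Rmult_le_compat_l; lra).
  assert (I2 : (Cmod l * Cmod (g w - g z - m * (w - z)) <= Cmod l * (e * h))%R)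
    by (apply Rmult_le_compat_l; lra).
  rewrite <- E. assert (0 <= (Cmod m + Cmod l + 1) * e * h)%R by (apply Rmult_le_pos; [nra|lra]).
  nra.
Qed.

Lemma Cder_Cinv (z : C) : z <> 0 -> Cder Cinv z (- / (z * z)).
Proof.
  intros Hz eps Heps.
  assert (Az : (0 < Cmod z)%R) by (apply Cmod_gt_0; exact Hz).
  set (a := Cmod z) in *.
  set (d := Rmin (a / 2) (eps * (a * a * a) / 2)).
  exists d. split.
  { apply Rmin_pos; [lra|]. apply Rdiv_lt_0_compat; [|lra].
    repeat apply Rmult_lt_0_compat; lra. }
  intros w Hw.
  assert (Hw1 : (Cmod (w - z) < a / 2)%R) by (eapply Rlt_le_trans; [exact Hw|apply Rmin_l]).
  assert (Hw2 : (Cmod (w - z) < eps * (a * a * a) / 2)%R) by (eapply Rlt_le_trans; [exact Hw|apply Rmin_r]).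
  assert (Aw : (a / 2 < Cmod w)%R).
  { assert (a <= Cmod w + Cmod (w - z))%R; [|lra].
    unfold a. replace z with (w - (w - z)) at 1 by ring. apply Cmod_triangle_minus. }
  assert (Hw0 : w <> 0) by (apply Cmod_gt_0; lra).
  replace (/ w - / z - - / (z * z) * (w - z)) with ((w - z) * (w - z) * / (z * z * w))
    by (field; split; assumption).
  rewrite !Cmod_mult, Cmod_inv by (repeat apply Cmult_neq_0; assumption).
  rewrite !Cmod_mult. fold a.
  set (h := Cmod (w - z)) in *. assert (Hh : (0 <= h)%R) by apply Cmod_ge_0.
  rewrite Rmult_assoc, (Rmult_comm eps). apply Rmult_le_compat_l; [exact Hh|].
  assert (P : (0 < a * a * Cmod w)%R) by (repeat apply Rmult_lt_0_compat; lra).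
  apply Rmult_le_reg_r with (a * a * Cmod w)%R; [exact P|].
  rewrite Rmult_assoc, Rinv_l by lra. rewrite Rmult_1_r.
  apply Rle_trans with (eps * (a * a * a) / 2)%R; [lra|].
  replace (eps * (a * a * a) / 2)%R with (eps * (a * a * (a / 2)))%R by field.
  apply Rmult_le_compat_l; [lra|]. apply Rmult_le_compat_l; [nra|lra].
Qed.

Lemma Cder_inv (f : C -> C) (z l : C) : f z <> 0 -> Cder f z l ->
  Cder (fun x => / f x) z (- l / (f z * f z)).
Proof.
  intros Hz H. pose proof (Cder_comp Cinv f z _ _ H (Cder_Cinv _ Hz)) as H1.
  replace (- l / (f z * f z)) with (- / (f z * f z) * l) by (field; exact Hz). exact H1.
Qed.

Lemma Cder_div (f g : C -> C) (z l m : C) : g z <> 0 -> Cder f z l -> Cder g z m ->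
  Cder (fun x => f x / g x) z ((l * g z - f z * m) / (g z * g z)).
Proof.
  intros Hz Hf Hg. pose proof (Cder_mult _ _ _ _ _ Hf (Cder_inv _ _ _ Hz Hg)) as H.
  replace ((l * g z - f z * m) / (g z * g z)) with (l * / g z + f z * (- m / (g z * g z)))
    by (field; exact Hz).
  exact H.
Qed.

Lemma Cder_pow f z l n : Cder f z l ->
  Cder (fun x => f x ^ S n) z (INR (S n) * f z ^ n * l).
Proof.
  intros H. induction n as [|n IH].
  - eapply Cder_ext with (f := f). { intros; simpl; ring. }
    replace (INR 1 * f z ^ 0 * l) with l by (simpl; ring). exact H.
  - pose proof (Cder_mult _ _ _ _ _ H IH) as H1.
    replace (INR (S (S n)) * f z ^ S n * l) with (l * f z ^ S n + f z * (INR (S n) * f z ^ n * l)).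
    { exact H1. }
    rewrite (S_INR (S n)), RtoC_plus. rewrite !Cpow_S. ring.
Qed.

Lemma Cder_unique f z l m : Cder f z l -> Cder f z m -> l = m.
Proof.
  intros Hl Hm. apply Ceq_minus, Cmod_eq_0.
  apply Rle_antisym; [|apply Cmod_ge_0].
  apply Rnot_lt_le. intros Hpos.
  set (e := (Cmod (l - m) / 3)%R) in *.
  assert (He : (0 < e)%R) by (unfold e; lra).
  destruct (Hl e He) as [d1 [Hd1 H1]]. destruct (Hm e He) as [d2 [Hd2 H2]].
  set (r := (Rmin d1 d2 / 2)%R).
  assert (Hr : (0 < r)%R) by (unfold r; pose proof (Rmin_pos _ _ Hd1 Hd2); lra).
  assert (Hr1 : (r < d1)%R) by (unfold r; pose proof (Rmin_l d1 d2); pose proof (Rmin_pos _ _ Hd1 Hd2); lra).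
  assert (Hr2 : (r < d2)%R) by (unfold r; pose proof (Rmin_r d1 d2); pose proof (Rmin_pos _ _ Hd1 Hd2); lra).
  assert (Er : Cmod (z + r - z) = r).
  { replace (z + r - z) with (RtoC r) by ring. rewrite Cmod_R. apply Rabs_pos_eq; lra. }
  specialize (H1 (z + r)). specialize (H2 (z + r)). rewrite Er in H1, H2.
  specialize (H1 Hr1). specialize (H2 Hr2).
  assert (I : (Cmod ((l - m) * (z + r - z)) <= 2 * e * r)%R).
  { replace ((l - m) * (z + r - z)) with
      ((f (z + r) - f z - m * (z + r - z)) - (f (z + r) - f z - l * (z + r - z))) by ring.
    eapply Rle_trans; [apply Cmod_triangle_minus|]. lra. }
  rewrite Cmod_mult, Er in I.
  assert (Cmod (l - m) <= 2 * e)%R by (apply Rmult_le_reg_r with r; assumption).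
  unfold e in *. lra.
Qed.

Lemma Cder_is_derive f z l : Cder f z l ->
  @is_derive C_AbsRing C_NormedModule f z l.
Proof.
  intros H. split.
  - apply is_linear_scal_l.
  - intros x Hx.
    assert (E : z = x) by exact (@is_filter_lim_locally_unique C_AbsRing (AbsRing_NormedModule C_AbsRing) z x Hx).
    subst x. intros eps. destruct (H eps (cond_pos eps)) as [d [Hd H1]].
    exists (mkposreal d Hd). intros w Hw. 
    specialize (H1 w Hw).
    change (Cmod (f w - f z - (w - z) * l) <= eps * Cmod (w - z))%R.
    rewrite (Cmult_comm (w - z) l). exact H1.
Qed.

Lemma Cder_C_derive f z l : Cder f z l -> C_derive f z = l.
Proof. intros H. apply is_C_derive_unique, Cder_is_derive, H. Qed.

(** The mean value theorem applies to real functions; restricting the real part of [f] to a segment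
    makes it usable. *)
Lemma Cder_line_Re f z0 dz (s : R) l : Cder f (z0 + s * dz) l ->
  is_derive (fun x : R => Re (f (z0 + x * dz))) s (Re (l * dz)).
Proof.
  intros H. split; [apply is_linear_scal_l|].
  intros x Hx.
  assert (E0 : s = x) by exact (@is_filter_lim_locally_unique R_AbsRing R_NormedModule s x Hx).
  subst x. intros eps.
  assert (He : (0 < eps / (Cmod dz + 1))%R).
  { apply Rdiv_lt_0_compat; [apply cond_pos|]. pose proof (Cmod_ge_0 dz); lra. }
  destruct (H _ He) as [d [Hd H1]].
  assert (Hd' : (0 < d / (Cmod dz + 1))%R).
  { apply Rdiv_lt_0_compat; [exact Hd|]. pose proof (Cmod_ge_0 dz); lra. }
  exists (mkposreal _ Hd').
  change (forall w : R, (Rabs (w - s) < d / (Cmod dz + 1))%R ->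
    (Rabs (Re (f (z0 + w * dz)%C) - Re (f (z0 + s * dz)%C) - (w - s) * Re (l * dz)%C) <= eps * Rabs (w - s))%R).
  intros w Hw.
  assert (E : z0 + w * dz - (z0 + s * dz) = (w - s)%R * dz).
  { rewrite RtoC_minus. ring. }
  specialize (H1 (z0 + w * dz)). rewrite E, Cmod_mult, Cmod_R in H1.
  pose proof (Cmod_ge_0 dz) as Adz. pose proof (Rabs_pos (w - s)) as Aws.
  assert (Hlt : (Rabs (w - s) * Cmod dz < d)%R).
  { apply Rle_lt_trans with (Rabs (w - s) * (Cmod dz + 1))%R; [nra|].
    apply Rmult_lt_reg_r with (/ (Cmod dz + 1))%R; [apply Rinv_0_lt_compat; lra|].
    rewrite Rmult_assoc, Rinv_r by lra. rewrite Rmult_1_r. exact Hw. }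
  specialize (H1 Hlt).
  eapply Rle_trans; [|eapply Rle_trans; [exact H1|]].
  - eapply Rle_trans; [|apply re_le_Cmod].
    right. f_equal. rewrite !Re_minus. f_equal.
    replace (l * ((w - s)%R * dz)) with ((w - s)%R * (l * dz)) by ring.
    rewrite re_scal_l. reflexivity.
  - replace (eps / (Cmod dz + 1) * (Rabs (w - s) * Cmod dz))%R
      with (eps * Rabs (w - s) * (Cmod dz / (Cmod dz + 1)))%R by (field; lra).
    rewrite <- (Rmult_1_r (eps * Rabs (w - s))) at 2.
    apply Rmult_le_compat_l; [apply Rmult_le_pos; [apply Rlt_le, cond_pos|exact Aws]|].
    apply Rmult_le_reg_r with (Cmod dz + 1)%R; [lra|].
    unfold Rdiv. rewrite Rmult_assoc, Rinv_l by lra. lra.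
Qed.

(** The mean value theorem for the real part, then for the real part of [- Ci * f], which is [Im f].
    The derivative has to vanish for [s > 0] only: at the start of a ray from the origin,
    [q d/dq f = 0] says nothing about it. *)
Lemma const_on_ray f z0 z1 (l : R -> C) :
  (forall s : R, (0 <= s <= 1)%R -> Cder f (z0 + s * (z1 - z0)) (l s)) ->
  (forall s : R, (0 < s <= 1)%R -> l s = 0) -> f z1 = f z0.
Proof.
  assert (Key : forall f (l : R -> C),
    (forall s : R, (0 <= s <= 1)%R -> Cder f (z0 + s * (z1 - z0)) (l s)) ->
    (forall s : R, (0 < s <= 1)%R -> l s = 0) -> Re (f z1) = Re (f z0)).
  { clear f l. intros f l H Hl.
    destruct (MVT_gen (fun x : R => Re (f (z0 + x * (z1 - z0)))) 0 1 (fun _ => 0%R)) as [c [_ Hc]].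
    - intros x Hx. rewrite Rmin_left, Rmax_right in Hx by lra.
      replace 0%R with (Re (l x * (z1 - z0))).
      + apply Cder_line_Re, H; lra.
      + rewrite Hl by lra. rewrite Cmult_0_l. reflexivity.
    - intros x Hx. rewrite Rmin_left, Rmax_right in Hx by lra.
      assert (D := Cder_line_Re _ _ _ _ _ (H x Hx)).
      apply continuity_pt_filterlim. apply (ex_derive_continuous (fun x : R => Re (f (z0 + x * (z1 - z0))))).
      eexists; exact D.
    - cbv beta in Hc.
      replace (z0 + 1%R * (z1 - z0)) with z1 in Hc by ring.
      replace (z0 + 0%R * (z1 - z0)) with z0 in Hc by ring. lra. }
  intros H Hl. apply C_eq; [exact (Key f l H Hl)|].
  assert (E : forall z, Im z = (Re (- Ci * z))).
  { intros [x y]; unfold Re, Im, Ci, Cmult, Copp; simpl; ring. }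
  rewrite (E (f z1)), (E (f z0)).
  apply (Key (fun z => - Ci * f z) (fun s => - Ci * l s)).
  - intros s Hs. apply Cder_scal, H, Hs.
  - intros s Hs. rewrite (Hl s Hs). ring.
Qed.

(** * Complex series *)

Fixpoint Csum (f : nat -> C) (n : nat) : C :=
  match n with
  | O => 0
  | S m => Csum f m + f m
  end.

Definition Clim (s : nat -> C) (l : C) : Prop :=
  is_lim_seq (fun n => Cmod (s n - l)) 0%R.

Definition abs_conv (f : nat -> C) : Prop := ex_series (fun n => Cmod (f n)).

Lemma Csum_ext f g n : (forall i, (i < n)%nat -> f i = g i) -> Csum f n = Csum g n.
Proof.
  induction n as [|n IH]; simpl; intros H; [reflexivity|].
  rewrite IH, (H n); auto.
Qed.

Lemma Csum_plus f g n : Csum (fun i => f i + g i) n = Csum f n + Csum g n.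
Proof. induction n as [|n IH]; simpl; [ring|rewrite IH; ring]. Qed.

Lemma Csum_scal c f n : Csum (fun i => c * f i) n = c * Csum f n.
Proof. induction n as [|n IH]; simpl; [ring|rewrite IH; ring]. Qed.

Lemma Csum_mult f g m n :
  Csum f m * Csum g n = Csum (fun i => Csum (fun j => f i * g j) n) m.
Proof.
  induction m as [|m IH]; simpl; [ring|].
  rewrite <- IH, Csum_scal. ring.
Qed.

Lemma Csum_rev f n : Csum f n = Csum (fun i => f (n - 1 - i)%nat) n.
Proof.
  assert (G : forall f n, Csum f (S n) = f O + Csum (fun i => f (S i)) n).
  { intros g k. induction k as [|k IH]; [simpl; ring|].
    change (Csum g (S k) + g (S k) = g O + (Csum (fun i => g (S i)) k + g (S k))).
    rewrite IH. ring. }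
  revert f; induction n as [|n IH]; intros f; [reflexivity|].
  rewrite (G (fun i => f (S n - 1 - i)%nat)). simpl Csum at 1.
  rewrite (IH f). replace (S n - 1 - 0)%nat with n by lia.
  rewrite (Cplus_comm (f n)). f_equal. apply Csum_ext. intros i Hi. f_equal. lia.
Qed.

Lemma Csum_first f n : Csum f (S n) = f O + Csum (fun i => f (S i)) n.
Proof.
  induction n as [|n IH]; [simpl; ring|].
  change (Csum f (S n) + f (S n) = f O + (Csum (fun i => f (S i)) n + f (S n))).
  rewrite IH. ring.
Qed.

Lemma Csum_bound f n (K : R) : (forall i, (i < n)%nat -> (Cmod (f i) <= K)%R) ->
  (Cmod (Csum f n) <= INR n * K)%R.
Proof.
  induction n as [|n IH]; intros H.
  - simpl. rewrite Cmod_0. lra.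
  - simpl Csum. rewrite S_INR. eapply Rle_trans; [apply Cmod_triangle|].
    assert (Cmod (Csum f n) <= INR n * K)%R by (apply IH; auto).
    specialize (H n (Nat.lt_succ_diag_r n)). lra.
Qed.

Lemma Re_Csum f n : Re (Csum f (S n)) = sum_n (fun i => Re (f i)) n.
Proof.
  induction n as [|n IH].
  - rewrite sum_O. simpl Csum. rewrite Re_plus. simpl. ring.
  - rewrite sum_Sn, <- IH. simpl Csum. rewrite Re_plus. reflexivity.
Qed.

Lemma Im_Csum f n : Im (Csum f (S n)) = sum_n (fun i => Im (f i)) n.
Proof.
  induction n as [|n IH].
  - rewrite sum_O. simpl Csum. rewrite Im_plus. simpl. ring.
  - rewrite sum_Sn, <- IH. simpl Csum. rewrite Im_plus. reflexivity.
Qed.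

Lemma Clim_ext s t l : (forall n, s n = t n) -> Clim s l -> Clim t l.
Proof. intros H. apply is_lim_seq_ext. intros n. rewrite H. reflexivity. Qed.

Lemma Clim_le s l (K : nat -> R) :
  (forall n, (Cmod (s n - l) <= K n)%R) -> is_lim_seq K 0%R -> Clim s l.
Proof.
  intros H HK. apply is_lim_seq_le_le with (u := fun _ => 0%R) (w := K); auto.
  - intros n. split; [apply Cmod_ge_0|apply H].
  - apply is_lim_seq_const.
Qed.

Lemma Clim_unique s l m : Clim s l -> Clim s m -> l = m.
Proof.
  intros H1 H2. apply Ceq_minus, Cmod_eq_0, Rle_antisym; [|apply Cmod_ge_0].
  assert (H := is_lim_seq_plus' _ _ _ _ H1 H2).
  assert (Hle : Rbar_le (Cmod (l - m)) (0 + 0)%R).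
  { refine (is_lim_seq_le (fun _ => Cmod (l - m)) _ _ _ _ (is_lim_seq_const _) H).
    intros n. replace (l - m) with ((s n - m) - (s n - l)) by ring.
    eapply Rle_trans; [apply Cmod_triangle_minus|]. lra. }
  simpl in Hle. lra.
Qed.

Lemma Clim_const l : Clim (fun _ => l) l.
Proof.
  apply is_lim_seq_ext with (fun _ => 0%R); [|apply is_lim_seq_const].
  intros n. replace (l - l) with (RtoC 0) by ring. rewrite Cmod_0. reflexivity.
Qed.

Lemma Clim_plus s t l m : Clim s l -> Clim t m -> Clim (fun n => s n + t n) (l + m).
Proof.
  intros H1 H2. apply Clim_le with (fun n => Cmod (s n - l) + Cmod (t n - m))%R.
  - intros n. replace (s n + t n - (l + m)) with ((s n - l) + (t n - m)) by ring.
    apply Cmod_triangle.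
  - assert (H := is_lim_seq_plus' _ _ _ _ H1 H2). rewrite Rplus_0_r in H. exact H.
Qed.

Lemma Clim_scal c s l : Clim s l -> Clim (fun n => c * s n) (c * l).
Proof.
  intros H. apply Clim_le with (fun n => Cmod c * Cmod (s n - l))%R.
  - intros n. replace (c * s n - c * l) with (c * (s n - l)) by ring.
    rewrite Cmod_mult. lra.
  - assert (H1 := is_lim_seq_scal_l _ (Cmod c) _ H). simpl in H1.
    rewrite Rmult_0_r in H1. exact H1.
Qed.

Lemma Clim_minus s t l m : Clim s l -> Clim t m -> Clim (fun n => s n - t n) (l - m).
Proof.
  intros H1 H2. replace (l - m) with (l + (-(1)) * m) by ring.
  eapply Clim_ext; [|exact (Clim_plus _ _ _ _ H1 (Clim_scal (-(1)) _ _ H2))].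
  intros n. simpl. ring.
Qed.

Lemma Clim_mult s t l m : Clim s l -> Clim t m -> Clim (fun n => s n * t n) (l * m).
Proof.
  intros H1 H2.
  apply Clim_le with (fun n => Cmod (s n - l) * Cmod (t n - m) +
    (Cmod (s n - l) * Cmod m + Cmod l * Cmod (t n - m)))%R.
  - intros n. replace (s n * t n - l * m) with
      ((s n - l) * (t n - m) + ((s n - l) * m + l * (t n - m))) by ring.
    eapply Rle_trans; [apply Cmod_triangle|]. rewrite Cmod_mult.
    apply Rplus_le_compat_l. eapply Rle_trans; [apply Cmod_triangle|].
    rewrite !Cmod_mult. lra.
  - replace 0%R with (0 * 0 + (0 * Cmod m + Cmod l * 0))%R by ring.
    apply is_lim_seq_plus'; [apply is_lim_seq_mult'; assumption|].
    apply is_lim_seq_plus'; apply is_lim_seq_mult'; try assumption; apply is_lim_seq_const.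
Qed.

Lemma Clim_incr s l : Clim (fun n => s (S n)) l -> Clim s l.
Proof. intros H. apply (is_lim_seq_incr_1 (fun n => Cmod (s n - l))). exact H. Qed.

Lemma Clim_Re s l : Clim s l -> is_lim_seq (fun n => Re (s n)) (Re l).
Proof.
  intros H. apply is_lim_seq_le_le with
    (u := fun n => (Re l - Cmod (s n - l))%R) (w := fun n => (Re l + Cmod (s n - l))%R).
  - intros n. assert (Hn := re_le_Cmod (s n - l)). rewrite Re_minus in Hn.
    apply Rabs_le_between in Hn. lra.
  - replace (Finite (Re l)) with (Finite (Re l - 0)) by (f_equal; ring).
    apply is_lim_seq_minus'; [apply is_lim_seq_const|exact H].
  - replace (Finite (Re l)) with (Finite (Re l + 0)) by (f_equal; ring).
    apply is_lim_seq_plus'; [apply is_lim_seq_const|exact H].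
Qed.

Lemma Clim_Im s l : Clim s l -> is_lim_seq (fun n => Im (s n)) (Im l).
Proof.
  intros H. assert (H1 := Clim_Re _ _ (Clim_scal (- Ci) _ _ H)).
  assert (E : forall z, Re (- Ci * z) = Im z).
  { intros [x y]; unfold Re, Im, Ci, Cmult, Copp; simpl; ring. }
  rewrite E in H1. eapply is_lim_seq_ext; [|exact H1]. intros n. simpl. apply E.
Qed.

Lemma Clim_CLim_seq s l : Clim s l -> CLim_seq s = l.
Proof.
  intros H. unfold CLim_seq.
  rewrite (is_lim_seq_unique _ _ (Clim_Re _ _ H)), (is_lim_seq_unique _ _ (Clim_Im _ _ H)).
  destruct l; reflexivity.
Qed.

Lemma abs_conv_Re f : abs_conv f -> ex_series (fun n => Re (f n)).
Proof.
  intros H. apply (ex_series_le (fun n => Re (f n)) (fun n => Cmod (f n))); [|exact H].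
  intros n. apply re_le_Cmod.
Qed.

Lemma abs_conv_Im f : abs_conv f -> ex_series (fun n => Im (f n)).
Proof.
  intros H. apply (ex_series_le (fun n => Im (f n)) (fun n => Cmod (f n))); [|exact H].
  intros n. apply Im_le_Cmod.
Qed.

Lemma CSeries_Clim f : abs_conv f -> Clim (Csum f) (CSeries f).
Proof.
  intros H. apply Clim_incr.
  apply Clim_le with (fun n =>
    Rabs (sum_n (fun i => Re (f i)) n - Series (fun i => Re (f i))) +
    Rabs (sum_n (fun i => Im (f i)) n - Series (fun i => Im (f i))))%R.
  - intros n. eapply Rle_trans; [apply Cmod_le_Re_Im|].
    rewrite Re_minus, Im_minus, Re_Csum, Im_Csum. unfold CSeries. simpl. lra.
  - assert (Hr := Series_correct _ (abs_conv_Re _ H)).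
    assert (Hi := Series_correct _ (abs_conv_Im _ H)).
    replace 0%R with (Rabs 0 + Rabs 0)%R by (rewrite Rabs_R0; ring).
    apply is_lim_seq_plus'.
    + apply (is_lim_seq_abs _ (Finite 0)).
      replace 0%R with (Series (fun i => Re (f i)) - Series (fun i => Re (f i)))%R by ring.
      apply is_lim_seq_minus'; [exact Hr|apply is_lim_seq_const].
    + apply (is_lim_seq_abs _ (Finite 0)).
      replace 0%R with (Series (fun i => Im (f i)) - Series (fun i => Im (f i)))%R by ring.
      apply is_lim_seq_minus'; [exact Hi|apply is_lim_seq_const].
Qed.

Lemma CSeries_unique f l : Clim (Csum f) l -> CSeries f = l.
Proof.
  intros H.
  assert (H1 : Clim (fun n => Csum f (S n)) l)
    by exact (proj1 (is_lim_seq_incr_1 (fun n => Cmod (Csum f n - l)) _) H).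
  unfold CSeries. rewrite (is_series_unique _ (Re l)), (is_series_unique _ (Im l)).
  - destruct l; reflexivity.
  - change (is_lim_seq (sum_n (fun n => Im (f n))) (Im l)).
    eapply is_lim_seq_ext; [|exact (Clim_Im _ _ H1)]. intros n. apply Im_Csum.
  - change (is_lim_seq (sum_n (fun n => Re (f n))) (Re l)).
    eapply is_lim_seq_ext; [|exact (Clim_Re _ _ H1)]. intros n. apply Re_Csum.
Qed.

Lemma CSeries_ext f g : (forall n, f n = g n) -> CSeries f = CSeries g.
Proof. intros H. unfold CSeries. f_equal; apply Series_ext; intros n; rewrite H; reflexivity. Qed.

Lemma abs_conv_le f (K : nat -> R) : (forall n, (Cmod (f n) <= K n)%R) -> ex_series K -> abs_conv f.
Proof.
  intros H HK. apply (ex_series_le (fun n => Cmod (f n)) K); [|exact HK].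
  intros n. change (Rabs (Cmod (f n)) <= K n)%R. rewrite Rabs_pos_eq; [apply H|apply Cmod_ge_0].
Qed.

Lemma abs_conv_ext f g : (forall n, f n = g n) -> abs_conv f -> abs_conv g.
Proof. intros H. apply ex_series_ext. intros n. rewrite H. reflexivity. Qed.

Lemma abs_conv_plus f g : abs_conv f -> abs_conv g -> abs_conv (fun n => f n + g n).
Proof.
  intros Hf Hg. eapply abs_conv_le; [|exact (ex_series_plus _ _ Hf Hg)].
  intros n. apply Cmod_triangle.
Qed.

Lemma CSeries_plus f g : abs_conv f -> abs_conv g ->
  CSeries (fun n => f n + g n) = CSeries f + CSeries g.
Proof.
  intros Hf Hg. apply CSeries_unique.
  eapply Clim_ext; [|exact (Clim_plus _ _ _ _ (CSeries_Clim _ Hf) (CSeries_Clim _ Hg))].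
  intros n. symmetry. apply Csum_plus.
Qed.

Lemma CSeries_scal c f : abs_conv f -> CSeries (fun n => c * f n) = c * CSeries f.
Proof.
  intros Hf. apply CSeries_unique.
  eapply Clim_ext; [|exact (Clim_scal c _ _ (CSeries_Clim _ Hf))].
  intros n. symmetry. apply Csum_scal.
Qed.

Lemma abs_conv_incr f : abs_conv (fun n => f (S n)) -> abs_conv f.
Proof. intros H. apply (ex_series_incr_1 (fun n => Cmod (f n))). exact H. Qed.

Lemma abs_conv_decr f : abs_conv f -> abs_conv (fun n => f (S n)).
Proof. intros H. apply (ex_series_incr_1 (fun n => Cmod (f n))) in H. exact H. Qed.

Lemma CSeries_first f : abs_conv f -> CSeries f = f O + CSeries (fun n => f (S n)).
Proof.
  intros Hf. apply CSeries_unique, Clim_incr.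
  eapply Clim_ext; [|exact (Clim_plus _ _ _ _ (Clim_const (f O))
    (CSeries_Clim _ (abs_conv_decr _ Hf)))].
  intros n. symmetry. apply Csum_first.
Qed.

Lemma CSeries_bound f (K : nat -> R) : (forall n, (Cmod (f n) <= K n)%R) -> ex_series K ->
  (Cmod (CSeries f) <= Series K)%R.
Proof.
  intros H HK. pose proof (CSeries_Clim _ (abs_conv_le _ _ H HK)) as L.
  assert (B : forall n, (Cmod (Csum f (S n)) <= sum_n K n)%R).
  { induction n as [|n IH].
    - rewrite sum_O. simpl Csum. rewrite Cplus_0_l. apply H.
    - rewrite sum_Sn. simpl Csum. eapply Rle_trans; [apply Cmod_triangle|].
      apply Rplus_le_compat; [exact IH|apply H]. }
  apply (proj1 (is_lim_seq_incr_1 _ _)) in L.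
  assert (M := is_lim_seq_plus' _ _ _ _ (Series_correct _ HK) L).
  assert (Hle : Rbar_le (Cmod (CSeries f)) (Series K + 0)%R).
  { refine (is_lim_seq_le (fun _ => Cmod (CSeries f)) _ _ _ _ (is_lim_seq_const _) M).
    intros n. specialize (B n).
    replace (CSeries f) with (Csum f (S n) - (Csum f (S n) - CSeries f)) at 1 by ring.
    eapply Rle_trans; [apply Cmod_triangle_minus|].
    apply Rplus_le_compat_r. exact B. }
  simpl in Hle. lra.
Qed.

(** Multiplying by the variable and differentiating turns the coefficients [(n + 1)^p] into
    [(n + 1)^(p + 1)] and keeps the radius of convergence, so the induction starts from the
    geometric series. *)
Lemma ex_series_poly_geom p (r : R) : (0 <= r < 1)%R -> ex_series (fun n => INR (S n) ^ p * r ^ n)%R.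
Proof.
  intros Hr.
  assert (R1 : CV_radius (fun _ => 1%R) = 1%R).
  { replace (Finite 1) with (Finite (/ 1)) by (f_equal; field).
    apply CV_radius_finite_DAlembert.
    - intros; lra.
    - lra.
    - apply is_lim_seq_ext with (fun _ => 1%R); [|apply is_lim_seq_const].
      intros n. unfold Rdiv. rewrite Rinv_1, Rmult_1_r, Rabs_R1. reflexivity. }
  assert (Rp : CV_radius (fun n => INR (S n) ^ p)%R = 1%R).
  { induction p as [|p IH]; [exact R1|].
    transitivity (CV_radius (PS_derive (PS_incr_1 (fun n => INR (S n) ^ p)%R))).
    2: { rewrite CV_radius_derive, CV_radius_incr_1. exact IH. }
    apply CV_radius_ext. intros n. unfold PS_derive, PS_incr_1. simpl. reflexivity. }
  apply ex_series_ext with (fun n => Rabs (INR (S n) ^ p * r ^ n)).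
  { intros n. apply Rabs_pos_eq. apply Rmult_le_pos; apply pow_le; [apply pos_INR|lra]. }
  apply CV_disk_inside. rewrite Rp. simpl. rewrite Rabs_pos_eq; lra.
Qed.

(** The weights allowed in the sums over [q ^ n]. With [INR n] in place of [INR (S n)], a positive
    exponent would force [w 0 = 0]. *)
Definition poly_bdd (w : nat -> C) : Prop :=
  exists (K : R) (p : nat), (0 <= K)%R /\ forall n, (Cmod (w n) <= K * INR (S n) ^ p)%R.

Lemma INR_S_ge1 n : (1 <= INR (S n))%R.
Proof. rewrite S_INR. pose proof (pos_INR n). lra. Qed.

Lemma poly_bdd_le w (K : R) : (forall n, (Cmod (w n) <= K)%R) -> poly_bdd w.
Proof.
  intros H. exists K, O. split.
  - eapply Rle_trans; [apply (Cmod_ge_0 (w O))|apply H].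
  - intros n; simpl. rewrite Rmult_1_r. apply H.
Qed.

Lemma poly_bdd_INR : poly_bdd (fun n => INR n).
Proof.
  exists 1%R, 1%nat. split; [lra|]. intros n. rewrite Cmod_R, Rabs_pos_eq by apply pos_INR.
  rewrite pow_1, S_INR. lra.
Qed.

Lemma poly_bdd_mult v w : poly_bdd v -> poly_bdd w -> poly_bdd (fun n => v n * w n).
Proof.
  intros [K [p [HK B]]] [L [m [HL D]]]. exists (K * L)%R, (p + m)%nat. split; [nra|].
  intros n. rewrite Cmod_mult, pow_add.
  replace (K * L * (INR (S n) ^ p * INR (S n) ^ m))%R with
    ((K * INR (S n) ^ p) * (L * INR (S n) ^ m))%R by ring.
  apply Rmult_le_compat; auto using Cmod_ge_0.
Qed.

Lemma poly_bdd_plus v w : poly_bdd v -> poly_bdd w -> poly_bdd (fun n => v n + w n).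
Proof.
  intros [K [p [HK B]]] [L [m [HL D]]]. exists (K + L)%R, (p + m)%nat. split; [lra|].
  intros n. eapply Rle_trans; [apply Cmod_triangle|].
  rewrite Rmult_plus_distr_r.
  pose proof (INR_S_ge1 n) as H1.
  apply Rplus_le_compat.
  - eapply Rle_trans; [apply B|]. apply Rmult_le_compat_l; [exact HK|].
    apply Rle_pow; [exact H1|lia].
  - eapply Rle_trans; [apply D|]. apply Rmult_le_compat_l; [exact HL|].
    apply Rle_pow; [exact H1|lia].
Qed.

Lemma poly_bdd_scal c w : poly_bdd w -> poly_bdd (fun n => c * w n).
Proof. apply (poly_bdd_mult (fun _ => c)). apply (poly_bdd_le _ (Cmod c)). intros; lra. Qed.

Lemma poly_bdd_pow w k : poly_bdd w -> poly_bdd (fun n => w n ^ k).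
Proof.
  intros H. induction k as [|k IH].
  - apply (poly_bdd_le _ 1). intros n. simpl. rewrite Cmod_1. lra.
  - simpl. apply poly_bdd_mult; assumption.
Qed.

Lemma poly_bdd_shift w : poly_bdd w -> poly_bdd (fun n => w (S n)).
Proof.
  intros [L [p [HL D]]].
  exists (L * 2 ^ p)%R, p. split; [apply Rmult_le_pos; [exact HL|apply pow_le; lra]|].
  intros n. eapply Rle_trans; [apply D|]. rewrite Rmult_assoc, <- Rpow_mult_distr.
  apply Rmult_le_compat_l; [exact HL|]. apply pow_incr.
  rewrite !S_INR. pose proof (pos_INR n); lra.
Qed.

Lemma abs_conv_poly_geom w f (K r : R) : (0 <= r < 1)%R -> poly_bdd w ->
  (forall n, (Cmod (f n) <= K * r ^ n)%R) -> abs_conv (fun n => w n * f n).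
Proof.
  intros Hr [L [p [HL B]]] H.
  eapply abs_conv_le; [|exact (ex_series_scal_l (L * K)%R _ (ex_series_poly_geom p r Hr))].
  intros n. rewrite Cmod_mult. change (scal ?a ?b) with (a * b)%R.
  replace (L * K * (INR (S n) ^ p * r ^ n))%R with ((L * INR (S n) ^ p) * (K * r ^ n))%R by ring.
  apply Rmult_le_compat; auto using Cmod_ge_0.
Qed.

(** Quadratic remainder bounds on the terms, with summable constants, add up to a quadratic
    remainder bound for the series; this replaces uniform convergence of the derivatives. *)
Lemma series_Cder (g : nat -> C -> C) (g' : nat -> C) (K : nat -> R) (z : C) (d : R) :
  (0 < d)%R -> ex_series K -> abs_conv g' ->
  (forall w, (Cmod (w - z) < d)%R -> abs_conv (fun n => g n w)) ->
  (forall n w, (Cmod (w - z) < d)%R ->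
     (Cmod (g n w - g n z - g' n * (w - z)) <= K n * (Cmod (w - z) * Cmod (w - z)))%R) ->
  Cder (fun w => CSeries (fun n => g n w)) z (CSeries g').
Proof.
  intros Hd HK Hg' Hg Hq eps Heps.
  assert (Hz : (Cmod (z - z) < d)%R).
  { replace (z - z) with (RtoC 0) by ring. rewrite Cmod_0. exact Hd. }
  set (S := Series K).
  assert (HS : (0 < Rabs S + 1)%R) by (pose proof (Rabs_pos S); lra).
  exists (Rmin d (eps / (Rabs S + 1))). split.
  { apply Rmin_pos; [exact Hd|]. apply Rdiv_lt_0_compat; assumption. }
  intros w Hw.
  assert (Hw1 : (Cmod (w - z) < d)%R) by (eapply Rlt_le_trans; [exact Hw|apply Rmin_l]).
  assert (Hw2 : (Cmod (w - z) < eps / (Rabs S + 1))%R) by (eapply Rlt_le_trans; [exact Hw|apply Rmin_r]).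
  set (h := Cmod (w - z)) in *. assert (Hh : (0 <= h)%R) by apply Cmod_ge_0.
  assert (E : CSeries (fun n => g n w) - CSeries (fun n => g n z) - CSeries g' * (w - z)
     = CSeries (fun n => g n w - g n z - g' n * (w - z))).
  { symmetry. apply CSeries_unique.
    eapply Clim_ext; [|exact (Clim_minus _ _ _ _
       (Clim_minus _ _ _ _ (CSeries_Clim _ (Hg w Hw1)) (CSeries_Clim _ (Hg z Hz)))
       (Clim_mult _ _ _ _ (CSeries_Clim _ Hg') (Clim_const (w - z))))].
    intros n. simpl. induction n as [|n IH]; simpl; [ring|].
    rewrite <- IH. ring. }
  rewrite E.
  eapply Rle_trans.
  { apply (CSeries_bound _ (fun n => (h * h) * K n)%R).
    - intros n. rewrite Rmult_comm. apply Hq. exact Hw1.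
    - exact (ex_series_scal_l (h * h)%R K HK). }
  rewrite Series_scal_l. fold S.
  rewrite Rmult_assoc, (Rmult_comm eps). apply Rmult_le_compat_l; [exact Hh|].
  apply Rle_trans with (h * (Rabs S + 1))%R.
  { apply Rmult_le_compat_l; [exact Hh|]. pose proof (Rle_abs S). lra. }
  apply Rmult_le_reg_r with (/ (Rabs S + 1))%R; [apply Rinv_0_lt_compat; lra|].
  rewrite Rmult_assoc, Rinv_r, Rmult_1_r by lra. lra.
Qed.

(** * Sums of [w_n h (q^n)] *)

Lemma pow_le_base (r : R) n : (0 <= r <= 1)%R -> (r ^ S n <= r)%R.
Proof.
  intros Hr. simpl. rewrite <- (Rmult_1_r r) at 3. apply Rmult_le_compat_l; [lra|].
  rewrite <- (pow1 n). apply pow_incr. exact Hr.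
Qed.

Lemma Cpow_le (x : C) (r : R) n : (Cmod x <= r)%R -> (Cmod (x ^ n) <= r ^ n)%R.
Proof. intros H. rewrite Cmod_pow. apply pow_incr. split; [apply Cmod_ge_0|exact H]. Qed.

(** Here and in the second order bound that follows, the powers of [r] on the left stand for the
    exponents [n - 1] and [n - 2] on the right, so that small [n] need no exception. *)
Lemma Cpow_diff_bound (x y : C) (r : R) n : (0 <= r)%R -> (Cmod x <= r)%R -> (Cmod y <= r)%R ->
  (r * Cmod (y ^ n - x ^ n) <= INR n * r ^ n * Cmod (y - x))%R.
Proof.
  intros Hr Hx Hy. pose proof (Cmod_ge_0 (y - x)) as Hd.
  induction n as [|n IH].
  - replace (y ^ 0 - x ^ 0) with (RtoC 0) by (simpl; ring). rewrite Cmod_0. simpl. lra.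
  - replace (y ^ S n - x ^ S n) with (y * (y ^ n - x ^ n) + x ^ n * (y - x)) by (simpl; ring).
    rewrite S_INR. simpl pow.
    assert (I : (Cmod (y * (y ^ n - x ^ n) + x ^ n * (y - x))
        <= r * Cmod (y ^ n - x ^ n) + r ^ n * Cmod (y - x))%R).
    { eapply Rle_trans; [apply Cmod_triangle|]. rewrite !Cmod_mult.
      apply Rplus_le_compat; apply Rmult_le_compat_r; auto using Cmod_ge_0.
      apply Cpow_le, Hx. }
    apply (Rmult_le_compat_l r) in I; [|exact Hr].
    apply (Rmult_le_compat_l r) in IH; [|exact Hr]. nra.
Qed.

Lemma Cpow_taylor_bound (x y : C) (r : R) n : (0 <= r)%R -> (Cmod x <= r)%R -> (Cmod y <= r)%R ->
  (r * r * Cmod (y ^ n - x ^ n - INR n * x ^ pred n * (y - x))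
    <= INR n * INR n * r ^ n * (Cmod (y - x) * Cmod (y - x)))%R.
Proof.
  intros Hr Hx Hy. set (d := Cmod (y - x)). assert (Hd : (0 <= d)%R) by apply Cmod_ge_0.
  assert (B0 : forall n, (0 <= r ^ n * (d * d))%R).
  { intros m. apply Rmult_le_pos; [apply pow_le, Hr|nra]. }
  induction n as [|n IH].
  - replace (y ^ 0 - x ^ 0 - INR 0 * x ^ pred 0 * (y - x)) with (RtoC 0) by (simpl; ring).
    rewrite Cmod_0. simpl. lra.
  - assert (E : y ^ S n - x ^ S n - INR (S n) * x ^ pred (S n) * (y - x)
      = y * (y ^ n - x ^ n - INR n * x ^ pred n * (y - x))
        + INR n * x ^ pred n * ((y - x) * (y - x))).
    { rewrite S_INR, RtoC_plus. destruct n as [|n]; simpl pred; rewrite !Cpow_S; simpl; ring. }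
    rewrite E. set (e := Cmod (y ^ n - x ^ n - INR n * x ^ pred n * (y - x))) in *.
    assert (I : (r * r * Cmod (INR n * x ^ pred n * ((y - x) * (y - x))) <= INR n * r ^ S n * (d * d))%R).
    { rewrite !Cmod_mult, Cmod_R, (Rabs_pos_eq (INR n)) by apply pos_INR. fold d.
      destruct n as [|n].
      - simpl. lra.
      - simpl pred. assert (P := Cpow_le x r n Hx).
        replace (INR (S n) * r ^ S (S n) * (d * d))%R
          with (r * r * (INR (S n) * r ^ n * (d * d)))%R by (simpl; ring).
        apply Rmult_le_compat_l; [nra|]. apply Rmult_le_compat_r; [nra|].
        apply Rmult_le_compat_l; [apply pos_INR|exact P]. }
    assert (I2 : (Cmod (y * (y ^ n - x ^ n - INR n * x ^ pred n * (y - x))) <= r * e)%R).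
    { rewrite Cmod_mult. fold e. apply Rmult_le_compat_r; [apply Cmod_ge_0|exact Hy]. }
    eapply Rle_trans.
    { apply Rmult_le_compat_l; [nra|]. apply Cmod_triangle. }
    rewrite Rmult_plus_distr_l.
    assert (I3 : (r * r * Cmod (y * (y ^ n - x ^ n - INR n * x ^ pred n * (y - x)))
       <= r * (INR n * INR n * r ^ n * (d * d)))%R).
    { apply Rle_trans with (r * (r * r * e))%R; [|apply Rmult_le_compat_l; assumption].
      replace (r * (r * r * e))%R with (r * r * (r * e))%R by ring.
      apply Rmult_le_compat_l; [nra|exact I2]. }
    rewrite S_INR. specialize (B0 (S n)). simpl pow in *. pose proof (pos_INR n) as Hn.
    assert (0 <= (INR n + 1) * (r * r ^ n * (d * d)))%R by (apply Rmult_le_pos; lra).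
    nra.
Qed.

(* [h] is holomorphic on the unit disc with derivative [h'] and [h 0 = 0], in
   the quantitative form that makes [sum_n w_n h (q^n)] differentiable. *)
Definition nice (h h' : C -> C) : Prop :=
  forall r : R, (0 < r < 1)%R -> exists K : R, (0 <= K)%R /\
    forall x y : C, (Cmod x <= r)%R -> (Cmod y <= r)%R ->
      (Cmod (h x) <= K * Cmod x)%R /\ (Cmod (h' x) <= K)%R /\
      (Cmod (h y - h x - h' x * (y - x)) <= K * (Cmod (y - x) * Cmod (y - x)))%R.

Definition PSum (w : nat -> C) (h : C -> C) (q : C) : C := CSeries (fun n => w n * h (q ^ n)).

Lemma PSum_abs_conv w h h' q : nice h h' -> poly_bdd w -> (Cmod q < 1)%R ->
  abs_conv (fun n => w n * h (q ^ n)).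
Proof.
  intros Hh Hw Hq. pose proof (Cmod_ge_0 q) as Aq.
  set (r := ((Cmod q + 1) / 2)%R).
  destruct (Hh r) as [K [HK B]]; [unfold r; lra|].
  apply (abs_conv_poly_geom w _ (K + Cmod (h 1))%R (Cmod q)); [lra|exact Hw|].
  intros n. pose proof (Cmod_ge_0 (h 1)) as A1. destruct n as [|n].
  - simpl. lra.
  - destruct (B (q ^ S n) 0) as [B1 _].
    + rewrite Cmod_pow. eapply Rle_trans; [apply pow_le_base; lra|unfold r; lra].
    + rewrite Cmod_0; unfold r; lra.
    + eapply Rle_trans; [exact B1|]. rewrite Cmod_pow.
      apply Rmult_le_compat_r; [apply pow_le, Aq|lra].
Qed.

Lemma PSum_Cder w h h' q : nice h h' -> poly_bdd w -> (Cmod q < 1)%R ->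
  Cder (PSum w h) q (CSeries (fun n => w n * (h' (q ^ n) * (INR n * q ^ pred n)))).
Proof.
  intros Hh Hw Hq. pose proof (Cmod_ge_0 q) as Aq.
  set (r := ((Cmod q + 1) / 2)%R). assert (Hr : (0 < r < 1)%R) by (unfold r; lra).
  destruct (Hh r Hr) as [K [HK B]].
  assert (Bp : forall x n, (Cmod x <= r)%R -> (Cmod (x ^ S n) <= r)%R).
  { intros x n Hx. eapply Rle_trans; [apply Cpow_le, Hx|apply pow_le_base; lra]. }
  assert (Hn : poly_bdd (fun n => w n * (INR n * INR n))).
  { apply poly_bdd_mult; [exact Hw|apply poly_bdd_mult; apply poly_bdd_INR]. }
  assert (Hd : forall w0, (Cmod (w0 - q) < r - Cmod q)%R -> (Cmod w0 <= r)%R).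
  { intros x Hx. replace x with ((x - q) + q) by ring.
    eapply Rle_trans; [apply Cmod_triangle|]. lra. }
  unfold PSum.
  (* The factor 2 counts two errors, the remainder of [h] and that of the power; apart from the
     weight, each is at most [K / (r * r)] times [n^2 r^n |x - q|^2]. *)
  apply (series_Cder (fun n x => w n * h (x ^ n)) _
    (fun n => (2 * K / (r * r)) * (Cmod (w n * (INR n * INR n)) * r ^ n))%R _ (r - Cmod q)).
  - unfold r; lra.
  - apply (ex_series_scal_l (2 * K / (r * r))%R (fun n => Cmod (w n * (INR n * INR n)) * r ^ n)%R).
    assert (Hc := abs_conv_poly_geom (fun n => w n * (INR n * INR n)) (fun n => (r : C) ^ n) 1 r).
    eapply ex_series_ext; [|apply Hc; [lra|exact Hn|]].
    + intros n. simpl. rewrite (Cmod_mult _ (r ^ n)), Cmod_pow, Cmod_R, (Rabs_pos_eq r) by lra. reflexivity.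
    + intros n. rewrite Cmod_pow, Cmod_R, (Rabs_pos_eq r) by lra. lra.
  - apply (abs_conv_ext (fun n => (w n * INR n) * (h' (q ^ n) * q ^ pred n))).
    { intros n; ring. }
    apply (abs_conv_poly_geom _ _ ((K + Cmod (h' 1)) / r)%R r); [lra| |].
    { apply poly_bdd_mult; [exact Hw|apply poly_bdd_INR]. }
    intros n. rewrite Cmod_mult. pose proof (Cmod_ge_0 (h' 1)) as A1.
    destruct n as [|n]; simpl pred.
    + simpl Cpow. rewrite Cmod_1. simpl pow.
      apply Rmult_le_reg_r with r; [lra|]. field_simplify; [|lra]. nra.
    + replace ((K + Cmod (h' 1)) / r * r ^ S n)%R with ((K + Cmod (h' 1)) * r ^ n)%R
        by (simpl; field; lra).
      apply Rmult_le_compat; auto using Cmod_ge_0.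
      * destruct (B (q ^ S n) 0) as [_ [B2 _]]; [apply Bp; unfold r; lra|rewrite Cmod_0; lra|]. lra.
      * apply Cpow_le. unfold r; lra.
  - intros x Hx. apply (PSum_abs_conv _ _ h'); [exact Hh|exact Hw|].
    specialize (Hd x Hx). lra.
  - intros n x Hx. specialize (Hd x Hx).
    (* [x ^ 0 = 1] lies outside the range controlled by [nice], but the term of index 0 does not
       depend on [x]. *)
    destruct n as [|n].
    { simpl. replace (w 0%nat * h 1 - w 0%nat * h 1 - w 0%nat * (h' 1 * (0 * 1)) * (x - q))
        with (RtoC 0) by ring.
      rewrite Cmod_0. apply Rmult_le_pos; [|apply Rmult_le_pos; apply Cmod_ge_0].
      apply Rmult_le_pos; [|apply Rmult_le_pos; [apply Cmod_ge_0|lra]].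
      apply Rdiv_le_0_compat; nra. }
    set (m := S n) in *. set (d := Cmod (x - q)). assert (Ad : (0 <= d)%R) by apply Cmod_ge_0.
    assert (Hq' : (Cmod q <= r)%R) by (unfold r; lra).
    destruct (B (q ^ m) (x ^ m)) as [_ [B2 B3]]; [apply Bp, Hq'|apply Bp, Hd|].
    replace (w m * h (x ^ m) - w m * h (q ^ m) - w m * (h' (q ^ m) * (INR m * q ^ pred m)) * (x - q))
      with (w m * ((h (x ^ m) - h (q ^ m) - h' (q ^ m) * (x ^ m - q ^ m))
         + h' (q ^ m) * (x ^ m - q ^ m - INR m * q ^ pred m * (x - q)))) by ring.
    assert (T1 := Cpow_diff_bound q x r m (Rlt_le _ _ (proj1 Hr)) Hq' Hd).
    assert (T2 := Cpow_taylor_bound q x r m (Rlt_le _ _ (proj1 Hr)) Hq' Hd).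
    fold d in T1, T2.
    set (e1 := Cmod (x ^ m - q ^ m)) in *.
    set (e2 := Cmod (x ^ m - q ^ m - INR m * q ^ pred m * (x - q))) in *.
    assert (Ae1 : (0 <= e1)%R) by apply Cmod_ge_0. assert (Ae2 : (0 <= e2)%R) by apply Cmod_ge_0.
    rewrite !Cmod_mult, Cmod_R, (Rabs_pos_eq (INR m)) by apply pos_INR.
    replace (2 * K / (r * r) * (Cmod (w m) * (INR m * INR m) * r ^ m) * (d * d))%R
      with (Cmod (w m) * (2 * K / (r * r) * (INR m * INR m * r ^ m * (d * d))))%R by ring.
    apply Rmult_le_compat_l; [apply Cmod_ge_0|].
    eapply Rle_trans; [apply Cmod_triangle|]. rewrite Cmod_mult. fold e2.
    apply Rle_trans with (K * (e1 * e1) + K * e2)%R.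
    { apply Rplus_le_compat; [exact B3|]. apply Rmult_le_compat_r; assumption. }
    set (M := (INR m * INR m * r ^ m * (d * d))%R) in *.
    assert (Prm : (0 <= r ^ m)%R) by (apply pow_le; lra).
    assert (Prm1 : (r ^ m <= 1)%R) by (rewrite <- (pow1 m); apply pow_incr; lra).
    assert (T3 : (r * r * (e1 * e1) <= M)%R).
    { assert (T4 : ((r * e1) * (r * e1) <= (INR m * r ^ m * d) * (INR m * r ^ m * d))%R)
        by (apply Rmult_le_compat; nra).
      apply Rle_trans with (r ^ m * M)%R; [unfold M; nra|].
      rewrite <- (Rmult_1_l M) at 2. apply Rmult_le_compat_r; [|exact Prm1].
      unfold M. apply Rmult_le_pos; [apply Rmult_le_pos; [apply Rmult_le_pos; apply pos_INR|exact Prm]|nra]. }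
    apply Rmult_le_reg_l with (r * r)%R; [nra|].
    replace (r * r * (2 * K / (r * r) * M))%R with (K * M + K * M)%R by (field; lra).
    replace (r * r * (K * (e1 * e1) + K * e2))%R with (K * (r * r * (e1 * e1)) + K * (r * r * e2))%R by ring.
    apply Rplus_le_compat; apply Rmult_le_compat_l; assumption.
Qed.

(* The derivation [q d/dq]. *)
Definition Dd (f : C -> C) (q l : C) : Prop := exists l', Cder f q l' /\ q * l' = l.

Lemma Dd_eq f q l m : Dd f q l -> l = m -> Dd f q m.
Proof. intros H <-; exact H. Qed.

Lemma Dd_ext f g q l : (forall x, f x = g x) -> Dd f q l -> Dd g q l.
Proof. intros E [l' [H1 H2]]. exists l'. split; [eapply Cder_ext; eauto|exact H2]. Qed.

Lemma Dd_ext_loc f g q l (r : R) : (0 < r)%R ->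
  (forall x, (Cmod (x - q) < r)%R -> f x = g x) -> Dd f q l -> Dd g q l.
Proof. intros Hr E [l' [H1 H2]]. exists l'. split; [eapply Cder_ext_loc; eauto|exact H2]. Qed.

Lemma Dd_cont f q l : Dd f q l -> Ccont f q.
Proof. intros [l' [H1 _]]. exact (Cder_cont _ _ _ H1). Qed.

Lemma Dd_unique f q l m : Dd f q l -> Dd f q m -> l = m.
Proof. intros [l' [H1 <-]] [m' [H2 <-]]. f_equal. exact (Cder_unique _ _ _ _ H1 H2). Qed.

Lemma Dd_const c q : Dd (fun _ => c) q 0.
Proof. exists 0. split; [apply Cder_const|ring]. Qed.

Lemma Dd_id q : Dd (fun x => x) q q.
Proof. exists 1. split; [apply Cder_id|ring]. Qed.

Lemma Dd_plus f g q l m : Dd f q l -> Dd g q m -> Dd (fun x => f x + g x) q (l + m).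
Proof.
  intros [l' [H1 <-]] [m' [H2 <-]]. eexists. split; [apply Cder_plus; eassumption|ring].
Qed.

Lemma Dd_minus f g q l m : Dd f q l -> Dd g q m -> Dd (fun x => f x - g x) q (l - m).
Proof.
  intros [l' [H1 <-]] [m' [H2 <-]]. eexists. split; [apply Cder_minus; eassumption|ring].
Qed.

Lemma Dd_mult f g q l m : Dd f q l -> Dd g q m ->
  Dd (fun x => f x * g x) q (l * g q + f q * m).
Proof.
  intros [l' [H1 <-]] [m' [H2 <-]]. eexists. split; [apply Cder_mult; eassumption|ring].
Qed.

Lemma Dd_scal c f q l : Dd f q l -> Dd (fun x => c * f x) q (c * l).
Proof. intros [l' [H1 <-]]. eexists. split; [apply Cder_scal; eassumption|ring]. Qed.

Lemma Dd_pow f q l n : Dd f q l -> Dd (fun x => f x ^ S n) q (INR (S n) * f q ^ n * l).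
Proof. intros [l' [H1 <-]]. eexists. split; [apply Cder_pow; eassumption|ring]. Qed.

Lemma Dd_div (f g : C -> C) (q l m : C) : g q <> 0 -> Dd f q l -> Dd g q m ->
  Dd (fun x => f x / g x) q ((l * g q - f q * m) / (g q * g q)).
Proof.
  intros H0 [l' [H1 <-]] [m' [H2 <-]]. eexists. split; [apply Cder_div; eassumption|].
  field; exact H0.
Qed.

Lemma Dd_comp f g q l m : Dd g q m -> Cder f (g q) l -> Dd (fun x => f (g x)) q (l * m).
Proof.
  intros [m' [H2 <-]] H. eexists. split; [apply Cder_comp; eassumption|ring].
Qed.

Lemma Dd_cube f q l : Dd f (q ^ 3) l -> Dd (fun x => f (x ^ 3)) q (3 * l).
Proof.
  intros [l' [H <-]]. eapply Dd_eq.
  - apply (Dd_comp f (fun x => x ^ 3)); [apply Dd_pow, Dd_id|exact H].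
  - simpl INR. rewrite !RtoC_plus. simpl Cpow. ring.
Qed.

Lemma PSum_Dd w h h' q : nice h h' -> poly_bdd w -> (Cmod q < 1)%R ->
  Dd (PSum w h) q (PSum (fun n => INR n * w n) (fun x => x * h' x) q).
Proof.
  intros Hh Hw Hq. exists (CSeries (fun n => w n * (h' (q ^ n) * (INR n * q ^ pred n)))).
  split; [apply PSum_Cder; assumption|]. unfold PSum. rewrite <- CSeries_scal.
  - apply CSeries_ext. intros [|n]; simpl pred; simpl Cpow; [simpl INR|]; ring.
  - pose proof (Cmod_ge_0 q) as Aq.
    set (r := ((Cmod q + 1) / 2)%R).
    destruct (Hh r) as [K [HK B]]; [unfold r; lra|].
    apply (abs_conv_ext (fun n => (w n * INR n) * (h' (q ^ n) * q ^ pred n))).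
    { intros n; ring. }
    apply abs_conv_incr.
    apply (abs_conv_ext (fun n => (w (S n) * INR (S n)) * (h' (q ^ S n) * q ^ n))).
    { reflexivity. }
    apply (abs_conv_poly_geom (fun n => w (S n) * INR (S n)) _ K (Cmod q)); [lra| |].
    + exact (poly_bdd_shift _ (poly_bdd_mult _ _ Hw poly_bdd_INR)).
    + intros n. rewrite Cmod_mult, Cmod_pow. apply Rmult_le_compat_r; [apply pow_le, Aq|].
      destruct (B (q ^ S n) 0) as [_ [B2 _]]; [|rewrite Cmod_0; unfold r; lra|exact B2].
      rewrite Cmod_pow. eapply Rle_trans; [apply pow_le_base; lra|unfold r; lra].
Qed.

(** * The functions [x], [x / (1 - x)] and [- log (1 - x)] *)

Lemma Cmod_1_minus (x : C) (r : R) : (Cmod x <= r)%R -> (1 - r <= Cmod (1 - x))%R.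
Proof.
  intros H. assert (I : (Cmod 1 <= Cmod (1 - x) + Cmod x)%R).
  { replace (RtoC 1) with ((1 - x) + x) at 1 by ring. apply Cmod_triangle. }
  rewrite Cmod_1 in I. lra.
Qed.

Lemma one_minus_neq0 (x : C) : (Cmod x < 1)%R -> 1 - x <> 0.
Proof. intros H. apply Cmod_gt_0. pose proof (Cmod_1_minus x _ (Rle_refl _)). lra. Qed.

Lemma nice_id : nice (fun x => x) (fun _ => 1).
Proof.
  intros r Hr. exists 1%R. split; [lra|]. intros x y _ _. repeat split.
  - lra.
  - rewrite Cmod_1; lra.
  - replace (y - x - 1 * (y - x)) with (RtoC 0) by ring. rewrite Cmod_0, Rmult_1_l.
    apply Rmult_le_pos; apply Cmod_ge_0.
Qed.

Definition geo (x : C) : C := x / (1 - x).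

Lemma nice_geo : nice geo (fun x => / ((1 - x) * (1 - x))).
Proof.
  intros r Hr. set (k := (/ (1 - r))%R).
  assert (Hk : (1 < k)%R).
  { unfold k. rewrite <- Rinv_1. apply Rinv_lt_contravar; lra. }
  assert (Hi : forall x, (Cmod x <= r)%R -> (Cmod (/ (1 - x)) <= k)%R).
  { intros x Hx. pose proof (Cmod_1_minus x r Hx).
    rewrite Cmod_inv by (apply one_minus_neq0; lra).
    apply Rinv_le_contravar; lra. }
  assert (Hk2 : (k <= k * (k * k))%R) by nra.
  exists (k * (k * k))%R. split; [nra|]. intros x y Hx Hy.
  assert (Nx : 1 - x <> 0) by (apply one_minus_neq0; lra).
  assert (Ny : 1 - y <> 0) by (apply one_minus_neq0; lra).
  specialize (Hi x Hx) as Ix. specialize (Hi y Hy) as Iy.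
  repeat split.
  - unfold geo, Cdiv. rewrite Cmod_mult, Rmult_comm.
    apply Rmult_le_compat_r; [apply Cmod_ge_0|lra].
  - replace (/ ((1 - x) * (1 - x))) with (/ (1 - x) * / (1 - x)) by (field; exact Nx).
    rewrite Cmod_mult. apply Rle_trans with (k * k)%R; [|nra].
    apply Rmult_le_compat; auto using Cmod_ge_0.
  - unfold geo.
    replace (y / (1 - y) - x / (1 - x) - / ((1 - x) * (1 - x)) * (y - x))
      with (/ (1 - y) * (/ (1 - x) * / (1 - x)) * ((y - x) * (y - x))) by (field; split; assumption).
    rewrite !Cmod_mult. apply Rmult_le_compat_r; [apply Rmult_le_pos; apply Cmod_ge_0|].
    apply Rmult_le_compat; auto using Cmod_ge_0.
    + apply Rmult_le_pos; apply Cmod_ge_0.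
    + apply Rmult_le_compat; auto using Cmod_ge_0.
Qed.

Definition PS (w : nat -> C) (z : C) : C := CSeries (fun n => w n * z ^ n).

Lemma PS_abs_conv w z : poly_bdd w -> (Cmod z < 1)%R -> abs_conv (fun n => w n * z ^ n).
Proof. exact (PSum_abs_conv w _ _ z nice_id). Qed.

Lemma PS_Cder w z : poly_bdd w -> (Cmod z < 1)%R ->
  Cder (PS w) z (CSeries (fun n => w n * (INR n * z ^ pred n))).
Proof.
  intros Hw Hz. pose proof (PSum_Cder w _ _ z nice_id Hw Hz) as H.
  erewrite CSeries_ext; [exact H|]. intros n. simpl. ring.
Qed.

Lemma PS_Dd w z : poly_bdd w -> (Cmod z < 1)%R -> Dd (PS w) z (PS (fun n => INR n * w n) z).
Proof.
  intros Hw Hz. eapply Dd_eq; [exact (PSum_Dd w _ _ z nice_id Hw Hz)|].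
  apply CSeries_ext. intros n. simpl. ring.
Qed.

Lemma PS_0 w : PS w 0 = w O.
Proof.
  apply CSeries_unique. apply Clim_incr. apply Clim_ext with (fun _ => w O); [|apply Clim_const].
  intros n. rewrite Csum_first. rewrite (Csum_ext _ (fun _ => 0 * 0)), Csum_scal.
  - simpl. ring.
  - intros i _. simpl. ring.
Qed.

Lemma geometric_Clim (z : C) : (Cmod z < 1)%R -> Clim (Csum (fun n => z ^ n)) (/ (1 - z)).
Proof.
  intros Hz. pose proof (one_minus_neq0 z Hz) as N.
  apply Clim_le with (fun n => Cmod (/ (1 - z)) * (Cmod z) ^ n)%R.
  - intros n. replace (Csum (fun n => z ^ n) n - / (1 - z)) with (- (/ (1 - z) * z ^ n)).
    + rewrite Cmod_opp, Cmod_mult, Cmod_pow. lra.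
    + assert (E : Csum (fun n => z ^ n) n * (1 - z) = 1 - z ^ n).
      { induction n as [|n IH]; simpl; [ring|]. rewrite Cmult_plus_distr_r, IH. ring. }
      replace (Csum (fun n => z ^ n) n) with ((1 - z ^ n) / (1 - z)) by (rewrite <- E; field; exact N).
      field. exact N.
  - assert (H := is_lim_seq_scal_l _ (Cmod (/ (1 - z))) _ (is_lim_seq_geom (Cmod z)
      ltac:(rewrite Rabs_pos_eq; [exact Hz|apply Cmod_ge_0]))).
    simpl in H. rewrite Rmult_0_r in H. exact H.
Qed.

(* [ell z = - log (1 - z)]; the term of index 0 vanishes because [/ 0 = 0]. *)
Definition ell_coef (n : nat) : C := RtoC (/ INR n)%R.
Definition ell : C -> C := PS ell_coef.

Lemma INR_ell_coef n : INR (S n) * ell_coef (S n) = 1.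
Proof.
  unfold ell_coef. rewrite <- RtoC_mult, Rinv_r; [reflexivity|]. apply not_0_INR. lia.
Qed.

Lemma ell_coef_0 : ell_coef 0 = 0.
Proof. unfold ell_coef. simpl. rewrite Rinv_0. reflexivity. Qed.

Lemma Cmod_ell_coef n : (Cmod (ell_coef n) <= 1)%R.
Proof.
  destruct n as [|n]; [rewrite ell_coef_0, Cmod_0; lra|].
  unfold ell_coef. pose proof (INR_S_ge1 n) as H.
  rewrite Cmod_R, Rabs_pos_eq.
  - rewrite <- Rinv_1. apply Rinv_le_contravar; lra.
  - left. apply Rinv_0_lt_compat. lra.
Qed.

Lemma poly_bdd_ell : poly_bdd ell_coef.
Proof. apply (poly_bdd_le _ 1), Cmod_ell_coef. Qed.

Lemma ell_der_series z : (Cmod z < 1)%R ->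
  CSeries (fun n => ell_coef n * (INR n * z ^ pred n)) = / (1 - z).
Proof.
  intros Hz. apply CSeries_unique, Clim_incr.
  eapply Clim_ext; [|apply geometric_Clim, Hz]. intros n.
  rewrite Csum_first.
  rewrite (Csum_ext (fun i => ell_coef (S i) * (INR (S i) * z ^ pred (S i))) (fun n => z ^ n)).
  - simpl INR. ring.
  - intros i _. replace (ell_coef (S i) * (INR (S i) * z ^ pred (S i)))
      with (INR (S i) * ell_coef (S i) * z ^ i) by (simpl pred; ring).
    rewrite INR_ell_coef. ring.
Qed.

Lemma ell_Cder z : (Cmod z < 1)%R -> Cder ell z (/ (1 - z)).
Proof.
  intros Hz. rewrite <- (ell_der_series z Hz). apply PS_Cder; [apply poly_bdd_ell|exact Hz].
Qed.

Lemma nice_ell : nice ell (fun x => / (1 - x)).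
Proof.
  intros r Hr.
  assert (Hs2 : ex_series (fun n => Cmod (ell_coef n) * (INR n * INR n) * r ^ n / (r * r))%R).
  { assert (H := abs_conv_poly_geom (fun n => ell_coef n * (INR n * INR n)) (fun n => (r : C) ^ n / (r * r)) (/ (r * r)) r).
    assert (Nr : RtoC r * r <> 0).
    { apply Cmult_neq_0; intros E; apply RtoC_inj in E; lra. }
    assert (E : forall n, Cmod ((r : C) ^ n / (r * r)) = (r ^ n / (r * r))%R).
    { intros n. rewrite Cmod_div by exact Nr. rewrite Cmod_pow, Cmod_mult, Cmod_R, Rabs_pos_eq by lra. reflexivity. }
    eapply ex_series_ext; [|apply H; [lra| |]].
    - intros n. simpl. rewrite Cmod_mult, E, !Cmod_mult, Cmod_R, (Rabs_pos_eq (INR n)) by apply pos_INR.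
      unfold Rdiv. ring.
    - apply poly_bdd_mult; [apply poly_bdd_ell|apply poly_bdd_mult; apply poly_bdd_INR].
    - intros n. rewrite E. unfold Rdiv. lra. }
  set (k := (/ (1 - r))%R). set (K2 := Series (fun n => Cmod (ell_coef n) * (INR n * INR n) * r ^ n / (r * r))%R).
  assert (Hk : (0 < k)%R) by (apply Rinv_0_lt_compat; lra).
  assert (HK2 : (0 <= Rabs K2)%R) by apply Rabs_pos.
  exists (k + Rabs K2)%R. split; [lra|]. intros x y Hx Hy. repeat split.
  - apply Rle_trans with (k * Cmod x)%R; [|apply Rmult_le_compat_r; [apply Cmod_ge_0|lra]].
    assert (Hg : is_series (fun n => Cmod x * Cmod x ^ n)%R (Cmod x * / (1 - Cmod x))%R).
    { apply (is_series_scal_l (Cmod x) (fun n => Cmod x ^ n)%R). apply is_series_geom.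
      rewrite Rabs_pos_eq; [lra|apply Cmod_ge_0]. }
    unfold ell, PS. rewrite CSeries_first by (apply PS_abs_conv; [apply poly_bdd_ell|lra]).
    rewrite ell_coef_0, Cmult_0_l, Cplus_0_l.
    eapply Rle_trans; [apply (CSeries_bound _ (fun n => Cmod x * Cmod x ^ n)%R)|].
    + intros n. rewrite Cmod_mult, Cmod_pow. simpl pow.
      rewrite <- (Rmult_1_l (Cmod x * Cmod x ^ n)) at 2. apply Rmult_le_compat_r; [|apply Cmod_ell_coef].
      apply Rmult_le_pos; [apply Cmod_ge_0|apply pow_le, Cmod_ge_0].
    + eexists; exact Hg.
    + rewrite (is_series_unique _ _ Hg), Rmult_comm. apply Rmult_le_compat_r; [apply Cmod_ge_0|].
      apply Rinv_le_contravar; lra.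
  - apply Rle_trans with k; [|lra]. pose proof (Cmod_1_minus x r Hx).
    rewrite Cmod_inv by (apply one_minus_neq0; lra).
    apply Rinv_le_contravar; lra.
  - assert (Pb := poly_bdd_ell).
    assert (Hx1 : (Cmod x < 1)%R) by lra. assert (Hy1 : (Cmod y < 1)%R) by lra.
    assert (T : forall n, (Cmod (ell_coef n * (y ^ n - x ^ n - INR n * x ^ pred n * (y - x)))
       <= (Cmod (y - x) * Cmod (y - x)) * (Cmod (ell_coef n) * (INR n * INR n) * r ^ n / (r * r)))%R).
    { intros n. assert (T2 := Cpow_taylor_bound x y r n (Rlt_le _ _ (proj1 Hr)) Hx Hy).
      rewrite Cmod_mult.
      replace (Cmod (y - x) * Cmod (y - x) * (Cmod (ell_coef n) * (INR n * INR n) * r ^ n / (r * r)))%R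
       with (Cmod (ell_coef n) * (/ (r * r) * (INR n * INR n * r ^ n * (Cmod (y - x) * Cmod (y - x)))))%R
       by (field; lra).
      apply Rmult_le_compat_l; [apply Cmod_ge_0|].
      apply Rmult_le_reg_l with (r * r)%R; [nra|].
      rewrite <- Rmult_assoc, Rinv_r, Rmult_1_l by nra. exact T2. }
    replace (ell y - ell x - / (1 - x) * (y - x))
      with (CSeries (fun n => ell_coef n * (y ^ n - x ^ n - INR n * x ^ pred n * (y - x)))).
    + eapply Rle_trans; [apply (CSeries_bound _ _ T)|].
      * apply (ex_series_scal_l (Cmod (y - x) * Cmod (y - x))%R _ Hs2).
      * rewrite Series_scal_l. fold K2. rewrite Rmult_comm.
        apply Rmult_le_compat_r; [apply Rmult_le_pos; apply Cmod_ge_0|].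
        pose proof (Rle_abs K2). lra.
    + rewrite <- (ell_der_series x Hx1). apply CSeries_unique.
      assert (Ad : abs_conv (fun n => ell_coef n * (INR n * x ^ pred n))).
      { apply abs_conv_incr. apply (abs_conv_ext (fun n => 1 * x ^ n)).
        - intros n. simpl pred. replace (ell_coef (S n) * (INR (S n) * x ^ n)) with (INR (S n) * ell_coef (S n) * x ^ n) by ring. rewrite INR_ell_coef. reflexivity.
        - apply (PS_abs_conv (fun _ => 1)); [|exact Hx1]. apply (poly_bdd_le _ 1). intros; rewrite Cmod_1; lra. }
      eapply Clim_ext; [|exact (Clim_minus _ _ _ _ (Clim_minus _ _ _ _
        (CSeries_Clim _ (PS_abs_conv _ _ Pb Hy1)) (CSeries_Clim _ (PS_abs_conv _ _ Pb Hx1)))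
        (Clim_mult _ _ _ _ (CSeries_Clim _ Ad) (Clim_const (y - x))))].
      intros n. simpl. induction n as [|n IH]; simpl; [ring|]. rewrite <- IH. ring.
Qed.

(** * The exponential and [log (1 - z)] *)

Lemma Cexp_plus x y : Cexp (x + y) = Cexp x * Cexp y.
Proof.
  unfold Cexp. rewrite Re_plus, Im_plus, exp_plus, cos_plus, sin_plus.
  unfold Cmult; simpl. f_equal; ring.
Qed.

Lemma Cexp_0 : Cexp 0 = 1.
Proof. unfold Cexp. simpl. rewrite exp_0, cos_0, sin_0. unfold RtoC. f_equal; ring. Qed.

Lemma Cmod_Cexp z : Cmod (Cexp z) = exp (Re z).
Proof.
  unfold Cexp, Cmod; simpl.
  replace (_ + _)%R with (exp (Re z) * exp (Re z))%R.
  - apply sqrt_square. left; apply exp_pos.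
  - pose proof (sin2_cos2 (Im z)) as H. unfold Rsqr in H.
    transitivity (exp (Re z) * exp (Re z) * (sin (Im z) * sin (Im z) + cos (Im z) * cos (Im z)))%R.
    + rewrite H; ring.
    + ring.
Qed.

Lemma Cexp_neq_0 z : Cexp z <> 0.
Proof. apply Cmod_gt_0. rewrite Cmod_Cexp. apply exp_pos. Qed.

Lemma Cexp_opp z : Cexp (- z) = / Cexp z.
Proof.
  assert (E : Cexp (- z) * Cexp z = 1).
  { rewrite <- Cexp_plus. replace (- z + z) with (RtoC 0) by ring. apply Cexp_0. }
  pose proof (Cexp_neq_0 z). replace (Cexp (- z)) with (Cexp (- z) * Cexp z / Cexp z) by (field; auto).
  rewrite E. field; auto.
Qed.

Lemma Cexp_nat n z : Cexp (INR n * z) = Cexp z ^ n.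
Proof.
  induction n as [|n IH].
  - simpl. rewrite Cmult_0_l. apply Cexp_0.
  - rewrite S_INR, RtoC_plus. replace ((INR n + 1) * z) with (z + INR n * z) by ring.
    rewrite Cexp_plus, IH. reflexivity.
Qed.

Lemma Cexp_minus x y : Cexp (x - y) = Cexp x / Cexp y.
Proof. unfold Cminus. rewrite Cexp_plus, Cexp_opp. reflexivity. Qed.

Lemma real_deriv_eps (f : R -> R) (x l : R) : is_derive f x l ->
  forall eps : R, (0 < eps)%R -> exists d : R, (0 < d)%R /\ forall h : R,
    (Rabs h < d)%R -> (Rabs (f (x + h) - f x - l * h) <= eps * Rabs h)%R.
Proof.
  intros H eps Heps. apply is_derive_Reals in H. destruct (H eps Heps) as [d Hd].
  exists d. split; [apply cond_pos|]. intros h Hh.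
  destruct (Req_dec h 0) as [->|Hn].
  - rewrite Rplus_0_r. replace (f x - f x - l * 0)%R with 0%R by ring. rewrite Rabs_R0. lra.
  - specialize (Hd h Hn Hh).
    replace (f (x + h) - f x - l * h)%R with (((f (x + h) - f x) / h - l) * h)%R by (field; exact Hn).
    rewrite Rabs_mult. apply Rmult_le_compat_r; [apply Rabs_pos|lra].
Qed.

Lemma Cder_Cexp_0 : Cder Cexp 0 1.
Proof.
  intros eps Heps.
  (* The real and imaginary parts of the error are bounded below by [3 * e * h] and [5 * e * h] from
     above, together [8 * e * h]; [e <= 1] keeps [1 + x] at most 2. *)
  set (e := Rmin 1 (eps / 8)).
  assert (He : (0 < e)%R) by (apply Rmin_pos; lra).
  assert (He1 : (e <= 1)%R) by apply Rmin_l.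
  assert (He2 : (e <= eps / 8)%R) by apply Rmin_r.
  clearbody e.
  assert (Dexp : is_derive exp 0 1%R) by (rewrite <- exp_0; apply is_derive_exp).
  assert (Dcos : is_derive cos 0 0%R).
  { pose proof (is_derive_cos 0) as T. rewrite sin_0, Ropp_0 in T. exact T. }
  assert (Dsin : is_derive sin 0 1%R) by (rewrite <- cos_0; apply is_derive_sin).
  destruct (real_deriv_eps _ _ _ Dexp e He) as [d1 [Hd1 H1]].
  destruct (real_deriv_eps _ _ _ Dcos e He) as [d2 [Hd2 H2]].
  destruct (real_deriv_eps _ _ _ Dsin e He) as [d3 [Hd3 H3]].
  exists (Rmin (Rmin d1 d2) (Rmin d3 e)). split; [repeat apply Rmin_pos; assumption|].
  intros w Hw. replace (w - 0) with w in * by ring. rewrite Cexp_0.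
  set (h := Cmod w) in *.
  assert (Ax : (Rabs (Re w) <= h)%R) by apply re_le_Cmod.
  assert (Ay : (Rabs (Im w) <= h)%R) by apply Im_le_Cmod.
  assert (Hh : (0 <= h)%R) by apply Cmod_ge_0.
  pose proof (Rmin_l (Rmin d1 d2) (Rmin d3 e)) as M1. pose proof (Rmin_r (Rmin d1 d2) (Rmin d3 e)) as M2.
  pose proof (Rmin_l d1 d2). pose proof (Rmin_r d1 d2). pose proof (Rmin_l d3 e). pose proof (Rmin_r d3 e).
  destruct w as [x y]; unfold Re, Im in *; simpl fst in *; simpl snd in *.
  specialize (H1 x ltac:(lra)). specialize (H2 y ltac:(lra)). specialize (H3 y ltac:(lra)).
  rewrite Rplus_0_l in H1, H2, H3. rewrite exp_0 in H1. rewrite cos_0 in H2. rewrite sin_0 in H3.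
  assert (C1 : (Rabs (cos y) <= 1)%R) by (apply Rabs_le; apply COS_bound).
  assert (Bx : (Rabs x <= 1)%R) by lra.
  eapply Rle_trans; [apply Cmod_le_Re_Im|].
  assert (ER : Re (Cexp (x, y) - 1 - 1 * (x, y)) =
    ((exp x - 1 - 1 * x) * cos y + (1 + x) * (cos y - 1 - 0 * y))%R).
  { unfold Cexp, Re, Cminus, Copp, Cplus, Cmult, RtoC, Im; simpl. ring. }
  assert (EI : Im (Cexp (x, y) - 1 - 1 * (x, y)) =
    (((exp x - 1 - 1 * x) + x) * (sin y - 0 - 1 * y) + ((exp x - 1 - 1 * x) + x) * y + (sin y - 0 - 1 * y))%R).
  { unfold Cexp, Re, Cminus, Copp, Cplus, Cmult, RtoC, Im; simpl. ring. }
  rewrite ER, EI.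
  set (a := (exp x - 1 - 1 * x)%R) in *. set (b := (cos y - 1 - 0 * y)%R) in *.
  set (c := (sin y - 0 - 1 * y)%R) in *.
  assert (Ba : (Rabs a <= e * h)%R) by (eapply Rle_trans; [exact H1|apply Rmult_le_compat_l; lra]).
  assert (Bb : (Rabs b <= e * h)%R) by (eapply Rle_trans; [exact H2|apply Rmult_le_compat_l; lra]).
  assert (Bc : (Rabs c <= e * h)%R) by (eapply Rle_trans; [exact H3|apply Rmult_le_compat_l; lra]).
  assert (Hhe : (h <= e)%R) by lra.
  assert (Bax : (Rabs (a + x) <= 2 * e)%R).
  { eapply Rle_trans; [apply Rabs_triang|]. nra. }
  assert (T1 : (Rabs (a * cos y + (1 + x) * b) <= e * h + 2 * (e * h))%R).
  { eapply Rle_trans; [apply Rabs_triang|]. rewrite !Rabs_mult.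
    assert (Rabs (1 + x) <= 2)%R by (eapply Rle_trans; [apply Rabs_triang|]; rewrite Rabs_R1; lra).
    apply Rplus_le_compat.
    - rewrite <- (Rmult_1_r (e * h)). apply Rmult_le_compat; auto using Rabs_pos.
    - apply Rmult_le_compat; auto using Rabs_pos. }
  assert (T2 : (Rabs ((a + x) * c + (a + x) * y + c) <= 2 * (e * h) + 2 * e * h + e * h)%R).
  { eapply Rle_trans; [apply Rabs_triang|]. apply Rplus_le_compat; [|exact Bc].
    eapply Rle_trans; [apply Rabs_triang|]. rewrite !Rabs_mult.
    apply Rplus_le_compat; apply Rmult_le_compat; auto using Rabs_pos; lra. }
  assert (0 <= e * h)%R by nra. assert (e * h <= eps / 8 * h)%R by nra. lra.
Qed.

Lemma Cder_Cexp z : Cder Cexp z (Cexp z).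
Proof.
  assert (H0 : Cder (fun w => w - z) z 1).
  { replace (RtoC 1) with (1 - 0) by ring. apply Cder_minus; [apply Cder_id|apply Cder_const]. }
  assert (H1 : Cder Cexp (z - z) 1).
  { replace (z - z) with (RtoC 0) by ring. exact Cder_Cexp_0. }
  assert (H := Cder_scal (Cexp z) _ _ _ (Cder_comp Cexp (fun w => w - z) z _ _ H0 H1)).
  replace (Cexp z) with (Cexp z * (1 * 1)) at 1 by ring.
  eapply Cder_ext; [|exact H]. intros w. simpl. rewrite <- Cexp_plus. f_equal. ring.
Qed.

Lemma Dd_exp f q l : Dd f q l -> Dd (fun x => Cexp (f x)) q (Cexp (f q) * l).
Proof. intros H. apply Dd_comp with (1 := H), Cder_Cexp. Qed.

Lemma Dd_zero_Cder (f : C -> C) (q : C) : q <> 0 -> Dd f q 0 -> Cder f q 0.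
Proof.
  intros Hq [l' [H E]]. replace (RtoC 0) with l'; [exact H|].
  destruct (Ceq_dec l' 0) as [->|N]; [reflexivity|].
  exfalso. exact (Cmult_neq_0 _ _ Hq N E).
Qed.

(** At [s = 0] the hypothesis gives no more than differentiability at the origin, which is all that
    [const_on_ray] asks there. *)
Lemma Dd_zero_ray f q : (forall s : R, (0 <= s <= 1)%R -> Dd f (s * q) 0) -> f q = f 0.
Proof.
  intros H. destruct (Ceq_dec q 0) as [->|N]; [reflexivity|].
  apply (const_on_ray f 0 q (fun s => C_derive f (s * q))).
  - intros s Hs. replace (0 + s * (q - 0)) with (s * q) by ring.
    destruct (H s Hs) as [l [Hl _]]. rewrite (Cder_C_derive _ _ _ Hl). exact Hl.
  - intros s Hs. apply Cder_C_derive, Dd_zero_Cder; [|apply H; lra].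
    apply Cmult_neq_0; [|exact N]. intros E. apply RtoC_inj in E. lra.
Qed.

Lemma Dd_zero_ball (f : C -> C) (q0 : C) (r : R) : (forall q : C, (Cmod (q - q0) < r)%R -> q <> 0 /\ Dd f q 0) ->
  forall q : C, (Cmod (q - q0) < r)%R -> f q = f q0.
Proof.
  intros H q Hq. apply (const_on_ray f q0 q (fun _ => 0)); [|reflexivity].
  intros s Hs. destruct (H (q0 + s * (q - q0))) as [N D].
  - replace (q0 + s * (q - q0) - q0) with (s * (q - q0)) by ring.
    rewrite Cmod_mult, Cmod_R, Rabs_pos_eq by lra.
    pose proof (Cmod_ge_0 (q - q0)). nra.
  - apply Dd_zero_Cder; assumption.
Qed.

Lemma ray_disc (x : C) (s : R) : (0 <= s <= 1)%R -> (Cmod x < 1)%R -> (Cmod (s * x) < 1)%R.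
Proof.
  intros Hs Hx. rewrite Cmod_mult, Cmod_R, Rabs_pos_eq by lra. pose proof (Cmod_ge_0 x). nra.
Qed.

Lemma ell_Dd z : (Cmod z < 1)%R -> Dd ell z (geo z).
Proof.
  intros Hz. exists (/ (1 - z)). split; [apply ell_Cder, Hz|reflexivity].
Qed.

Lemma ell_0 : ell 0 = 0.
Proof. unfold ell. rewrite PS_0. apply ell_coef_0. Qed.

(** [exp (ell x) (1 - x)] has derivative zero along the ray from 0, where its value is 1. *)
Lemma Cexp_ell x : (Cmod x < 1)%R -> Cexp (- ell x) = 1 - x.
Proof.
  intros Hx. rewrite Cexp_opp.
  assert (E : Cexp (ell x) * (1 - x) = 1).
  { transitivity ((fun y => Cexp (ell y) * (1 - y)) 0).
    - apply (Dd_zero_ray (fun y => Cexp (ell y) * (1 - y))). intros s Hs.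
      pose proof (ray_disc x s Hs Hx) as Hsx.
      eapply Dd_eq; [apply Dd_mult; [apply Dd_exp, ell_Dd, Hsx|apply Dd_minus; [apply Dd_const|apply Dd_id]]|].
      unfold geo. field. apply one_minus_neq0, Hsx.
    - simpl. rewrite ell_0, Cexp_0. ring. }
  pose proof (Cexp_neq_0 (ell x)) as N.
  apply (f_equal (fun y => y / Cexp (ell x))) in E.
  replace (Cexp (ell x) * (1 - x) / Cexp (ell x)) with (1 - x) in E by (field; exact N).
  rewrite E. field. exact N.
Qed.

(** * Products of Lambert series *)

Lemma Csum_S f n : Csum f (S n) = Csum f n + f n.
Proof. reflexivity. Qed.

Definition Csq (h : nat -> nat -> C) (N : nat) : C :=
  Csum (fun i => Csum (fun j => h (S i) (S j)) N) N.

(* The part of [Csq h N] with [m + n <= N], summed along the antidiagonals. *)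
Definition Ctri (h : nat -> nat -> C) (N : nat) : C :=
  Csum (fun k => Csum (fun i => h (S i) (k - i)%nat) k) N.

Definition absdiff (m n : nat) : nat := ((m - n) + (n - m))%nat.

Lemma Csq_S h N : Csq h (S N) =
  Csq h N + Csum (fun i => h (S N) (S i) + h (S i) (S N)) N + h (S N) (S N).
Proof.
  unfold Csq. simpl Csum. rewrite !Csum_plus. ring.
Qed.

Lemma Csum_delta g n a : Csum (fun j => if Nat.eq_dec j a then g j else 0) n =
  if le_lt_dec n a then 0 else g a.
Proof.
  induction n as [|n IH]; simpl Csum.
  - destruct (le_lt_dec 0 a); [reflexivity|lia].
  - rewrite IH. destruct (le_lt_dec n a), (le_lt_dec (S n) a), (Nat.eq_dec n a); try lia; subst; ring.
Qed.

(** Writing the triangle as a masked square lets the difference [Csq - Ctri] be estimated term by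
    term. *)
Lemma Ctri_restrict h N : Ctri h N =
  Csq (fun m n => if le_lt_dec (m + n) N then h m n else 0) N.
Proof.
  (* The frame [M] of the square has to stay fixed while the triangle grows; passing from [K] to
     [K + 1] adds the antidiagonal [i + j = K - 1] of the shifted indices. *)
  assert (G : forall K M, (K <= M)%nat -> Ctri h K =
    Csum (fun i => Csum (fun j => if le_lt_dec (S i + S j) K then h (S i) (S j) else 0) M) M).
  { induction K as [|K IH]; intros M HM.
    - unfold Ctri; simpl Csum.
      rewrite (Csum_ext _ (fun _ => 0 * 0)), Csum_scal; [ring|].
      intros i _. rewrite (Csum_ext _ (fun _ => 0 * 0)), Csum_scal; [ring|].
      intros j _. destruct (le_lt_dec (S i + S j) 0); [lia|ring].
    - change (Ctri h (S K)) with (Ctri h K + Csum (fun i => h (S i) (K - i)%nat) K).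
      rewrite (IH M) by lia.
      assert (E : Csum (fun i => h (S i) (K - i)%nat) K =
        Csum (fun i => Csum (fun j => if Nat.eq_dec j (K - S i) then
           (if le_lt_dec K i then 0 else h (S i) (S j)) else 0) M) M).
      { assert (Z : forall P : nat, Csum (fun i => Csum (fun j => if Nat.eq_dec j (K - S i) then
           (if le_lt_dec K i then 0 else h (S i) (S j)) else 0) M) (K + P) =
           Csum (fun i => h (S i) (K - i)%nat) K).
        { induction P as [|P IHP].
          - rewrite Nat.add_0_r. apply Csum_ext. intros i Hi. rewrite Csum_delta.
            destruct (le_lt_dec M (K - S i)); [lia|]. destruct (le_lt_dec K i); [lia|].
            f_equal. lia.
          - rewrite Nat.add_succ_r. simpl Csum. rewrite IHP, Csum_delta.
            destruct (le_lt_dec M (K - S (K + P))), (le_lt_dec K (K + P)); try lia; ring. }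
        specialize (Z (M - K)%nat). replace (K + (M - K))%nat with M in Z by lia.
        symmetry; exact Z. }
      rewrite E, <- Csum_plus. apply Csum_ext. intros i _. rewrite <- Csum_plus.
      apply Csum_ext. intros j _.
      destruct (le_lt_dec (S i + S j) K), (le_lt_dec (S i + S j) (S K)),
        (Nat.eq_dec j (K - S i)), (le_lt_dec K i); try lia; ring. }
  apply G. lia.
Qed.

Lemma Csq_plus g h N : Csq (fun m n => g m n + h m n) N = Csq g N + Csq h N.
Proof.
  unfold Csq. rewrite <- Csum_plus. apply Csum_ext. intros i _. apply Csum_plus.
Qed.

Lemma Csq_scal c h N : Csq (fun m n => c * h m n) N = c * Csq h N.
Proof.
  unfold Csq. rewrite <- Csum_scal. apply Csum_ext. intros i _. apply Csum_scal.
Qed.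

Lemma Csq_mult x y N : Csq (fun m n => x m * y n) N =
  Csum (fun i => x (S i)) N * Csum (fun i => y (S i)) N.
Proof. unfold Csq. rewrite Csum_mult. reflexivity. Qed.

Lemma Csq_ext g h N : (forall m n, (0 < m)%nat -> (0 < n)%nat -> g m n = h m n) -> Csq g N = Csq h N.
Proof. intros H. apply Csum_ext. intros i _. apply Csum_ext. intros j _. apply H; lia. Qed.

(* Ramanujan's rearrangement: it only uses the addition law [hu], satisfied by
   [u n = q^n / (1 - q^n)]. *)
Lemma convolution_identity (u f : nat -> C)
  (hu : forall m n, (0 < m)%nat -> (0 < n)%nat -> u m * u n = u (m + n)%nat * (1 + u m + u n)) N :
  Csq (fun m n => u m * u n * (f (absdiff m n) + 2 * f m)) N =
  f O * Csum (fun i => u (S i) * u (S i)) N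
  + Csum (fun i => 2 * f (S i) * (u (S i) + u (S i) * u (S i))
      - u (S i) * ((INR (S i) + 1) * f (S i) + 2 * Csum (fun k => f (S k)) i)) N
  + Ctri (fun m n => u m * u n * (f (m + n)%nat + 2 * f m)) N.
Proof.
  induction N as [|N IH]; [unfold Csq, Ctri; simpl; ring|].
  rewrite Csq_S, IH. unfold Ctri. rewrite !Csum_S.
  set (U := u (S N)). set (F := f (S N)).
  assert (D0 : absdiff (S N) (S N) = 0%nat) by (unfold absdiff; lia). rewrite D0.
  rewrite (Csum_ext (fun i => u (S N) * u (S i) * (f (absdiff (S N) (S i)) + 2 * f (S N)) +
      u (S i) * u (S N) * (f (absdiff (S i) (S N)) + 2 * f (S i)))
    (fun i => (2 * U) * (u (S i) * f (N - i)%nat) + ((2 * U * F) * u (S i) + (2 * U) * (u (S i) * f (S i))))).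
  2: { intros i Hi. replace (absdiff (S N) (S i)) with (N - i)%nat by (unfold absdiff; lia).
       replace (absdiff (S i) (S N)) with (N - i)%nat by (unfold absdiff; lia). unfold U, F. ring. }
  rewrite (Csum_ext (fun i => u (S i) * u (N - i)%nat * (f (S i + (N - i))%nat + 2 * f (S i)))
    (fun i => (U * F) * 1 + ((U * F) * u (S i) + ((U * F) * u (N - i)%nat +
       ((2 * U) * f (S i) + ((2 * U) * (u (S i) * f (S i)) + (2 * U) * (f (S i) * u (N - i)%nat))))))).
  (* On the new antidiagonal [m + n = N + 1] the addition law turns [u m * u n] into
     [U * (1 + u m + u n)]. Only single sums remain, and reversing the index matches them. *)
  2: { intros i Hi. rewrite hu by lia. replace (S i + (N - i))%nat with (S N) by lia. unfold U, F. ring. }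
  rewrite !Csum_plus, !Csum_scal.
  assert (E1 : Csum (fun i => u (N - i)%nat) N = Csum (fun i => u (S i)) N).
  { rewrite (Csum_rev (fun i => u (S i))). apply Csum_ext. intros i Hi. f_equal. lia. }
  assert (E2 : Csum (fun i => f (S i) * u (N - i)%nat) N = Csum (fun i => u (S i) * f (N - i)%nat) N).
  { rewrite (Csum_rev (fun i => u (S i) * f (N - i)%nat)). apply Csum_ext. intros i Hi.
    replace (S (N - 1 - i)) with (N - i)%nat by lia. replace (N - (N - 1 - i))%nat with (S i) by lia. ring. }
  assert (E3 : Csum (fun _ => 1) N = INR N).
  { clear. induction N as [|N IH]; [reflexivity|]. rewrite S_INR, RtoC_plus, <- IH. reflexivity. }
  rewrite E1, E2, E3. rewrite S_INR, RtoC_plus. fold F U. ring.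
Qed.

Lemma pow_poly_lim p (r : R) : (0 <= r < 1)%R ->
  is_lim_seq (fun n => INR (S n) ^ p * r ^ n)%R 0%R.
Proof. intros Hr. apply ex_series_lim_0, ex_series_poly_geom, Hr. Qed.

(** Outside the triangle [m + n > N], so each of at most [N^2] terms is a polynomial times [r^N]. As
    [m] and [n] are at most [N], [m + n + 1] is at most [2 (N + 1)], whence the factor [2 ^ p]. *)
Lemma Csq_Ctri_lim (h : nat -> nat -> C) (K r : R) p : (0 <= r < 1)%R -> (0 <= K)%R ->
  (forall m n, (0 < m)%nat -> (0 < n)%nat -> (Cmod (h m n) <= K * INR (S (m + n)) ^ p * r ^ (m + n))%R) ->
  Clim (fun N => Csq h N - Ctri h N) 0.
Proof.
  intros Hr HK B.
  apply Clim_le with (fun N => (K * 2 ^ p) * (INR (S N) ^ (p + 2) * r ^ N))%R.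
  - intros N. rewrite Ctri_restrict.
    replace (Csq h N - _ - 0) with
      (Csq h N + (-(1)) * Csq (fun m n => if le_lt_dec (m + n) N then h m n else 0) N) by ring.
    rewrite <- Csq_scal, <- Csq_plus.
    set (b := (K * (2 ^ p * INR (S N) ^ p) * r ^ N)%R).
    assert (Hb : (0 <= b)%R).
    { unfold b. repeat apply Rmult_le_pos; try apply pow_le; try lra. apply pos_INR. }
    apply Rle_trans with (INR N * (INR N * b))%R.
    + apply Csum_bound. intros i Hi. apply Csum_bound. intros j Hj.
      destruct (le_lt_dec (S i + S j) N) as [L|L].
      * replace (_ + _) with (RtoC 0) by ring. rewrite Cmod_0. exact Hb.
      * replace (_ + _) with (h (S i) (S j)) by ring.
        eapply Rle_trans; [apply B; lia|]. unfold b.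
        apply Rmult_le_compat.
        -- apply Rmult_le_pos; [exact HK|apply pow_le, pos_INR].
        -- apply pow_le; lra.
        -- apply Rmult_le_compat_l; [exact HK|]. rewrite <- Rpow_mult_distr.
           apply pow_incr. split; [apply pos_INR|].
           replace 2%R with (INR 2) by (simpl; ring). rewrite <- mult_INR. apply le_INR. lia.
        -- replace (S i + S j)%nat with (N + (S i + S j - N))%nat by lia. rewrite pow_add.
           rewrite <- (Rmult_1_r (r ^ N)) at 2. apply Rmult_le_compat_l; [apply pow_le; lra|].
           rewrite <- (pow1 (S i + S j - N)). apply pow_incr. lra.
    + unfold b. rewrite pow_add.
      assert (Q : (INR N * INR N <= INR (S N) ^ 2)%R).
      { rewrite S_INR. pose proof (pos_INR N). simpl. nra. }
      apply Rle_trans with (INR (S N) ^ 2 * (K * (2 ^ p * INR (S N) ^ p) * r ^ N))%R.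
      * rewrite <- Rmult_assoc. apply Rmult_le_compat_r; [exact Hb|exact Q].
      * right; ring.
  - assert (H := is_lim_seq_scal_l _ (K * 2 ^ p)%R _ (pow_poly_lim (p + 2) r Hr)).
    simpl in H. rewrite Rmult_0_r in H. exact H.
Qed.

Definition lam (q : C) (n : nat) : C := geo (q ^ n).

Lemma Cpow_disc (q : C) n : (Cmod q < 1)%R -> (0 < n)%nat -> (Cmod (q ^ n) < 1)%R.
Proof.
  intros Hq Hn. pose proof (Cmod_ge_0 q). destruct n as [|n]; [lia|].
  rewrite Cmod_pow. eapply Rle_lt_trans; [apply pow_le_base; lra|exact Hq].
Qed.

Lemma lam_mult q m n : (Cmod q < 1)%R -> (0 < m)%nat -> (0 < n)%nat ->
  lam q m * lam q n = lam q (m + n) * (1 + lam q m + lam q n).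
Proof.
  intros Hq Hm Hn. unfold lam, geo.
  pose proof (one_minus_neq0 _ (Cpow_disc q m Hq Hm)).
  pose proof (one_minus_neq0 _ (Cpow_disc q n Hq Hn)).
  pose proof (one_minus_neq0 _ (Cpow_disc q (m + n) Hq ltac:(lia))).
  rewrite Cpow_add_r in *. field. repeat split; assumption.
Qed.

Lemma lam_bound q : (Cmod q < 1)%R -> exists K : R, (0 <= K)%R /\
  forall n, (0 < n)%nat -> (Cmod (lam q n) <= K * Cmod q ^ n)%R.
Proof.
  intros Hq. pose proof (Cmod_ge_0 q) as Aq.
  set (r := ((Cmod q + 1) / 2)%R).
  destruct (nice_geo r) as [K [HK B]]; [unfold r; lra|].
  exists K. split; [exact HK|]. intros [|n] Hn; [lia|].
  rewrite <- Cmod_pow. apply (B (q ^ S n) 0).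
  - rewrite Cmod_pow. eapply Rle_trans; [apply pow_le_base; lra|unfold r; lra].
  - rewrite Cmod_0; unfold r; lra.
Qed.

Definition Lam (w : nat -> C) (q : C) : C := CSeries (fun i => w (S i) * lam q (S i)).

(* [Lam2 w q = sum_n w_n q^n / (1 - q^n)^2]. *)
Definition Lam2 (w : nat -> C) (q : C) : C :=
  CSeries (fun i => w (S i) * (lam q (S i) + lam q (S i) * lam q (S i))).

Lemma nice_geo2 (x : C) : (Cmod x < 1)%R -> x * / ((1 - x) * (1 - x)) = geo x + geo x * geo x.
Proof. intros H. unfold geo. field. apply one_minus_neq0, H. Qed.

Lemma Lam_abs_conv w q : poly_bdd w -> (Cmod q < 1)%R -> abs_conv (fun i => w (S i) * lam q (S i)).
Proof. intros Hw Hq. exact (abs_conv_decr _ (PSum_abs_conv w geo _ q nice_geo Hw Hq)). Qed.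

Lemma lam_le (q : C) : (Cmod q < 1)%R -> exists K : R, (0 <= K)%R /\
  forall n, (Cmod (lam q (S n) * lam q (S n)) <= K * Cmod q ^ n)%R.
Proof.
  intros Hq. destruct (lam_bound q Hq) as [K [HK B]].
  pose proof (Cmod_ge_0 q) as Aq. exists (K * K)%R. split; [nra|]. intros n.
  rewrite Cmod_mult.
  assert (I : (Cmod (lam q (S n)) <= K * Cmod q ^ n)%R).
  { eapply Rle_trans; [apply B; lia|]. apply Rmult_le_compat_l; [exact HK|].
    simpl. rewrite <- (Rmult_1_l (Cmod q ^ n)) at 2. apply Rmult_le_compat_r; [apply pow_le, Aq|lra]. }
  assert (I2 : (Cmod (lam q (S n)) <= K)%R).
  { eapply Rle_trans; [exact I|]. rewrite <- (Rmult_1_r K) at 2. apply Rmult_le_compat_l; [exact HK|].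
    rewrite <- (pow1 n). apply pow_incr. lra. }
  rewrite Rmult_assoc. apply Rmult_le_compat; auto using Cmod_ge_0.
Qed.

Lemma Lamsq_abs_conv w q : poly_bdd w -> (Cmod q < 1)%R ->
  abs_conv (fun i => w (S i) * (lam q (S i) * lam q (S i))).
Proof.
  intros Hw Hq. destruct (lam_le q Hq) as [K [HK B]].
  apply (abs_conv_poly_geom (fun i => w (S i)) _ K (Cmod q)).
  - split; [apply Cmod_ge_0|exact Hq].
  - apply poly_bdd_shift, Hw.
  - exact B.
Qed.

Lemma Lam2_abs_conv w q : poly_bdd w -> (Cmod q < 1)%R ->
  abs_conv (fun i => w (S i) * (lam q (S i) + lam q (S i) * lam q (S i))).
Proof.
  intros Hw Hq. eapply abs_conv_ext; [|exact (abs_conv_plus _ _ (Lam_abs_conv w q Hw Hq) (Lamsq_abs_conv w q Hw Hq))].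
  intros n; simpl; ring.
Qed.

Lemma Lam_plus v w q : poly_bdd v -> poly_bdd w -> (Cmod q < 1)%R ->
  Lam (fun n => v n + w n) q = Lam v q + Lam w q.
Proof.
  intros Hv Hw Hq. unfold Lam. rewrite <- CSeries_plus by (apply Lam_abs_conv; assumption).
  apply CSeries_ext. intros n; ring.
Qed.

Lemma Lam_scal c w q : poly_bdd w -> (Cmod q < 1)%R -> Lam (fun n => c * w n) q = c * Lam w q.
Proof.
  intros Hw Hq. unfold Lam. rewrite <- CSeries_scal by (apply Lam_abs_conv; assumption).
  apply CSeries_ext. intros n; ring.
Qed.

Lemma Lam2_scal c w q : poly_bdd w -> (Cmod q < 1)%R -> Lam2 (fun n => c * w n) q = c * Lam2 w q.
Proof.
  intros Hw Hq. unfold Lam2. rewrite <- CSeries_scal by (apply Lam2_abs_conv; assumption).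
  apply CSeries_ext. intros n; ring.
Qed.

Lemma Lam2_plus v w q : poly_bdd v -> poly_bdd w -> (Cmod q < 1)%R ->
  Lam2 (fun n => v n + w n) q = Lam2 v q + Lam2 w q.
Proof.
  intros Hv Hw Hq. unfold Lam2. rewrite <- CSeries_plus by (apply Lam2_abs_conv; assumption).
  apply CSeries_ext. intros n; ring.
Qed.

Lemma Lam_Dd w q : poly_bdd w -> (Cmod q < 1)%R -> Dd (Lam w) q (Lam2 (fun n => INR n * w n) q).
Proof.
  intros Hw Hq.
  assert (E : forall x, (Cmod x < 1)%R -> PSum w geo x - w 0%nat * geo 1 = Lam w x).
  { intros x Hx. unfold PSum. rewrite CSeries_first by exact (PSum_abs_conv w geo _ x nice_geo Hw Hx).
    simpl Cpow at 1. unfold Lam, lam. ring. }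
  assert (D1 := Dd_minus _ _ _ _ _ (PSum_Dd w geo _ q nice_geo Hw Hq) (Dd_const (w 0%nat * geo 1) q)).
  eapply Dd_eq.
  - eapply (Dd_ext_loc _ _ _ _ (1 - Cmod q)); [lra| |exact D1].
    intros x Hx. simpl. apply E. replace x with ((x - q) + q) by ring.
    eapply Rle_lt_trans; [apply Cmod_triangle|]. lra.
  - unfold PSum. rewrite CSeries_first.
    + simpl INR at 1. unfold Lam2.
      replace (CSeries (fun n => INR (S n) * w (S n) * (q ^ S n * / ((1 - q ^ S n) * (1 - q ^ S n)))))
        with (CSeries (fun i => INR (S i) * w (S i) * (lam q (S i) + lam q (S i) * lam q (S i)))).
      * ring.
      * apply CSeries_ext. intros n. rewrite nice_geo2; [reflexivity|]. apply Cpow_disc; [exact Hq|lia].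
    + apply abs_conv_incr.
      eapply abs_conv_ext; [|exact (Lam2_abs_conv _ q (poly_bdd_mult _ _ poly_bdd_INR Hw) Hq)].
      intros n. simpl. rewrite nice_geo2; [reflexivity|]. apply (Cpow_disc q (S n)); [exact Hq|lia].
Qed.

(** For [f n = cos (n theta)] the difference [f |m - n| - f (m + n)] is
    [2 sin (m theta) sin (n theta)], and the double sum becomes a product of Lambert series. The
    same happens for any [f] whose difference splits into products; closed partial sums of [f] then
    make [Lam W] explicit. *)
Lemma Lam_product f W q : poly_bdd f -> poly_bdd W -> (Cmod q < 1)%R ->
  (forall i, W (S i) = (INR (S i) + 1) * f (S i) + 2 * Csum (fun k => f (S k)) i) ->
  Clim (fun N => Csq (fun m n => lam q m * lam q n * (f (absdiff m n) - f (m + n)%nat)) N)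
    (f O * CSeries (fun i => lam q (S i) * lam q (S i)) + 2 * Lam2 f q - Lam W q).
Proof.
  intros Hf HW Hq EW.
  set (h := fun m n => lam q m * lam q n * (f (m + n)%nat + 2 * f m)).
  set (main := fun i => f O * (1 * (lam q (S i) * lam q (S i)))
     + (2 * (f (S i) * (lam q (S i) + lam q (S i) * lam q (S i))) + (-(1)) * (W (S i) * lam q (S i)))).
  assert (P1 : poly_bdd (fun _ => 1)) by (apply (poly_bdd_le _ 1); intros; rewrite Cmod_1; lra).
  assert (EN : forall N, Csum main N + (-(1)) * (Csq h N - Ctri h N) =
     Csq (fun m n => lam q m * lam q n * (f (absdiff m n) - f (m + n)%nat)) N).
  { intros N.
    assert (I := convolution_identity (lam q) f (fun m n => lam_mult q m n Hq) N).
    fold h in I.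
    assert (J : Csq (fun m n => lam q m * lam q n * (f (absdiff m n) - f (m + n)%nat)) N
      = Csq (fun m n => lam q m * lam q n * (f (absdiff m n) + 2 * f m)) N + (-(1)) * Csq h N).
    { rewrite <- Csq_scal, <- Csq_plus. apply Csq_ext. intros m n _ _. unfold h. ring. }
    rewrite J, I.
    replace (Csum main N) with (f O * Csum (fun i => lam q (S i) * lam q (S i)) N +
      Csum (fun i => 2 * f (S i) * (lam q (S i) + lam q (S i) * lam q (S i))
      - lam q (S i) * ((INR (S i) + 1) * f (S i) + 2 * Csum (fun k => f (S k)) i)) N).
    - ring.
    - rewrite <- Csum_scal, <- Csum_plus. apply Csum_ext. intros i _. unfold main. rewrite EW. ring. }
  eapply Clim_ext; [exact EN|].
  replace (f O * CSeries (fun i => lam q (S i) * lam q (S i)) + 2 * Lam2 f q - Lam W q)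
    with ((f O * CSeries (fun i => 1 * (lam q (S i) * lam q (S i))) + (2 * Lam2 f q + (-(1)) * Lam W q)) + (-(1)) * 0).
  2: { rewrite (CSeries_ext (fun i => 1 * (lam q (S i) * lam q (S i))) (fun i => lam q (S i) * lam q (S i)));
       [ring|intros; ring]. }
  apply Clim_plus.
  - assert (A1 := Lamsq_abs_conv _ q P1 Hq). cbv beta in A1.
    assert (A2 := Lam2_abs_conv f q Hf Hq). assert (A3 := Lam_abs_conv W q HW Hq).
    eapply Clim_ext; [|exact (Clim_plus _ _ _ _ (Clim_scal (f O) _ _ (CSeries_Clim _ A1))
      (Clim_plus _ _ _ _ (Clim_scal 2 _ _ (CSeries_Clim _ A2)) (Clim_scal (-(1)) _ _ (CSeries_Clim _ A3))))].
    intros n. simpl. unfold main. rewrite !Csum_plus, !Csum_scal. reflexivity.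
  - apply Clim_scal.
    destruct Hf as [L [p [HL BL]]]. destruct (lam_bound q Hq) as [K [HK BK]].
    apply (Csq_Ctri_lim h (K * K * (3 * L))%R (Cmod q) p).
    + split; [apply Cmod_ge_0|exact Hq].
    + repeat apply Rmult_le_pos; lra.
    + intros m n Hm Hn. unfold h. rewrite !Cmod_mult.
      pose proof (pow_le (Cmod q) m (Cmod_ge_0 q)). pose proof (pow_le (Cmod q) n (Cmod_ge_0 q)).
      replace (K * K * (3 * L) * INR (S (m + n)) ^ p * Cmod q ^ (m + n))%R with
        ((K * Cmod q ^ m) * (K * Cmod q ^ n) * (3 * L * INR (S (m + n)) ^ p))%R
        by (rewrite pow_add; ring).
      apply Rmult_le_compat.
      * apply Rmult_le_pos; apply Cmod_ge_0.
      * apply Cmod_ge_0.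
      * apply Rmult_le_compat; auto using Cmod_ge_0.
      * eapply Rle_trans; [apply Cmod_triangle|].
        assert (I1 : (Cmod (f (m + n)%nat) <= L * INR (S (m + n)) ^ p)%R) by apply BL.
        assert (I2 : (Cmod (2 * f m) <= 2 * (L * INR (S (m + n)) ^ p))%R).
        { rewrite Cmod_mult, Cmod_R, Rabs_pos_eq by lra. apply Rmult_le_compat_l; [lra|].
          eapply Rle_trans; [apply BL|]. apply Rmult_le_compat_l; [exact HL|].
          apply pow_incr. split; [apply pos_INR|]. apply le_INR. lia. }
        lra.
Qed.

(** * Twisted Lambert series of level 3 *)

(* [chi n = 2 sin (2 pi n / 3) / sqrt 3] and [cc n = 2 cos (2 pi n / 3)], of
   period 3 with values 0, 1, -1 and 2, -1, -1. *)
Fixpoint chicc (n : nat) : C * C :=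
  match n with
  | O => (RtoC 0, RtoC 2)
  | S m => ((snd (chicc m) - fst (chicc m)) / 2, (- snd (chicc m) - 3 * fst (chicc m)) / 2)
  end.
Definition chi (n : nat) : C := fst (chicc n).
Definition cc (n : nat) : C := snd (chicc n).

Ltac cnz := repeat split; intros Ecnz; apply RtoC_inj in Ecnz; lra.

Lemma chi_S n : chi (S n) = (cc n - chi n) / 2.
Proof. reflexivity. Qed.
Lemma cc_S n : cc (S n) = (- cc n - 3 * chi n) / 2.
Proof. reflexivity. Qed.
Lemma chi_0 : chi 0 = 0.
Proof. reflexivity. Qed.
Lemma cc_0 : cc 0 = 2.
Proof. reflexivity. Qed.
Lemma chi_1 : chi 1 = 1.
Proof. rewrite chi_S, chi_0, cc_0. field; cnz. Qed.
Lemma cc_1 : cc 1 = -(1).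
Proof. rewrite cc_S, chi_0, cc_0. field; cnz. Qed.

Lemma chi_period n : chi (S (S (S n))) = chi n.
Proof. rewrite !chi_S, !cc_S, !chi_S. field; cnz. Qed.
Lemma cc_period n : cc (S (S (S n))) = cc n.
Proof. rewrite !cc_S, !chi_S, !cc_S. field; cnz. Qed.

Lemma chi_add m n : chi (m + n) = (chi m * cc n + cc m * chi n) / 2 /\
  cc (m + n) = (cc m * cc n - 3 * (chi m * chi n)) / 2.
Proof.
  induction n as [|n [IH1 IH2]].
  - rewrite Nat.add_0_r, chi_0, cc_0. split; field; cnz.
  - rewrite Nat.add_succ_r, !chi_S, !cc_S, IH1, IH2. split; field; cnz.
Qed.

Lemma chi_norm n : cc n * cc n + 3 * (chi n * chi n) = 4.
Proof.
  induction n as [|n IH]; [rewrite chi_0, cc_0; ring|].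
  rewrite chi_S, cc_S, <- IH. field; cnz.
Qed.

(** Extended to all integers, [n] and [chi n] are odd and [cc n] is even, so the absolute value
    costs a sign [s] on the odd ones. Every [f] used below is even, hence [s] occurs there to an
    even power. *)
Lemma dist_facts m n : exists s : C, (s = 1 \/ s = -(1)) /\
  RtoC (INR (absdiff m n)) = s * (INR m - INR n) /\
  chi (absdiff m n) = s * ((chi m * cc n - cc m * chi n) / 2) /\
  cc (absdiff m n) = (cc m * cc n + 3 * (chi m * chi n)) / 2.
Proof.
  assert (G : forall n d, chi d = (chi (n + d) * cc n - cc (n + d) * chi n) / 2 /\
     cc d = (cc (n + d) * cc n + 3 * (chi (n + d) * chi n)) / 2).
  { intros k d. destruct (chi_add k d) as [E1 E2]. rewrite E1, E2.
    assert (N := chi_norm k). split.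
    - transitivity (chi d * (cc k * cc k + 3 * (chi k * chi k)) / 4); [rewrite N|]; field; cnz.
    - transitivity (cc d * (cc k * cc k + 3 * (chi k * chi k)) / 4); [rewrite N|]; field; cnz. }
  destruct (Nat.le_ge_cases n m) as [L|L].
  - exists 1. split; [left; reflexivity|]. unfold absdiff.
    replace (m - n + (n - m))%nat with (m - n)%nat by lia.
    destruct (G n (m - n)%nat) as [G1 G2]. replace (n + (m - n))%nat with m in * by lia.
    rewrite G2. split; [|split].
    + rewrite minus_INR by exact L. rewrite RtoC_minus. ring.
    + rewrite G1. field; cnz.
    + field; cnz.
  - exists (-(1)). split; [right; reflexivity|]. unfold absdiff.
    replace (m - n + (n - m))%nat with (n - m)%nat by lia.
    destruct (G m (n - m)%nat) as [G1 G2]. replace (m + (n - m))%nat with n in * by lia.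
    rewrite G2. split; [|split].
    + rewrite minus_INR by exact L. rewrite RtoC_minus. ring.
    + rewrite G1. field; cnz.
    + field; cnz.
Qed.

Lemma three_cases (P : nat -> Prop) : P 0%nat -> P 1%nat -> P 2%nat ->
  (forall n, P n -> P (S (S (S n)))) -> forall n, P n.
Proof.
  intros H0 H1 H2 HS n. assert (G : P n /\ P (S n) /\ P (S (S n))); [|tauto].
  induction n as [|n [I1 [I2 I3]]]; auto.
Qed.

Lemma chi_2 : chi 2 = -(1).
Proof. rewrite chi_S, chi_1, cc_1. field; cnz. Qed.
Lemma cc_2 : cc 2 = -(1).
Proof. rewrite cc_S, chi_1, cc_1. field; cnz. Qed.

Lemma poly_bdd_chi : poly_bdd chi.
Proof.
  apply (poly_bdd_le _ 1). apply three_cases.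
  - rewrite chi_0, Cmod_0; lra.
  - rewrite chi_1, Cmod_1; lra.
  - rewrite chi_2, Cmod_opp, Cmod_1; lra.
  - intros n H. rewrite chi_period. exact H.
Qed.

Lemma poly_bdd_cc : poly_bdd cc.
Proof.
  apply (poly_bdd_le _ 2). apply three_cases.
  - rewrite cc_0, Cmod_R, Rabs_pos_eq; lra.
  - rewrite cc_1, Cmod_opp, Cmod_1; lra.
  - rewrite cc_2, Cmod_opp, Cmod_1; lra.
  - intros n H. rewrite cc_period. exact H.
Qed.

Definition Sw (k n : nat) : C := INR n ^ k.
Definition Xw (k n : nat) : C := chi n * INR n ^ k.
Definition Cw (k n : nat) : C := cc n * INR n ^ k.

Lemma poly_bdd_Sw k : poly_bdd (Sw k).
Proof. apply poly_bdd_pow, poly_bdd_INR. Qed.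
Lemma poly_bdd_Xw k : poly_bdd (Xw k).
Proof. apply poly_bdd_mult; [apply poly_bdd_chi|apply poly_bdd_Sw]. Qed.
Lemma poly_bdd_Cw k : poly_bdd (Cw k).
Proof. apply poly_bdd_mult; [apply poly_bdd_cc|apply poly_bdd_Sw]. Qed.

Ltac bdd := repeat first
  [ apply poly_bdd_Sw | apply poly_bdd_Xw | apply poly_bdd_Cw | apply poly_bdd_plus
  | apply poly_bdd_scal ].

Lemma Clim_Lam w q : poly_bdd w -> (Cmod q < 1)%R ->
  Clim (Csum (fun i => w (S i) * lam q (S i))) (Lam w q).
Proof. intros Hw Hq. apply CSeries_Clim, Lam_abs_conv; assumption. Qed.

Lemma Clim_prod a b q : poly_bdd a -> poly_bdd b -> (Cmod q < 1)%R ->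
  Clim (fun N => Csq (fun m n => (a m * lam q m) * (b n * lam q n)) N) (Lam a q * Lam b q).
Proof.
  intros Ha Hb Hq. eapply Clim_ext; [|exact (Clim_mult _ _ _ _ (Clim_Lam a q Ha Hq) (Clim_Lam b q Hb Hq))].
  intros N. symmetry. apply (Csq_mult (fun m => a m * lam q m) (fun n => b n * lam q n)).
Qed.

Lemma Lam_product_eq f W q (t : nat -> nat -> C) l : poly_bdd f -> poly_bdd W -> (Cmod q < 1)%R ->
  (forall i, Csum (fun k => f (S k)) i = (W (S i) - (INR (S i) + 1) * f (S i)) / 2) ->
  (forall m n, f (absdiff m n) - f (m + n)%nat = t m n) ->
  Clim (fun N => Csq (fun m n => lam q m * lam q n * t m n) N) l ->
  f O * CSeries (fun i => lam q (S i) * lam q (S i)) + 2 * Lam2 f q - Lam W q = l.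
Proof.
  intros Hf HW Hq HS Ht Hl.
  eapply Clim_unique; [|exact Hl].
  eapply Clim_ext; [|apply (Lam_product f W q Hf HW Hq)].
  - intros N. apply Csq_ext. intros m n _ _. simpl. rewrite Ht. reflexivity.
  - intros i. rewrite HS. field; cnz.
Qed.

Ltac dist_tac := intros m n; unfold Sw, Xw, Cw;
  let H1 := fresh in let H2 := fresh in let H3 := fresh in
  let G1 := fresh in let G2 := fresh in
  destruct (chi_add m n) as [G1 G2];
  destruct (dist_facts m n) as [s [[-> | ->] [H1 [H2 H3]]]];
  rewrite ?H1, ?H2, ?H3, ?G1, ?G2, ?plus_INR, ?RtoC_plus; field; cnz.

Ltac sum_tac := intros i; unfold Sw, Xw, Cw; induction i as [|i IH];
  [ simpl Csum; simpl INR; rewrite ?chi_1, ?cc_1; field; cnz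
  | rewrite Csum_S, IH, ?(chi_S (S i)), ?(cc_S (S i)), !(S_INR (S i)), !RtoC_plus; field; cnz ].

(* Up to constants the weights below are [theta]-derivatives of [cos (n theta)], at
   [theta = 0] for [S2], [S4] and at [theta = 2 pi / 3] for [C0], ..., [C4]; the
   resulting identities are the jets of Jacobi's heat equation for theta functions. *)
Lemma Lam_conv_S2 q : (Cmod q < 1)%R ->
  -(4) * (Lam (Sw 1) q * Lam (Sw 1) q) = 2 * Lam2 (Sw 2) q - (Lam (Sw 1) q + 5 * Lam (Sw 3) q) / 3.
Proof.
  intros Hq.
  assert (H := Lam_product_eq (Sw 2) (fun n => (1 / 3) * Sw 1 n + (5 / 3) * Sw 3 n) q
    (fun m n => -(4) * (Sw 1 m * Sw 1 n)) (-(4) * (Lam (Sw 1) q * Lam (Sw 1) q))).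
  rewrite Lam_plus, !Lam_scal in H by (assumption || bdd).
  rewrite <- H; try assumption; try bdd.
  - unfold Sw at 1. simpl. field; cnz.
  - sum_tac.
  - dist_tac.
  - eapply Clim_ext; [|apply (Clim_scal (-(4))), (Clim_prod (Sw 1) (Sw 1) q); (assumption || bdd)].
    intros N. simpl. rewrite <- Csq_scal. apply Csq_ext. intros; ring.
Qed.

Lemma Lam_conv_S4 q : (Cmod q < 1)%R ->
  -(16) * (Lam (Sw 1) q * Lam (Sw 3) q) =
   2 * Lam2 (Sw 4) q - (- Lam (Sw 1) q / 15 + 2 * Lam (Sw 3) q / 3 + 7 * Lam (Sw 5) q / 5).
Proof.
  intros Hq.
  assert (H := Lam_product_eq (Sw 4)
    (fun n => (- (1 / 15)) * Sw 1 n + ((2 / 3) * Sw 3 n + (7 / 5) * Sw 5 n)) q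
    (fun m n => -(8) * (Sw 1 m * Sw 3 n) + -(8) * (Sw 3 m * Sw 1 n))
    (-(8) * (Lam (Sw 1) q * Lam (Sw 3) q) + -(8) * (Lam (Sw 3) q * Lam (Sw 1) q))).
  rewrite !Lam_plus, !Lam_scal in H by (assumption || bdd).
  transitivity (-(8) * (Lam (Sw 1) q * Lam (Sw 3) q) + -(8) * (Lam (Sw 3) q * Lam (Sw 1) q)); [ring|].
  rewrite <- H; try assumption; try bdd.
  - unfold Sw at 1. simpl. field; cnz.
  - sum_tac.
  - dist_tac.
  - eapply Clim_ext; [|apply Clim_plus;
      [apply (Clim_scal (-(8))), (Clim_prod (Sw 1) (Sw 3) q); (assumption || bdd)
      |apply (Clim_scal (-(8))), (Clim_prod (Sw 3) (Sw 1) q); (assumption || bdd)]].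
    intros N. simpl. rewrite <- !Csq_scal, <- Csq_plus. apply Csq_ext. intros; ring.
Qed.

(** The case [f = 1], where the difference [f |m - n| - f (m + n)] vanishes. It is the classical
    equality of [sum q^n / (1 - q^n)^2] and [sum n q^n / (1 - q^n)]. *)
Lemma Lam2_Sw0 q : (Cmod q < 1)%R -> Lam2 (Sw 0) q = Lam (Sw 1) q.
Proof.
  intros Hq.
  assert (H := Lam_product_eq (Sw 0) (fun n => 3 * Sw 1 n + (-(1)) * Sw 0 n) q
    (fun m n => 0) 0).
  rewrite !Lam_plus, !Lam_scal in H by (assumption || bdd).
  assert (E : Lam2 (Sw 0) q = Lam (Sw 0) q + CSeries (fun i => lam q (S i) * lam q (S i))).
  { unfold Lam2, Lam. 
    assert (A1 := Lam_abs_conv (Sw 0) q (poly_bdd_Sw 0) Hq).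
    assert (A2 := Lamsq_abs_conv (Sw 0) q (poly_bdd_Sw 0) Hq).
    rewrite (CSeries_ext (fun i => lam q (S i) * lam q (S i)) (fun i => Sw 0 (S i) * (lam q (S i) * lam q (S i))))
      by (intros; unfold Sw; simpl; ring).
    rewrite <- CSeries_plus by assumption. apply CSeries_ext. intros; ring. }
  rewrite E in *. assert (S00 : Sw 0 0 = 1) by reflexivity. rewrite S00 in H.
  assert (H0 : 1 * CSeries (fun i => lam q (S i) * lam q (S i)) +
     2 * (Lam (Sw 0) q + CSeries (fun i => lam q (S i) * lam q (S i))) -
     (3 * Lam (Sw 1) q + (-(1)) * Lam (Sw 0) q) = 0).
  { apply H; try assumption; try bdd.
    - sum_tac.
    - intros m n. unfold Sw. simpl. ring.
    - apply Clim_ext with (fun _ => 0); [|apply Clim_const].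
      intros N. rewrite (Csq_ext _ (fun m n => 0 * 0)), Csq_scal; [ring|intros; ring]. }
  replace (Lam (Sw 0) q + CSeries (fun i => lam q (S i) * lam q (S i))) with
    ((1 * CSeries (fun i => lam q (S i) * lam q (S i)) +
     2 * (Lam (Sw 0) q + CSeries (fun i => lam q (S i) * lam q (S i))) -
     (3 * Lam (Sw 1) q + (-(1)) * Lam (Sw 0) q)) / 3 + Lam (Sw 1) q) by (field; cnz).
  rewrite H0. field; cnz.
Qed.

(** Subtracting 2 from [cc] gives [f 0 = 0], which removes the sum of the squares of [lam]; in the
    identities of higher weight a positive power of [n] does this. *)
Lemma Lam_conv_C0 q : (Cmod q < 1)%R ->
  3 * (Lam (Xw 0) q * Lam (Xw 0) q) =
   2 * (Lam2 (Cw 0) q - 2 * Lam2 (Sw 0) q) - (Lam (Xw 0) q + Lam (Cw 1) q - 6 * Lam (Sw 1) q).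
Proof.
  intros Hq.
  assert (H := Lam_product_eq (fun n => Cw 0 n + (-(2)) * Sw 0 n)
    (fun n => Xw 0 n + (Cw 1 n + (-(6)) * Sw 1 n)) q
    (fun m n => 3 * (Xw 0 m * Xw 0 n)) (3 * (Lam (Xw 0) q * Lam (Xw 0) q))).
  rewrite !Lam_plus, !Lam_scal, Lam2_plus, Lam2_scal in H by (assumption || bdd).
  rewrite <- H; try assumption; try bdd.
  - unfold Sw at 1, Cw at 1. rewrite cc_0. simpl. field; cnz.
  - sum_tac.
  - dist_tac.
  - eapply Clim_ext; [|apply (Clim_scal 3), (Clim_prod (Xw 0) (Xw 0) q); (assumption || bdd)].
    intros N. simpl. rewrite <- Csq_scal. apply Csq_ext. intros; ring.
Qed.

Lemma Lam_conv_X1 q : (Cmod q < 1)%R ->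
  -(2) * (Lam (Xw 0) q * Lam (Cw 1) q) =
   2 * Lam2 (Xw 1) q - (2 / 3 * Lam (Xw 0) q + Lam (Xw 2) q - 1 / 3 * Lam (Cw 1) q).
Proof.
  intros Hq.
  assert (H := Lam_product_eq (Xw 1)
    (fun n => (2 / 3) * Xw 0 n + (Xw 2 n + (- (1 / 3)) * Cw 1 n)) q
    (fun m n => -(1) * (Xw 0 m * Cw 1 n) + -(1) * (Cw 1 m * Xw 0 n))
    (-(1) * (Lam (Xw 0) q * Lam (Cw 1) q) + -(1) * (Lam (Cw 1) q * Lam (Xw 0) q))).
  rewrite !Lam_plus, !Lam_scal in H by (assumption || bdd).
  transitivity (-(1) * (Lam (Xw 0) q * Lam (Cw 1) q) + -(1) * (Lam (Cw 1) q * Lam (Xw 0) q)); [ring|].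
  rewrite <- H; try assumption; try bdd.
  - unfold Xw at 1. rewrite chi_0. simpl. field; cnz.
  - sum_tac.
  - dist_tac.
  - eapply Clim_ext; [|apply Clim_plus;
      [apply (Clim_scal (-(1))), (Clim_prod (Xw 0) (Cw 1) q); (assumption || bdd)
      |apply (Clim_scal (-(1))), (Clim_prod (Cw 1) (Xw 0) q); (assumption || bdd)]].
    intros N. simpl. rewrite <- !Csq_scal, <- Csq_plus. apply Csq_ext. intros; ring.
Qed.

Lemma Lam_conv_C2 q : (Cmod q < 1)%R ->
  6 * (Lam (Xw 0) q * Lam (Xw 2) q) - 2 * (Lam (Cw 1) q * Lam (Cw 1) q) =
   2 * Lam2 (Cw 2) q - (-(2 / 3) * Lam (Xw 0) q + Lam (Xw 2) q + 4 / 3 * Lam (Cw 1) q + Lam (Cw 3) q).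
Proof.
  intros Hq.
  assert (H := Lam_product_eq (Cw 2)
    (fun n => (- (2 / 3)) * Xw 0 n + (Xw 2 n + ((4 / 3) * Cw 1 n + Cw 3 n))) q
    (fun m n => 3 * (Xw 0 m * Xw 2 n) + (3 * (Xw 2 m * Xw 0 n) + -(2) * (Cw 1 m * Cw 1 n)))
    (3 * (Lam (Xw 0) q * Lam (Xw 2) q) + (3 * (Lam (Xw 2) q * Lam (Xw 0) q) + -(2) * (Lam (Cw 1) q * Lam (Cw 1) q)))).
  rewrite !Lam_plus, !Lam_scal in H by (assumption || bdd).
  transitivity (3 * (Lam (Xw 0) q * Lam (Xw 2) q) + (3 * (Lam (Xw 2) q * Lam (Xw 0) q) + -(2) * (Lam (Cw 1) q * Lam (Cw 1) q))); [ring|].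
  rewrite <- H; try assumption; try bdd.
  - unfold Cw at 1. rewrite cc_0. simpl. field; cnz.
  - sum_tac.
  - dist_tac.
  - eapply Clim_ext; [|apply Clim_plus; [|apply Clim_plus];
      [apply (Clim_scal 3), (Clim_prod (Xw 0) (Xw 2) q); (assumption || bdd)
      |apply (Clim_scal 3), (Clim_prod (Xw 2) (Xw 0) q); (assumption || bdd)
      |apply (Clim_scal (-(2))), (Clim_prod (Cw 1) (Cw 1) q); (assumption || bdd)]].
    intros N. simpl. rewrite <- !Csq_scal, <- !Csq_plus. apply Csq_ext. intros; ring.
Qed.

Lemma Lam_conv_X3 q : (Cmod q < 1)%R ->
  -(6) * (Lam (Xw 2) q * Lam (Cw 1) q) - 2 * (Lam (Xw 0) q * Lam (Cw 3) q) =
   2 * Lam2 (Xw 3) q - (-(2 / 3) * Lam (Xw 0) q + 2 * Lam (Xw 2) q + Lam (Xw 4) q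
     + 2 / 3 * Lam (Cw 1) q - 1 / 3 * Lam (Cw 3) q).
Proof.
  intros Hq.
  assert (H := Lam_product_eq (Xw 3)
    (fun n => (- (2 / 3)) * Xw 0 n + (2 * Xw 2 n + (Xw 4 n + ((2 / 3) * Cw 1 n + (- (1 / 3)) * Cw 3 n)))) q
    (fun m n => -(3) * (Xw 2 m * Cw 1 n) + (-(3) * (Cw 1 m * Xw 2 n) +
       (-(1) * (Xw 0 m * Cw 3 n) + -(1) * (Cw 3 m * Xw 0 n))))
    (-(3) * (Lam (Xw 2) q * Lam (Cw 1) q) + (-(3) * (Lam (Cw 1) q * Lam (Xw 2) q) +
       (-(1) * (Lam (Xw 0) q * Lam (Cw 3) q) + -(1) * (Lam (Cw 3) q * Lam (Xw 0) q))))).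
  rewrite !Lam_plus, !Lam_scal in H by (assumption || bdd).
  transitivity (-(3) * (Lam (Xw 2) q * Lam (Cw 1) q) + (-(3) * (Lam (Cw 1) q * Lam (Xw 2) q) +
       (-(1) * (Lam (Xw 0) q * Lam (Cw 3) q) + -(1) * (Lam (Cw 3) q * Lam (Xw 0) q)))); [ring|].
  rewrite <- H; try assumption; try bdd.
  - unfold Xw at 1. rewrite chi_0. simpl. field; cnz.
  - sum_tac.
  - dist_tac.
  - eapply Clim_ext; [|apply Clim_plus; [|apply Clim_plus; [|apply Clim_plus]];
      [apply (Clim_scal (-(3))), (Clim_prod (Xw 2) (Cw 1) q); (assumption || bdd)
      |apply (Clim_scal (-(3))), (Clim_prod (Cw 1) (Xw 2) q); (assumption || bdd)
      |apply (Clim_scal (-(1))), (Clim_prod (Xw 0) (Cw 3) q); (assumption || bdd)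
      |apply (Clim_scal (-(1))), (Clim_prod (Cw 3) (Xw 0) q); (assumption || bdd)]].
    intros N. simpl. rewrite <- !Csq_scal, <- !Csq_plus. apply Csq_ext. intros; ring.
Qed.

Lemma Lam_conv_C4 q : (Cmod q < 1)%R ->
  -(8) * (Lam (Cw 1) q * Lam (Cw 3) q) + 6 * (Lam (Xw 0) q * Lam (Xw 4) q)
    + 18 * (Lam (Xw 2) q * Lam (Xw 2) q) =
   2 * Lam2 (Cw 4) q - (2 * Lam (Xw 0) q - 4 * Lam (Xw 2) q + Lam (Xw 4) q
     - 8 / 3 * Lam (Cw 1) q + 8 / 3 * Lam (Cw 3) q + Lam (Cw 5) q).
Proof.
  intros Hq.
  assert (H := Lam_product_eq (Cw 4)
    (fun n => 2 * Xw 0 n + (-(4) * Xw 2 n + (Xw 4 n + (-(8 / 3) * Cw 1 n + ((8 / 3) * Cw 3 n + Cw 5 n))))) q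
    (fun m n => -(4) * (Cw 1 m * Cw 3 n) + (-(4) * (Cw 3 m * Cw 1 n) +
       (3 * (Xw 0 m * Xw 4 n) + (3 * (Xw 4 m * Xw 0 n) + 18 * (Xw 2 m * Xw 2 n)))))
    (-(4) * (Lam (Cw 1) q * Lam (Cw 3) q) + (-(4) * (Lam (Cw 3) q * Lam (Cw 1) q) +
       (3 * (Lam (Xw 0) q * Lam (Xw 4) q) + (3 * (Lam (Xw 4) q * Lam (Xw 0) q) + 18 * (Lam (Xw 2) q * Lam (Xw 2) q)))))).
  rewrite !Lam_plus, !Lam_scal in H by (assumption || bdd).
  transitivity (-(4) * (Lam (Cw 1) q * Lam (Cw 3) q) + (-(4) * (Lam (Cw 3) q * Lam (Cw 1) q) +
       (3 * (Lam (Xw 0) q * Lam (Xw 4) q) + (3 * (Lam (Xw 4) q * Lam (Xw 0) q) + 18 * (Lam (Xw 2) q * Lam (Xw 2) q))))); [ring|].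
  rewrite <- H; try assumption; try bdd.
  - unfold Cw at 1. rewrite cc_0. simpl. field; cnz.
  - sum_tac.
  - dist_tac.
  - eapply Clim_ext; [|apply Clim_plus; [|apply Clim_plus; [|apply Clim_plus; [|apply Clim_plus]]];
      [apply (Clim_scal (-(4))), (Clim_prod (Cw 1) (Cw 3) q); (assumption || bdd)
      |apply (Clim_scal (-(4))), (Clim_prod (Cw 3) (Cw 1) q); (assumption || bdd)
      |apply (Clim_scal 3), (Clim_prod (Xw 0) (Xw 4) q); (assumption || bdd)
      |apply (Clim_scal 3), (Clim_prod (Xw 4) (Xw 0) q); (assumption || bdd)
      |apply (Clim_scal 18), (Clim_prod (Xw 2) (Xw 2) q); (assumption || bdd)]].
    intros N. simpl. rewrite <- !Csq_scal, <- !Csq_plus. apply Csq_ext. intros; ring.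
Qed.

(** * Eisenstein series of level 3 *)

Lemma Clim_subseq3 s l : Clim s l -> Clim (fun n => s (3 * n)%nat) l.
Proof.
  intros H. apply (is_lim_seq_subseq (fun n => Cmod (s n - l)) _ (fun n => (3 * n)%nat)); [|exact H].
  apply eventually_subseq. intros n. lia.
Qed.

(** [cc n] is -1 plus 3 times the indicator of the multiples of 3. Partial sums are compared at
    lengths [3 n], where whole periods have been summed. *)
Lemma trisection (g : nat -> C) l1 l2 l3 :
  Clim (Csum (fun i => cc (S i) * g (S i))) l1 -> Clim (Csum (fun i => g (S i))) l2 ->
  Clim (Csum (fun i => g (3 * S i)%nat)) l3 -> l1 = - l2 + 3 * l3.
Proof.
  intros H1 H2 H3. eapply Clim_unique; [exact (Clim_subseq3 _ _ H1)|].
  replace (- l2 + 3 * l3) with (3 * l3 - l2) by ring.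
  eapply Clim_ext; [|exact (Clim_minus _ _ _ _ (Clim_scal 3 _ _ H3) (Clim_subseq3 _ _ H2))].
  intros n. simpl. induction n as [|n IH]; [simpl; ring|].
  assert (P : forall k, cc (S (3 * k)) = -(1) /\ cc (S (S (3 * k))) = -(1) /\ cc (S (S (S (3 * k)))) = 2).
  { induction k as [|k [I1 [I2 I3]]].
    - change (3 * 0)%nat with 0%nat. rewrite cc_period. split; [apply cc_1|split; [apply cc_2|apply cc_0]].
    - replace (3 * S k)%nat with (S (S (S (3 * k)))) by lia. rewrite !(cc_period (S _)). auto. }
  destruct (P n) as [P1 [P2 P3]].
  replace (S n + (S n + (S n + 0)))%nat with (S (S (S (n + (n + (n + 0)))))) by lia.
  rewrite !Csum_S, <- IH.
  change (n + (n + (n + 0)))%nat with (3 * n)%nat. rewrite P1, P2, P3.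
  replace (S (S (S (3 * n)))) with (3 * S n)%nat by lia. change (S (n + S (n + S (n + 0))))%nat with (3 * S n)%nat. ring.
Qed.

Lemma lam_3 q n : lam q (3 * n) = lam (q ^ 3) n.
Proof. unfold lam. rewrite Cpow_mult_r. reflexivity. Qed.

Lemma Sw_3 j n : Sw j (3 * n) = 3 ^ j * Sw j n.
Proof.
  unfold Sw. rewrite mult_INR, RtoC_mult, Cpow_mult_l. f_equal. f_equal. f_equal. simpl; ring.
Qed.

Lemma disc_cube (q : C) : (Cmod q < 1)%R -> (Cmod (q ^ 3) < 1)%R.
Proof. intros H. apply Cpow_disc; [exact H|lia]. Qed.

Lemma Lam_Cw j q : (Cmod q < 1)%R ->
  Lam (Cw j) q = - Lam (Sw j) q + 3 * (3 ^ j * Lam (Sw j) (q ^ 3)).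
Proof.
  intros Hq. apply (trisection (fun n => Sw j n * lam q n)).
  - eapply Clim_ext; [|exact (Clim_Lam (Cw j) q (poly_bdd_Cw j) Hq)].
    intros N. apply Csum_ext. intros i _. unfold Cw, Sw. ring.
  - exact (Clim_Lam (Sw j) q (poly_bdd_Sw j) Hq).
  - eapply Clim_ext; [|exact (Clim_scal (3 ^ j) _ _ (Clim_Lam (Sw j) _ (poly_bdd_Sw j) (disc_cube q Hq)))].
    intros N. cbv beta. rewrite <- Csum_scal. apply Csum_ext. intros i _.
    rewrite lam_3, Sw_3. ring.
Qed.

Lemma Lam2_Cw j q : (Cmod q < 1)%R ->
  Lam2 (Cw j) q = - Lam2 (Sw j) q + 3 * (3 ^ j * Lam2 (Sw j) (q ^ 3)).
Proof.
  intros Hq. apply (trisection (fun n => Sw j n * (lam q n + lam q n * lam q n))).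
  - eapply Clim_ext; [|exact (CSeries_Clim _ (Lam2_abs_conv (Cw j) q (poly_bdd_Cw j) Hq))].
    intros N. apply Csum_ext. intros i _. unfold Cw, Sw. ring.
  - exact (CSeries_Clim _ (Lam2_abs_conv (Sw j) q (poly_bdd_Sw j) Hq)).
  - eapply Clim_ext; [|exact (Clim_scal (3 ^ j) _ _ (CSeries_Clim _ (Lam2_abs_conv (Sw j) _ (poly_bdd_Sw j) (disc_cube q Hq))))].
    intros N. cbv beta. rewrite <- Csum_scal. apply Csum_ext. intros i _.
    rewrite lam_3, Sw_3. ring.
Qed.

Definition eis2 (q : C) : C := 1 - 24 * Lam (Sw 1) q.
Definition eis4 (q : C) : C := 1 + 240 * Lam (Sw 3) q.
Definition eis6 (q : C) : C := 1 - 504 * Lam (Sw 5) q.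

(* Borwein's cubic theta function [a] as a Lambert series, and the weight 3
   Eisenstein series that will turn out to be [eta(tau)^9 / eta(3 tau)^3]. *)
Definition cubA (q : C) : C := 1 + 6 * Lam (Xw 0) q.
Definition cubE (q : C) : C := 1 - 9 * Lam (Xw 2) q.

Lemma Lam2_ext v w q : (forall n, v (S n) = w (S n)) -> Lam2 v q = Lam2 w q.
Proof. intros H. apply CSeries_ext. intros n. rewrite H. reflexivity. Qed.

(** Elimination by certificate: an explicit multiplier [c] reduces a deduction from a known equation
    to a rational identity. *)
Lemma lin_eq (x y l r c : C) : l = r -> x - y = c * (l - r) -> x = y.
Proof. intros -> H. apply Ceq_minus. rewrite H. ring. Qed.

Lemma lin_eq2 (x y l r c l' r' c' : C) : l = r -> l' = r' ->
  x - y = c * (l - r) + c' * (l' - r') -> x = y.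
Proof. intros -> -> H. apply Ceq_minus. rewrite H. ring. Qed.

(** Ramanujan's equation for [E2], and next the one for [E4]. D multiplies the weight by [n] and
    turns [Lam] into [Lam2], so a convolution identity is a formula for a derivative. *)
Lemma eis2_Dd q : (Cmod q < 1)%R -> Dd eis2 q ((eis2 q ^ 2 - eis4 q) / 12).
Proof.
  intros Hq. eapply Dd_eq.
  - apply Dd_minus; [apply Dd_const|]. apply Dd_scal, Lam_Dd; [apply poly_bdd_Sw|exact Hq].
  - rewrite (Lam2_ext _ (Sw 2)) by (intros; unfold Sw; simpl; ring).
    apply (lin_eq _ _ _ _ 12 (Lam_conv_S2 q Hq)). unfold eis2, eis4. field; cnz.
Qed.

Lemma eis4_Dd q : (Cmod q < 1)%R -> Dd eis4 q ((eis2 q * eis4 q - eis6 q) / 3).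
Proof.
  intros Hq. eapply Dd_eq.
  - apply Dd_plus; [apply Dd_const|]. apply Dd_scal, Lam_Dd; [apply poly_bdd_Sw|exact Hq].
  - rewrite (Lam2_ext _ (Sw 4)) by (intros; unfold Sw; simpl; ring).
    apply (lin_eq _ _ _ _ (-(120)) (Lam_conv_S4 q Hq)). unfold eis2, eis4, eis6. field; cnz.
Qed.

Lemma cubA_sq q : (Cmod q < 1)%R -> cubA q * cubA q = (3 * eis2 (q ^ 3) - eis2 q) / 2.
Proof.
  intros Hq. assert (H := Lam_conv_C0 q Hq). rewrite Lam2_Cw, Lam_Cw, !Lam2_Sw0 in H by (assumption || (apply disc_cube; assumption)).
  apply (lin_eq _ _ _ _ 12 H). unfold cubA, eis2. simpl Cpow. field; cnz.
Qed.

Lemma Lam_C1 q : (Cmod q < 1)%R ->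
  Lam (Cw 1) q = 1 / 3 - (eis2 q + 3 * (cubA q * cubA q)) / 12.
Proof.
  intros Hq. rewrite Lam_Cw, cubA_sq by exact Hq. unfold eis2. simpl Cpow. field; cnz.
Qed.

Lemma Lam_C3 q : (Cmod q < 1)%R ->
  Lam (Cw 3) q = - (1 / 3) + (81 * eis4 (q ^ 3) - eis4 q) / 240.
Proof. intros Hq. rewrite Lam_Cw by exact Hq. unfold eis4. simpl Cpow. field; cnz. Qed.

Lemma Lam_C5 q : (Cmod q < 1)%R ->
  Lam (Cw 5) q = 13 / 9 + (eis6 q - 729 * eis6 (q ^ 3)) / 504.
Proof. intros Hq. rewrite Lam_Cw by exact Hq. unfold eis6. simpl Cpow. field; cnz. Qed.

Lemma cubA_Dd q : (Cmod q < 1)%R ->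
  Dd cubA q (- cubE q / 3 + cubA q * (eis2 q + 3 * (cubA q * cubA q)) / 12).
Proof.
  intros Hq. eapply Dd_eq.
  - apply Dd_plus; [apply Dd_const|]. apply Dd_scal, Lam_Dd; [apply poly_bdd_Xw|exact Hq].
  - rewrite (Lam2_ext _ (Xw 1)) by (intros; unfold Xw; simpl; ring).
    assert (H := Lam_conv_X1 q Hq). rewrite Lam_C1 in H by exact Hq.
    assert (EX0 : Lam (Xw 0) q = (cubA q - 1) / 6) by (unfold cubA; field; cnz).
    assert (EX2 : Lam (Xw 2) q = (1 - cubE q) / 9) by (unfold cubE; field; cnz).
    rewrite EX0, EX2 in H. apply (lin_eq _ _ _ _ (-(3)) H). field; cnz.
Qed.

Lemma disc_open (q : C) : (Cmod q < 1)%R -> forall x, (Cmod (x - q) < 1 - Cmod q)%R -> (Cmod x < 1)%R.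
Proof.
  intros Hq x Hx. replace x with ((x - q) + q) by ring.
  eapply Rle_lt_trans; [apply Cmod_triangle|]. lra.
Qed.

Lemma eis2_cube q : (Cmod q < 1)%R -> eis2 (q ^ 3) = (eis2 q + 2 * (cubA q * cubA q)) / 3.
Proof. intros Hq. rewrite cubA_sq by exact Hq. field; cnz. Qed.

(** The derivative of [a^2 = (3 E2(q^3) - E2(q)) / 2] computed twice, by Ramanujan's equation for
    [E2] and by [cubA_Dd]; the terms in [E2] cancel. *)
Lemma cubA_cubE q : (Cmod q < 1)%R ->
  cubA q * cubE q = cubA q ^ 4 / 2 + (9 * eis4 (q ^ 3) - eis4 q) / 16.
Proof.
  intros Hq. pose proof (disc_cube q Hq) as Hq3.
  assert (D1 : Dd (fun x => cubA x * cubA x) q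
     ((3 * (3 * ((eis2 (q ^ 3) ^ 2 - eis4 (q ^ 3)) / 12)) - (eis2 q ^ 2 - eis4 q) / 12) / 2)).
  { apply (Dd_ext_loc (fun x => (1 / 2) * (3 * eis2 (x ^ 3) - eis2 x)) _ _ _ (1 - Cmod q)); [lra| |].
    - intros x Hx. rewrite (cubA_sq x (disc_open q Hq x Hx)). field; cnz.
    - eapply Dd_eq; [apply Dd_scal, Dd_minus; [apply Dd_scal, Dd_cube, eis2_Dd, Hq3|apply eis2_Dd, Hq]|].
      field; cnz. }
  assert (E1 := Dd_unique _ _ _ _ D1 (Dd_mult _ _ _ _ _ (cubA_Dd q Hq) (cubA_Dd q Hq))).
  rewrite eis2_cube in E1 by exact Hq.
  apply (lin_eq _ _ _ _ (3 / 2) E1). field; cnz.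
Qed.

(** [Lam_conv_C2] and [cubA_cubE] give two linear relations between [a^4], [a e], [E4(q)] and
    [E4(q^3)]; the combination taken at the end cancels [a e]. *)
Lemma eis4_sum q : (Cmod q < 1)%R -> eis4 q + 9 * eis4 (q ^ 3) = 10 * cubA q ^ 4.
Proof.
  intros Hq. pose proof (disc_cube q Hq) as Hq3.
  assert (E1 := cubA_cubE q Hq). assert (E2 := Lam_conv_C2 q Hq).
  rewrite Lam2_Cw, Lam_C1, Lam_C3 in E2 by exact Hq.
  assert (S1 := Lam_conv_S2 q Hq). assert (S2 := Lam_conv_S2 (q ^ 3) Hq3).
  assert (EX0 : Lam (Xw 0) q = (cubA q - 1) / 6) by (unfold cubA; field; cnz).
  assert (EX2 : Lam (Xw 2) q = (1 - cubE q) / 9) by (unfold cubE; field; cnz).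
  assert (ES : forall x, Lam (Sw 1) x = (1 - eis2 x) / 24 /\ Lam (Sw 3) x = (eis4 x - 1) / 240)
    by (intros x; unfold eis2, eis4; split; field; cnz).
  destruct (ES q) as [F1 F3]. destruct (ES (q ^ 3)) as [F1' F3'].
  rewrite EX0, EX2 in E2. rewrite F1, F3 in S1. rewrite F1', F3', (eis2_cube q Hq) in S2.
  assert (V1 : Lam2 (Sw 2) q = (1 / 2) * (-(4) * ((1 - eis2 q) / 24 * ((1 - eis2 q) / 24))
      + ((1 - eis2 q) / 24 + 5 * ((eis4 q - 1) / 240)) / 3)).
  { apply (lin_eq _ _ _ _ (-(1/2)) S1). field; cnz. }
  set (P3 := (eis2 q + 2 * (cubA q * cubA q)) / 3) in *.
  assert (V2 : Lam2 (Sw 2) (q ^ 3) = (1 / 2) * (-(4) * ((1 - P3) / 24 * ((1 - P3) / 24))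
      + ((1 - P3) / 24 + 5 * ((eis4 (q ^ 3) - 1) / 240)) / 3)).
  { apply (lin_eq _ _ _ _ (-(1/2)) S2). field; cnz. }
  unfold P3 in V2. rewrite V1, V2 in E2. clear V1 V2 S1 S2.
  apply (lin_eq2 _ _ _ _ (720 / 7) _ _ (720 / 63) E2 E1). field; cnz.
Qed.

Lemma eis4_cub q : (Cmod q < 1)%R -> eis4 q = 9 * cubA q ^ 4 - 8 * (cubA q * cubE q).
Proof.
  intros Hq. apply (lin_eq2 _ _ _ _ (1 / 2) _ _ 8 (eis4_sum q Hq) (cubA_cubE q Hq)). field; cnz.
Qed.

Lemma eis4_cube q : (Cmod q < 1)%R -> eis4 (q ^ 3) = (cubA q ^ 4 + 8 * (cubA q * cubE q)) / 9.
Proof.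
  intros Hq. apply (lin_eq2 _ _ _ _ (1 / 9) _ _ (-(1 / 9)) (eis4_sum q Hq) (eis4_cub q Hq)). field; cnz.
Qed.

(** The derivative of [e] stays a Lambert series because the elimination below determines only its
    product with [a]. *)
Definition cubE' (q : C) : C := -(9) * Lam2 (Xw 3) q.

Lemma cubE_Dd' q : (Cmod q < 1)%R -> Dd cubE q (cubE' q).
Proof.
  intros Hq. eapply Dd_eq.
  - apply Dd_minus; [apply Dd_const|]. apply Dd_scal, Lam_Dd; [apply poly_bdd_Xw|exact Hq].
  - rewrite (Lam2_ext _ (Xw 3)) by (intros; unfold Xw; simpl; ring). unfold cubE'. ring.
Qed.

(** Linear elimination of [E6(q)], [E6(q^3)], the derivative of [e] and [Lam (Xw 4)]. The equations
    are the derivatives of [eis4_sum] and [eis4_cub] together with [Lam_conv_X3] and [Lam_conv_C4];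
    [Lam_conv_S4] at [q] and at [q^3] disposes of the [Lam2] sums. *)
Lemma cubic_weight6 q : (Cmod q < 1)%R ->
  eis6 q = -(27) * cubA q ^ 6 + 36 * (cubA q ^ 3 * cubE q) - 8 * cubE q ^ 2 /\
  cubA q * cubE' q = cubA q * cubE q * (eis2 q - cubA q * cubA q) / 4.
Proof.
  intros Hq. pose proof (disc_cube q Hq) as Hq3.
  assert (Da := cubA_Dd q Hq). assert (De := cubE_Dd' q Hq).
  assert (HP3 := eis2_cube q Hq). assert (HQ := eis4_cub q Hq). assert (HQ3 := eis4_cube q Hq).
  assert (E1 : (eis2 q * eis4 q - eis6 q) / 3 + 9 * (3 * ((eis2 (q ^ 3) * eis4 (q ^ 3) - eis6 (q ^ 3)) / 3))
     = 10 * (INR 4 * cubA q ^ 3 * (- cubE q / 3 + cubA q * (eis2 q + 3 * (cubA q * cubA q)) / 12))).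
  { apply (Dd_unique (fun x => eis4 x + 9 * eis4 (x ^ 3)) q).
    - apply Dd_plus; [apply eis4_Dd, Hq|]. apply Dd_scal, Dd_cube, eis4_Dd, Hq3.
    - apply (Dd_ext_loc (fun x => 10 * cubA x ^ 4) _ _ _ (1 - Cmod q)); [lra| |].
      + intros x Hx. symmetry. apply eis4_sum, (disc_open q Hq x Hx).
      + apply Dd_scal, Dd_pow, Da. }
  assert (E2 : (eis2 q * eis4 q - eis6 q) / 3 =
     9 * (INR 4 * cubA q ^ 3 * (- cubE q / 3 + cubA q * (eis2 q + 3 * (cubA q * cubA q)) / 12))
     - 8 * ((- cubE q / 3 + cubA q * (eis2 q + 3 * (cubA q * cubA q)) / 12) * cubE q + cubA q * cubE' q)).
  { apply (Dd_unique eis4 q); [apply eis4_Dd, Hq|].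
    apply (Dd_ext_loc (fun x => 9 * cubA x ^ 4 - 8 * (cubA x * cubE x)) _ _ _ (1 - Cmod q)); [lra| |].
    - intros x Hx. symmetry. apply eis4_cub, (disc_open q Hq x Hx).
    - apply Dd_minus; [apply Dd_scal, Dd_pow, Da|]. apply Dd_scal, Dd_mult; assumption. }
  replace (RtoC (INR 4)) with (RtoC 4) in * by (f_equal; simpl; ring).
  assert (E3 := Lam_conv_X3 q Hq). assert (E4 := Lam_conv_C4 q Hq).
  assert (S1 := Lam_conv_S4 q Hq). assert (S2 := Lam_conv_S4 (q ^ 3) Hq3).
  rewrite Lam2_Cw, Lam_C1, Lam_C3, Lam_C5 in E4 by exact Hq.
  rewrite Lam_C1, Lam_C3 in E3 by exact Hq.
  assert (EX0 : Lam (Xw 0) q = (cubA q - 1) / 6) by (unfold cubA; field; cnz).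
  assert (EX2 : Lam (Xw 2) q = (1 - cubE q) / 9) by (unfold cubE; field; cnz).
  assert (ES : forall x, Lam (Sw 1) x = (1 - eis2 x) / 24 /\ Lam (Sw 3) x = (eis4 x - 1) / 240
      /\ Lam (Sw 5) x = (1 - eis6 x) / 504)
    by (intros x; unfold eis2, eis4, eis6; repeat split; field; cnz).
  destruct (ES q) as [F1 [F3 F5]]. destruct (ES (q ^ 3)) as [F1' [F3' F5']].
  rewrite EX0, EX2 in E3, E4. rewrite F1, F3, F5 in S1. rewrite F1', F3', F5' in S2.
  assert (EL : Lam2 (Xw 3) q = - cubE' q / 9) by (unfold cubE'; field; cnz). rewrite EL in E3.
  clear F1 F3 F5 F1' F3' F5' ES EX0 EX2 EL Da De.
  rewrite HP3, HQ3, HQ in *. clear HP3 HQ3 HQ.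
  set (P := eis2 q) in *. set (R := eis6 q) in *. set (R3 := eis6 (q ^ 3)) in *.
  set (a := cubA q) in *. set (e := cubE q) in *. set (e' := cubE' q) in *.
  set (d1 := Lam2 (Sw 4) q) in *. set (d2 := Lam2 (Sw 4) (q ^ 3)) in *. set (x4 := Lam (Xw 4) q) in *.
  clearbody P R R3 a e e' d1 d2 x4. clear Hq Hq3.
  assert (V1 : d1 = (1/2) * (-(16) * ((1 - P) / 24 * ((9 * a ^ 4 - 8 * (a * e) - 1) / 240)) +
     (- ((1 - P) / 24) / 15 + 2 * ((9 * a ^ 4 - 8 * (a * e) - 1) / 240) / 3 + 7 * ((1 - R) / 504) / 5))).
  { apply (lin_eq _ _ _ _ (-(1/2)) S1). field; cnz. }
  assert (V2 : d2 = (1/2) * (-(16) * ((1 - (P + 2 * (a * a)) / 3) / 24 * (((a ^ 4 + 8 * (a * e)) / 9 - 1) / 240)) +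
     (- ((1 - (P + 2 * (a * a)) / 3) / 24) / 15 + 2 * (((a ^ 4 + 8 * (a * e)) / 9 - 1) / 240) / 3 + 7 * ((1 - R3) / 504) / 5))).
  { apply (lin_eq _ _ _ _ (-(1/2)) S2). field; cnz. }
  rewrite V1, V2 in E4. clear V1 V2 S1 S2 d1 d2.
  assert (VR3 : R3 = (P + 2 * (a * a)) / 3 * ((a ^ 4 + 8 * (a * e)) / 9) + (P * (9 * a ^ 4 - 8 * (a * e)) - R) / 27
     - (10 / 9) * (4 * a ^ 3 * (- e / 3 + a * (P + 3 * (a * a)) / 12))).
  { apply (lin_eq _ _ _ _ (-(1/9)) E1). field; cnz. }
  assert (Vae : a * e' = (9 / 8) * (4 * a ^ 3 * (- e / 3 + a * (P + 3 * (a * a)) / 12))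
     - (- e / 3 + a * (P + 3 * (a * a)) / 12) * e - (P * (9 * a ^ 4 - 8 * (a * e)) - R) / 24).
  { apply (lin_eq _ _ _ _ (1/8) E2). field; cnz. }
  set (N1 := (P + 3 * (a * a)) / 12) in *.
  set (K := (81 * ((a ^ 4 + 8 * (a * e)) / 9) - (9 * a ^ 4 - 8 * (a * e))) / 240) in *.
  (* In [E4] the series [x4] enters as [6 * ((a - 1) / 6) * x4 + x4 = a * x4], so inserting this
     value brings in [e'] only as [a * e'], which [Vae] supplies. *)
  assert (Vx : x4 = -(1) / 3 + 2 / 9 * (3 * N1 * e + 3 / 2 * (a * K) - e')).
  { apply (lin_eq _ _ _ _ 1 E3). field; cnz. }
  rewrite Vx in E4. clear Vx E3 x4. unfold N1, K in *. clear N1 K.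
  assert (VR : R = -(27) * a ^ 6 + 36 * (a ^ 3 * e) - 8 * e ^ 2).
  { rewrite VR3 in E4.
    apply (lin_eq2 _ _ _ _ 54 _ _ 12 E4 Vae). field; cnz. }
  split; [exact VR|]. rewrite Vae, VR. field; cnz.
Qed.

(** * Eta quotients *)

(* [eulerLog q = - log prod_n (1 - q^n)] *)
Definition eulerLog (q : C) : C := CSeries (fun i => ell (q ^ S i)).

Lemma poly_bdd_1 : poly_bdd (fun _ => 1).
Proof. apply (poly_bdd_le _ 1); intros; rewrite Cmod_1; lra. Qed.

Lemma eulerLog_abs_conv q : (Cmod q < 1)%R -> abs_conv (fun i => ell (q ^ S i)).
Proof.
  intros Hq. eapply abs_conv_ext; [|exact (abs_conv_decr _ (PSum_abs_conv _ ell _ q nice_ell poly_bdd_1 Hq))].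
  intros n. simpl. ring.
Qed.

Lemma eulerLog_Dd q : (Cmod q < 1)%R -> Dd eulerLog q (Lam (Sw 1) q).
Proof.
  intros Hq.
  assert (E : forall x, (Cmod x < 1)%R -> PSum (fun _ => 1) ell x - 1 * ell 1 = eulerLog x).
  { intros x Hx. unfold PSum. rewrite CSeries_first by exact (PSum_abs_conv _ ell _ x nice_ell poly_bdd_1 Hx).
    rewrite (CSeries_ext (fun n => 1 * ell (x ^ S n)) (fun n => ell (x ^ S n))) by (intros; ring).
    change (x ^ 0) with (RtoC 1). unfold eulerLog. ring. }
  assert (D1 := Dd_minus _ _ _ _ _ (PSum_Dd _ ell _ q nice_ell poly_bdd_1 Hq) (Dd_const (1 * ell 1) q)).
  eapply Dd_eq.
  - apply (Dd_ext_loc (fun x => PSum (fun _ => 1) ell x - 1 * ell 1) eulerLog _ _ (1 - Cmod q));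
      [lra| |exact D1].
    intros x Hx. exact (E x (disc_open q Hq x Hx)).
  - unfold PSum. rewrite CSeries_first.
    + unfold Lam. rewrite (CSeries_ext _ (fun i => Sw 1 (S i) * lam q (S i))).
      * simpl INR. ring.
      * intros n. unfold Sw, lam, geo, Cdiv. ring.
    + apply abs_conv_incr. eapply abs_conv_ext; [|exact (Lam_abs_conv (Sw 1) q (poly_bdd_Sw 1) Hq)].
      intros n. unfold Sw, lam, geo, Cdiv. ring.
Qed.

Lemma Clim_cont f s l : Ccont f l -> Clim s l -> Clim (fun n => f (s n)) (f l).
Proof.
  intros Hf Hs. apply is_lim_seq_spec. intros eps.
  destruct (Hf eps (cond_pos eps)) as [d [Hd H]].
  apply is_lim_seq_spec in Hs. destruct (Hs (mkposreal d Hd)) as [N HN].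
  exists N. intros n Hn. specialize (HN n Hn). simpl in HN.
  rewrite Rminus_0_r, Rabs_pos_eq in * by apply Cmod_ge_0. apply H, HN.
Qed.

Lemma euler_product q : (Cmod q < 1)%R ->
  CLim_seq (Cprod (fun m => 1 - q ^ S m)) = Cexp (- eulerLog q).
Proof.
  intros Hq. apply Clim_CLim_seq.
  assert (Hc : Ccont (fun x => Cexp (-(1) * x)) (eulerLog q)).
  { apply (Cder_cont _ _ (Cexp (-(1) * eulerLog q) * (-(1) * 1))).
    apply (Cder_comp Cexp (fun x => -(1) * x)); [apply Cder_scal, Cder_id|apply Cder_Cexp]. }
  assert (L := Clim_cont _ _ _ Hc (CSeries_Clim _ (eulerLog_abs_conv q Hq))).
  cbv beta in L. fold (eulerLog q) in L.
  replace (- eulerLog q) with (-(1) * eulerLog q) by ring.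
  eapply Clim_ext; [|exact L]. intros n. cbv beta.
  induction n as [|n IH].
  - simpl. rewrite Cmult_0_r. apply Cexp_0.
  - rewrite Csum_S.
    change (Cprod (fun m => 1 - q ^ S m) (S n)) with (Cprod (fun m => 1 - q ^ S m) n * (1 - q ^ S n)).
    rewrite <- IH, <- (Cexp_ell (q ^ S n)) by (apply Cpow_disc; [exact Hq|lia]).
    rewrite <- Cexp_plus. f_equal. ring.
Qed.

Lemma Re_2piI (tau : C) : Re (2 * PI * Ci * tau) = (- (2 * PI * Im tau))%R.
Proof. destruct tau as [x y]. unfold Re, Im, Ci, RtoC, Cmult; simpl. ring. Qed.

Lemma Im_2piI (tau : C) : Im (2 * PI * Ci * tau) = (2 * PI * Re tau)%R.
Proof. destruct tau as [x y]. unfold Re, Im, Ci, RtoC, Cmult; simpl. ring. Qed.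

Lemma Cmod_nome tau : Cmod (nome tau) = exp (- (2 * PI * Im tau)).
Proof. unfold nome. rewrite Cmod_Cexp, Re_2piI. reflexivity. Qed.

Lemma nome_disc tau : (0 < Im tau)%R -> (Cmod (nome tau) < 1)%R.
Proof.
  intros H. rewrite Cmod_nome, <- exp_0. apply exp_increasing.
  pose proof PI_RGT_0. nra.
Qed.

Lemma nome_neq_0 tau : nome tau <> 0.
Proof. apply Cexp_neq_0. Qed.

Lemma nome_3 tau : nome (3 * tau) = nome tau ^ 3.
Proof.
  unfold nome. rewrite <- Cexp_nat. f_equal.
  replace (RtoC (INR 3)) with (RtoC 3) by (f_equal; simpl; ring). ring.
Qed.

Lemma eta_eq tau : (0 < Im tau)%R ->
  eta tau = Cexp (2 * PI * Ci * tau / 24) * Cexp (- eulerLog (nome tau)).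
Proof. intros H. unfold eta. rewrite euler_product; [reflexivity|apply nome_disc, H]. Qed.

(* [cubT q = 1 / u] and [cubB q = eta(tau)^3 / eta(3 tau)], as functions of the nome. *)
Definition cubU (q : C) : C := -(27) * Cexp (12 * (eulerLog q - eulerLog (q ^ 3))).
Definition cubT (q : C) : C := q * cubU q.
Definition cubB (q : C) : C := Cexp (eulerLog (q ^ 3) - 3 * eulerLog q).

Lemma cubU_neq_0 q : cubU q <> 0.
Proof.
  apply Cmult_neq_0; [|apply Cexp_neq_0]. intros E. apply (f_equal Re) in E. simpl in E. lra.
Qed.

Lemma cubB_neq_0 q : cubB q <> 0.
Proof. apply Cexp_neq_0. Qed.

(** The fractional powers combine to [q^(12 (1 - 3) / 24) = q^(-1)]: no root of [q] survives, and
    [1 / u] is a function of the nome. *)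
Lemma u_3B_eq tau : (0 < Im tau)%R -> u_3B tau = / cubT (nome tau).
Proof.
  intros H. assert (H3 : (0 < Im (3 * tau))%R) by (rewrite im_scal_l; lra).
  unfold u_3B. rewrite !eta_eq by assumption. rewrite nome_3.
  set (L := eulerLog (nome tau)). set (L3 := eulerLog (nome tau ^ 3)).
  pose proof (Cexp_neq_0 (2 * PI * Ci * (3 * tau) / 24)) as N1.
  pose proof (Cexp_neq_0 (- L3)) as N2.
  replace (Cexp (2 * PI * Ci * tau / 24) * Cexp (- L) /
    (Cexp (2 * PI * Ci * (3 * tau) / 24) * Cexp (- L3))) with
    (Cexp ((2 * PI * Ci * tau / 24 + - L) - (2 * PI * Ci * (3 * tau) / 24 + - L3)))
    by (rewrite Cexp_minus, !Cexp_plus; reflexivity).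
  rewrite <- Cexp_nat.
  replace (RtoC (INR 12)) with (RtoC 12) by (f_equal; simpl; ring).
  replace (12 * (2 * PI * Ci * tau / 24 + - L - (2 * PI * Ci * (3 * tau) / 24 + - L3)))
    with (- (2 * PI * Ci * tau + 12 * (L - L3))) by (field; cnz).
  rewrite Cexp_opp, Cexp_plus. unfold cubT, cubU. fold (nome tau). fold L L3.
  pose proof (nome_neq_0 tau). pose proof (Cexp_neq_0 (12 * (L - L3))).
  field. repeat split; try assumption; cnz.
Qed.

Lemma cubT_eq tau : (0 < Im tau)%R -> / u_3B tau = cubT (nome tau).
Proof.
  intros H. rewrite u_3B_eq by exact H.
  assert (N : cubT (nome tau) <> 0) by (apply Cmult_neq_0; [apply nome_neq_0|apply cubU_neq_0]).
  field. exact N.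
Qed.

Lemma eulerLog_cube_Dd q : (Cmod q < 1)%R ->
  Dd (fun x => eulerLog (x ^ 3)) q (3 * Lam (Sw 1) (q ^ 3)).
Proof. intros Hq. apply Dd_cube, eulerLog_Dd, disc_cube, Hq. Qed.

Lemma cubU_Dd q : (Cmod q < 1)%R -> Dd cubU q (cubU q * (cubA q * cubA q - 1)).
Proof.
  intros Hq. eapply Dd_eq.
  - apply Dd_scal, Dd_exp, Dd_scal, Dd_minus; [apply eulerLog_Dd, Hq|apply eulerLog_cube_Dd, Hq].
  - rewrite cubA_sq by exact Hq. unfold cubU, eis2. field; cnz.
Qed.

Lemma cubT_Dd q : (Cmod q < 1)%R -> Dd cubT q (cubT q * (cubA q * cubA q)).
Proof.
  intros Hq. eapply Dd_eq; [apply Dd_mult; [apply Dd_id|apply cubU_Dd, Hq]|].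
  unfold cubT. ring.
Qed.

Lemma cubB_Dd q : (Cmod q < 1)%R ->
  Dd cubB q (cubB q * ((eis2 q - cubA q * cubA q) / 12)).
Proof.
  intros Hq. eapply Dd_eq.
  - apply Dd_exp, Dd_minus; [apply eulerLog_cube_Dd, Hq|apply Dd_scal, eulerLog_Dd, Hq].
  - rewrite cubA_sq by exact Hq. unfold cubB, eis2. field; cnz.
Qed.

(** * Values and first derivatives at the cusp *)

Lemma CSeries_zero (f : nat -> C) : (forall n, f n = 0) -> CSeries f = 0.
Proof.
  intros H. apply CSeries_unique. apply Clim_ext with (fun _ => 0); [|apply Clim_const].
  intros n. rewrite (Csum_ext f (fun _ => 0 * 0)), Csum_scal; [ring|]. intros; rewrite H; ring.
Qed.

Lemma abs_conv_zero : abs_conv (fun _ => 0).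
Proof.
  apply (abs_conv_le _ (fun n => (1 / 2) ^ n)%R).
  - intros n. rewrite Cmod_0. apply pow_le. lra.
  - eexists. apply is_series_geom. rewrite Rabs_pos_eq; lra.
Qed.

Lemma Cpow_0_S n : (0 : C) ^ S n = 0.
Proof. simpl. ring. Qed.

Lemma Lam_0 w : Lam w 0 = 0.
Proof. unfold Lam. apply CSeries_zero. intros n. unfold lam, geo. rewrite Cpow_0_S. unfold Cdiv. ring. Qed.

Lemma eulerLog_0 : eulerLog 0 = 0.
Proof. unfold eulerLog. apply CSeries_zero. intros n. rewrite Cpow_0_S. apply ell_0. Qed.

Lemma eis2_0 : eis2 0 = 1.
Proof. unfold eis2. rewrite Lam_0. ring. Qed.
Lemma cubA_0 : cubA 0 = 1.
Proof. unfold cubA. rewrite Lam_0. ring. Qed.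
Lemma cubE_0 : cubE 0 = 1.
Proof. unfold cubE. rewrite Lam_0. ring. Qed.
Lemma cubU_0 : cubU 0 = -(27).
Proof.
  unfold cubU. rewrite Cpow_0_S, eulerLog_0. replace (12 * (0 - 0)) with (RtoC 0) by ring.
  rewrite Cexp_0. ring.
Qed.
Lemma cubT_0 : cubT 0 = 0.
Proof. unfold cubT. ring. Qed.
Lemma cubB_0 : cubB 0 = 1.
Proof.
  unfold cubB. rewrite Cpow_0_S, eulerLog_0. replace (0 - 3 * 0) with (RtoC 0) by ring. apply Cexp_0.
Qed.

(** [q d/dq] carries no information at [q = 0]; this recovers the true derivative there, to which
    only the term [n = 1] contributes. *)
Lemma Lam_Cder_0 w : poly_bdd w -> Cder (Lam w) 0 (w 1%nat).
Proof.
  intros Hw.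
  assert (H0 : (Cmod 0 < 1)%R) by (rewrite Cmod_0; lra).
  assert (E : forall x, (Cmod x < 1)%R -> PSum w geo x - w 0%nat * geo 1 = Lam w x).
  { intros x Hx. unfold PSum. rewrite CSeries_first by exact (PSum_abs_conv w geo _ x nice_geo Hw Hx).
    simpl Cpow at 1. unfold Lam, lam. ring. }
  assert (D1 := Cder_minus _ _ _ _ _ (PSum_Cder w geo _ 0 nice_geo Hw H0) (Cder_const (w 0%nat * geo 1) 0)).
  replace (w 1%nat) with (CSeries (fun n => w n * (/ ((1 - 0 ^ n) * (1 - 0 ^ n)) * (INR n * 0 ^ pred n))) - 0).
  - apply (Cder_ext_loc (fun x => PSum w geo x - w 0%nat * geo 1) (Lam w) _ _ 1); [lra| |exact D1].
    intros x Hx. apply E. replace (x - 0) with x in Hx by ring. exact Hx.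
  - assert (A : forall n, (fun n => w n * (/ ((1 - 0 ^ n) * (1 - 0 ^ n)) * (INR n * 0 ^ pred n))) (S (S n)) = 0).
    { intros n. simpl pred. rewrite (Cpow_0_S n). ring. }
    assert (A2 : abs_conv (fun n => w n * (/ ((1 - 0 ^ n) * (1 - 0 ^ n)) * (INR n * 0 ^ pred n)))).
    { apply abs_conv_incr, abs_conv_incr. exact (abs_conv_ext _ _ (fun n => eq_sym (A n)) abs_conv_zero). }
    rewrite (CSeries_first _ A2), (CSeries_first _ (abs_conv_decr _ A2)).
    rewrite (CSeries_zero _ A). simpl pred. rewrite (Cpow_0_S 0).
    change (INR 0) with 0%R. change (INR 1) with 1%R. change ((0 : C) ^ 0) with (RtoC 1).
    replace (/ ((1 - 0) * (1 - 0))) with (RtoC 1)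
      by (field; intros E0; apply (f_equal Re) in E0; simpl in E0; lra).
    ring.
Qed.

(** * The hypergeometric equation *)

Lemma PS_plus v w z : poly_bdd v -> poly_bdd w -> (Cmod z < 1)%R ->
  PS (fun n => v n + w n) z = PS v z + PS w z.
Proof.
  intros Hv Hw Hz. unfold PS. rewrite <- CSeries_plus by (apply PS_abs_conv; assumption).
  apply CSeries_ext. intros n; ring.
Qed.

Lemma PS_scal c w z : poly_bdd w -> (Cmod z < 1)%R -> PS (fun n => c * w n) z = c * PS w z.
Proof.
  intros Hw Hz. unfold PS. rewrite <- CSeries_scal by (apply PS_abs_conv; assumption).
  apply CSeries_ext. intros n; ring.
Qed.

Lemma PS_shift v w z : poly_bdd v -> poly_bdd w -> (Cmod z < 1)%R ->
  v O = 0 -> (forall n, v (S n) = w n) -> PS v z = z * PS w z.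
Proof.
  intros Hv Hw Hz H0 HS. unfold PS. rewrite CSeries_first by (apply PS_abs_conv; assumption).
  rewrite <- CSeries_scal by (apply PS_abs_conv; assumption).
  rewrite H0, Cmult_0_l, Cplus_0_l. apply CSeries_ext. intros n. rewrite HS. simpl. ring.
Qed.

(** The coefficients of [z d/dz] applied to the power series. *)
Definition thw (w : nat -> C) (n : nat) : C := INR n * w n.

Lemma poly_bdd_thw w : poly_bdd w -> poly_bdd (thw w).
Proof. intros H. apply poly_bdd_mult; [apply poly_bdd_INR|exact H]. Qed.

Lemma Dd_PS_comp w g q m : poly_bdd w -> (Cmod (g q) < 1)%R -> Dd g q (g q * m) ->
  Dd (fun x => PS w (g x)) q (PS (thw w) (g q) * m).
Proof.
  intros Hw Hg [g' [H1 H2]]. destruct (PS_Dd w (g q) Hw Hg) as [l [L1 L2]].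
  exists (l * g'). split; [apply Cder_comp; assumption|].
  unfold thw. rewrite <- L2. transitivity (l * (q * g')); [ring|]. rewrite H2. ring.
Qed.

Definition hcoefR (n : nat) : R :=
  (pochhammer (1 / 3) n * pochhammer (1 / 3) n / (pochhammer 1 n * INR (fact n)))%R.
Definition hcoef (n : nat) : C := hcoefR n.

Lemma pochhammer_1 n : pochhammer 1 n = INR (fact n).
Proof.
  induction n as [|n IH]; [reflexivity|].
  change (pochhammer 1 (S n)) with (pochhammer 1 n * (1 + INR n))%R.
  rewrite IH. change (fact (S n)) with (S n * fact n)%nat. rewrite mult_INR, S_INR. ring.
Qed.

Lemma hcoefR_rec n : (hcoefR (S n) * (INR n + 1) ^ 2 = hcoefR n * (INR n + 1 / 3) ^ 2)%R.
Proof.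
  unfold hcoefR. rewrite !pochhammer_1.
  change (pochhammer (1 / 3) (S n)) with (pochhammer (1 / 3) n * (1 / 3 + INR n))%R.
  change (fact (S n)) with (S n * fact n)%nat. rewrite mult_INR, S_INR.
  pose proof (INR_fact_lt_0 n). pose proof (pos_INR n). field. lra.
Qed.

Lemma hcoefR_0 : hcoefR 0 = 1%R.
Proof. unfold hcoefR. simpl. field. Qed.

Lemma hcoefR_S n : (hcoefR (S n) = hcoefR n * ((INR n + 1 / 3) / (INR n + 1)) ^ 2)%R.
Proof.
  pose proof (pos_INR n). pose proof (hcoefR_rec n) as H1.
  apply Rmult_eq_reg_r with ((INR n + 1) ^ 2)%R; [|apply pow_nonzero; lra].
  rewrite H1. field. lra.
Qed.

Lemma hcoefR_bounds n : (0 < hcoefR n <= 1)%R.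
Proof.
  induction n as [|n IH]; [rewrite hcoefR_0; lra|].
  rewrite hcoefR_S. pose proof (pos_INR n) as Hn.
  set (x := ((INR n + 1 / 3) / (INR n + 1))%R).
  assert (Hx : (0 < x <= 1)%R).
  { split; [apply Rdiv_lt_0_compat; lra|].
    apply Rmult_le_reg_r with (INR n + 1)%R; [lra|]. unfold x. field_simplify; lra. }
  assert (0 < x ^ 2 <= 1)%R by (simpl; nra). nra.
Qed.

Lemma poly_bdd_hcoef : poly_bdd hcoef.
Proof.
  apply (poly_bdd_le _ 1). intros n. unfold hcoef. pose proof (hcoefR_bounds n).
  rewrite Cmod_R, Rabs_pos_eq; lra.
Qed.

(* Telescoping bound: [c_n <= (27/8) (g_n - g_(n+1))] with [g_n = (n + 1/3) c_n],
   hence [sum_(n >= 1) c_n <= (27/8) g_1 = 1/2]. *)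
Lemma hcoefR_telescope n :
  (hcoefR (S n) <= 27 / 8 * ((INR (S n) + 1 / 3) * hcoefR (S n) - (INR (S (S n)) + 1 / 3) * hcoefR (S (S n))))%R.
Proof.
  rewrite (hcoefR_S (S n)). pose proof (hcoefR_bounds (S n)) as [Hc _].
  rewrite (S_INR (S n)). set (x := INR (S n)). assert (Hx : (1 <= x)%R) by apply INR_S_ge1.
  set (c := hcoefR (S n)) in *.
  assert (E : (27 / 8 * ((x + 1 / 3) * c - (x + 1 + 1 / 3) * (c * ((x + 1 / 3) / (x + 1)) ^ 2))
     = c * (27 / 8 * (1 / 3 - 4 / 27 * / ((x + 1) * (x + 1)))))%R).
  { field. lra. }
  rewrite E. rewrite <- (Rmult_1_r c) at 1. apply Rmult_le_compat_l; [lra|].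
  assert (/ ((x + 1) * (x + 1)) <= / 4)%R by (apply Rinv_le_contravar; nra). lra.
Qed.

Lemma hcoef_sum_bound (z : C) n : (Cmod z <= 1)%R ->
  (Cmod (Csum (fun i => (hcoef (S i) * z ^ S i)%C) n) <= 1 / 2 - 27 / 8 * ((INR (S n) + 1 / 3) * hcoefR (S n)))%R.
Proof.
  intros Hz. induction n as [|n IH].
  - simpl Csum. rewrite Cmod_0, (hcoefR_S 0), hcoefR_0. simpl. lra.
  - rewrite Csum_S. eapply Rle_trans; [apply Cmod_triangle|].
    assert (I : (Cmod (hcoef (S n) * z ^ S n) <= hcoefR (S n))%R).
    { rewrite Cmod_mult, Cmod_pow. unfold hcoef at 1. pose proof (hcoefR_bounds (S n)).
      rewrite Cmod_R, Rabs_pos_eq by lra. rewrite <- (Rmult_1_r (hcoefR (S n))) at 2.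
      apply Rmult_le_compat_l; [lra|]. rewrite <- (pow1 (S n)). apply pow_incr.
      split; [apply Cmod_ge_0|exact Hz]. }
    pose proof (hcoefR_telescope n). lra.
Qed.

Definition hypF : C -> C := PS hcoef.

(** The tail bound keeps [F] within 1/2 of its constant term 1. *)
Lemma hypF_neq_0 z : (Cmod z < 1)%R -> hypF z <> 0.
Proof.
  intros Hz E.
  assert (A := PS_abs_conv hcoef z poly_bdd_hcoef Hz).
  assert (L := CSeries_Clim _ (abs_conv_decr _ A)).
  assert (E2 : CSeries (fun n => hcoef (S n) * z ^ S n) = -(1)).
  { unfold hypF, PS in E. rewrite (CSeries_first _ A) in E. unfold hcoef at 1 in E. rewrite hcoefR_0 in E.
    replace (CSeries (fun n => hcoef (S n) * z ^ S n)) with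
      (1 * z ^ 0 + CSeries (fun n => hcoef (S n) * z ^ S n) - 1) by (simpl; ring).
    rewrite E. ring. }
  cbv beta in L. rewrite E2 in L.
  assert (Hle : Rbar_le (1 / 2)%R 0%R).
  { refine (is_lim_seq_le (fun _ => 1 / 2)%R _ _ _ _ (is_lim_seq_const _) L).
    intros n. pose proof (hcoef_sum_bound z n (Rlt_le _ _ Hz)) as B.
    pose proof (hcoefR_bounds (S n)). pose proof (pos_INR (S n)).
    assert (0 <= (INR (S n) + 1 / 3) * hcoefR (S n))%R by (apply Rmult_le_pos; lra).
    set (s := Csum (fun i => hcoef (S i) * z ^ S i) n) in *.
    assert (T : (Cmod (-(1)) <= Cmod s + Cmod (s - -(1)))%R).
    { replace (-(1)) with (s - (s - -(1))) at 1 by ring. apply Cmod_triangle_minus. }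
    rewrite Cmod_opp, Cmod_1 in T. lra. }
  simpl in Hle. lra.
Qed.

Definition hypF1 : C -> C := PS (thw hcoef).
Definition hypF2 : C -> C := PS (thw (thw hcoef)).

Lemma hcoef_rec n : hcoef (S n) * (INR (S n) * INR (S n)) =
  hcoef n * ((INR n + 1 / 3) * (INR n + 1 / 3)).
Proof.
  unfold hcoef. assert (H := hcoefR_rec n). rewrite S_INR.
  apply (f_equal RtoC) in H. rewrite !RtoC_mult, !RtoC_pow, !RtoC_plus, RtoC_div in H by lra.
  rewrite RtoC_plus.
  transitivity (hcoefR (S n) * (INR n + 1) ^ 2); [simpl; ring|]. rewrite H. simpl. ring.
Qed.

Ltac hbdd := repeat first
  [ exact poly_bdd_hcoef | apply poly_bdd_thw | apply poly_bdd_plus | apply poly_bdd_scal | assumption ].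

(** With [theta = z d/dz] this is [theta^2 F = z (theta + 1/3)^2 F], the recursion [hcoef_rec] in
    terms of power series. *)
Lemma hypF_ode z : (Cmod z < 1)%R ->
  (1 - z) * hypF2 z = z * (2 / 3 * hypF1 z + 1 / 9 * hypF z).
Proof.
  intros Hz.
  assert (E : hypF2 z = z * PS (fun n => thw (thw hcoef) n + (2 / 3 * thw hcoef n + 1 / 9 * hcoef n)) z).
  { apply PS_shift; try assumption; hbdd.
    - unfold thw. simpl. ring.
    - intros n. unfold thw.
      transitivity (hcoef (S n) * (INR (S n) * INR (S n))); [ring|]. rewrite hcoef_rec. field; cnz. }
  rewrite !PS_plus, !PS_scal in E by (assumption || hbdd).
  fold hypF hypF1 hypF2 in E.
  apply (lin_eq _ _ _ _ 1 E). ring.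
Qed.

(* Frobenius' second solution at [z = 0] is [log z * hypF z + hypG z]. *)
Fixpoint hharm (n : nat) : R :=
  match n with
  | O => 0%R
  | S m => (hharm m + (2 / (INR m + 1 / 3) - 2 / (INR m + 1)))%R
  end.
Definition hcoefG (n : nat) : C := hcoef n * hharm n.
Definition hypG : C -> C := PS hcoefG.
Definition hypG1 : C -> C := PS (thw hcoefG).
Definition hypG2 : C -> C := PS (thw (thw hcoefG)).

Lemma hharm_bounds n : (0 <= hharm n <= 6 * INR n)%R.
Proof.
  induction n as [|n IH]; [simpl; lra|].
  change (hharm (S n)) with (hharm n + (2 / (INR n + 1 / 3) - 2 / (INR n + 1)))%R.
  rewrite S_INR. pose proof (pos_INR n) as Hn.
  assert (I1 : (2 / (INR n + 1 / 3) <= 6)%R).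
  { apply Rmult_le_reg_r with (INR n + 1 / 3)%R; [lra|]. field_simplify; lra. }
  assert (I2 : (0 <= 2 / (INR n + 1))%R) by (apply Rlt_le, Rdiv_lt_0_compat; lra).
  assert (I3 : (2 / (INR n + 1) <= 2 / (INR n + 1 / 3))%R).
  { apply Rmult_le_compat_l; [lra|]. apply Rinv_le_contravar; lra. }
  lra.
Qed.

Lemma poly_bdd_hcoefG : poly_bdd hcoefG.
Proof.
  apply poly_bdd_mult; [apply poly_bdd_hcoef|].
  exists 6%R, 1%nat. split; [lra|]. intros n. pose proof (hharm_bounds n).
  rewrite Cmod_R, Rabs_pos_eq, pow_1, S_INR by lra. lra.
Qed.

(** Frobenius' method: the derivative at [s = 0] of the coefficient recursion with [n] replaced by
    [n + s]; [hharm] is the logarithmic derivative of the shifted coefficients. *)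
Lemma hcoefG_rec n : hcoefG (S n) * (INR (S n) * INR (S n)) + 2 * (INR (S n) * hcoef (S n)) =
  hcoefG n * ((INR n + 1 / 3) * (INR n + 1 / 3)) + 2 * ((INR n + 1 / 3) * hcoef n).
Proof.
  unfold hcoefG.
  replace (hcoef (S n) * hharm (S n) * (INR (S n) * INR (S n)))
    with (hcoef (S n) * (INR (S n) * INR (S n)) * hharm (S n)) by ring.
  assert (N1 : RtoC (INR n) + 1 <> 0).
  { rewrite <- RtoC_plus. intros E. apply RtoC_inj in E. pose proof (pos_INR n). lra. }
  assert (N2 : RtoC (INR n) + 1 / 3 <> 0).
  { rewrite <- RtoC_div, <- RtoC_plus by lra. intros E. apply RtoC_inj in E. pose proof (pos_INR n). lra. }
  assert (N3 : 3 * RtoC (INR n) + 1 <> 0).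
  { replace (3 * RtoC (INR n) + 1) with (3 * (RtoC (INR n) + 1 / 3)) by (field; cnz).
    apply Cmult_neq_0; [cnz|exact N2]. }
  assert (N4 : RtoC (INR n) * 3 + 1 <> 0) by (rewrite Cmult_comm; exact N3).
  assert (E : hcoef (S n) = hcoef n * ((INR n + 1 / 3) * (INR n + 1 / 3)) / ((INR n + 1) * (INR n + 1))).
  { rewrite <- hcoef_rec, S_INR, RtoC_plus. field. exact N1. }
  rewrite hcoef_rec, E.
  change (hharm (S n)) with (hharm n + (2 / (INR n + 1 / 3) - 2 / (INR n + 1)))%R.
  pose proof (pos_INR n).
  rewrite S_INR, !RtoC_plus, RtoC_minus, !RtoC_div, !RtoC_plus, RtoC_div by lra.
  field. repeat split; try assumption; cnz.
Qed.

Lemma hypG_ode z : (Cmod z < 1)%R ->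
  (1 - z) * hypG2 z = z * (2 / 3 * hypG1 z + 1 / 9 * hypG z + 2 * hypF1 z + 2 / 3 * hypF z) - 2 * hypF1 z.
Proof.
  intros Hz. pose proof poly_bdd_hcoefG.
  assert (E : PS (fun n => thw (thw hcoefG) n + 2 * thw hcoef n) z =
    z * PS (fun n => thw (thw hcoefG) n + (2 / 3 * thw hcoefG n + (1 / 9 * hcoefG n + (2 * thw hcoef n + 2 / 3 * hcoef n)))) z).
  { apply PS_shift; try assumption; hbdd.
    - unfold thw. simpl. ring.
    - intros n. unfold thw.
      transitivity (hcoefG (S n) * (INR (S n) * INR (S n)) + 2 * (INR (S n) * hcoef (S n))); [ring|].
      rewrite hcoefG_rec. field; cnz. }
  rewrite !PS_plus, !PS_scal in E by (assumption || hbdd).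
  fold hypF hypF1 hypF2 hypG hypG1 hypG2 in E.
  apply (lin_eq _ _ _ _ 1 E). ring.
Qed.

(** Abel's identity for the solutions [F] and [log z * F + G]. The left side is their Wronskian with
    respect to [z d/dz], in which the logarithms cancel; the right side is [(1 - z)^(-2/3)]. *)
Lemma hyp_wronskian z : (Cmod z < 1)%R ->
  hypF z * hypF z + hypF z * hypG1 z - hypG z * hypF1 z = Cexp (2 / 3 * ell z).
Proof.
  intros Hz. pose proof poly_bdd_hcoefG as BG. pose proof poly_bdd_hcoef as BF.
  set (X := fun x => (hypF x * hypF x + hypF x * hypG1 x - hypG x * hypF1 x) * Cexp (- (2 / 3) * ell x)).
  assert (E : X z = 1).
  { transitivity (X 0).
    - apply Dd_zero_ray. intros s Hs. pose proof (ray_disc z s Hs Hz) as Hx.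
      set (x := s * z) in *. pose proof (one_minus_neq0 x Hx) as N.
      assert (DF : Dd hypF x (hypF1 x)) by (apply PS_Dd; hbdd).
      assert (DF1 : Dd hypF1 x (hypF2 x)) by (apply PS_Dd; hbdd).
      assert (DG : Dd hypG x (hypG1 x)) by (apply PS_Dd; hbdd).
      assert (DG1 : Dd hypG1 x (hypG2 x)) by (apply PS_Dd; hbdd).
      eapply Dd_eq.
      { apply Dd_mult; [apply Dd_minus; [apply Dd_plus; apply Dd_mult; eassumption|apply Dd_mult; eassumption]|].
        apply Dd_exp, Dd_scal, ell_Dd, Hx. }
      assert (V1 : hypF2 x = x * (2 / 3 * hypF1 x + 1 / 9 * hypF x) / (1 - x)).
      { rewrite <- hypF_ode by exact Hx. field. exact N. }
      assert (V2 : hypG2 x = (x * (2 / 3 * hypG1 x + 1 / 9 * hypG x + 2 * hypF1 x + 2 / 3 * hypF x) - 2 * hypF1 x) / (1 - x)).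
      { rewrite <- hypG_ode by exact Hx. field. exact N. }
      rewrite V1, V2. unfold geo. field. repeat split; try assumption; cnz.
    - unfold X. rewrite ell_0. replace (- (2 / 3) * 0) with (RtoC 0) by ring. rewrite Cexp_0.
      unfold hypF, hypG, hypF1, hypG1. rewrite !PS_0. unfold thw, hcoefG, hcoef. simpl INR.
      rewrite hcoefR_0. simpl. ring. }
  unfold X in E.
  pose proof (Cexp_neq_0 (2 / 3 * ell z)) as N.
  replace (- (2 / 3) * ell z) with (- (2 / 3 * ell z)) in E by ring.
  rewrite Cexp_opp in E.
  apply (lin_eq _ _ _ _ (Cexp (2 / 3 * ell z)) E). field. exact N.
Qed.

Lemma Im_PS_real w (x : R) : (forall n, Im (w n) = 0%R) -> Im (PS w x) = 0%R.
Proof.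
  intros H. unfold PS, CSeries. simpl. rewrite (Series_ext _ (fun n => 0 * 0)%R).
  - rewrite Series_scal_l. ring.
  - intros n. rewrite <- RtoC_pow. transitivity (Im (w n) * x ^ n)%R; [|rewrite H; ring].
    exact (im_scal_r (w n) (x ^ n)%R).
Qed.

(** * Propagation along the component of the cusp *)

(* The image of [disc_region] under the nome, with the cusp [0] added. *)
Definition Omega (q : C) : Prop := (Cmod q < 1)%R /\ (Cmod (cubT q) < 1)%R.

Definition nearby (q : C) (G : C -> Prop) : Prop :=
  exists r : R, (0 < r)%R /\ forall x : C, (Cmod (x - q) < r)%R -> G x.

(** Both conditions are relative to [Omega]; the base point 0 is the cusp, which is not the nome of
    any point. *)
Definition clopen (G : C -> Prop) : Prop :=
  (forall q, Omega q -> G q -> nearby q G) /\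
  (forall q, Omega q -> ~ G q -> nearby q (fun x => ~ G x)) /\ G 0.

Lemma nearby_and q G H : nearby q G -> nearby q H -> nearby q (fun x => G x /\ H x).
Proof.
  intros [r [Hr A]] [s [Hs B]]. exists (Rmin r s). split; [apply Rmin_pos; assumption|].
  intros x Hx. split; [apply A|apply B]; eapply Rlt_le_trans; try exact Hx; [apply Rmin_l|apply Rmin_r].
Qed.

Lemma nearby_imp q (G H : C -> Prop) : (forall x, G x -> H x) -> nearby q G -> nearby q H.
Proof. intros I [r [Hr A]]. exists r. split; auto. Qed.

Lemma nearby_ball (q : C) (r : R) : (Cmod q < r)%R -> nearby q (fun x => (Cmod x < r)%R).
Proof.
  intros H. exists (r - Cmod q)%R. split; [lra|]. intros x Hx.
  replace x with ((x - q) + q) by ring. eapply Rle_lt_trans; [apply Cmod_triangle|]. lra.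
Qed.

Lemma Ccont_nearby f q (G : C -> Prop) : Ccont f q -> nearby (f q) G -> nearby q (fun x => G (f x)).
Proof.
  intros Hf [r [Hr A]]. destruct (Hf r Hr) as [d [Hd B]]. exists d. split; auto.
Qed.

Lemma nearby_neq (f : C -> C) (q c : C) : Ccont f q -> f q <> c -> nearby q (fun x => f x <> c).
Proof.
  intros Hf N. apply (Ccont_nearby f q (fun y => y <> c) Hf).
  exists (Cmod (f q - c)). split.
  - apply Cmod_gt_0. intros E. apply N, Ceq_minus, E.
  - intros x Hx ->. rewrite Cmod_sym in Hx. lra.
Qed.

Lemma Omega_0 : Omega 0.
Proof. split; [|rewrite cubT_0]; rewrite Cmod_0; lra. Qed.

Lemma Omega_open q : Omega q -> nearby q Omega.
Proof.
  intros [H1 H2]. apply nearby_and; [apply nearby_ball, H1|].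
  apply (Ccont_nearby cubT q (fun y => (Cmod y < 1)%R)); [|apply nearby_ball, H2].
  exact (Dd_cont _ _ _ (cubT_Dd q H1)).
Qed.

Lemma nearby_ray (G : C -> Prop) : nearby 0 G -> exists r : R, (0 < r)%R /\
  forall x, (Cmod (x - 0) < r)%R -> forall s : R, (0 <= s <= 1)%R -> G (s * x).
Proof.
  intros [r [Hr A]]. exists r. split; [exact Hr|]. intros x Hx s Hs. apply A.
  replace (s * x - 0) with (s * (x - 0)) by ring.
  rewrite Cmod_mult, Cmod_R, Rabs_pos_eq by lra. pose proof (Cmod_ge_0 (x - 0)). nra.
Qed.

(** At [q = 0] the argument runs along rays from the origin; elsewhere it uses a ball avoiding 0, in
    which [q d/dq X = 0] means that the derivative itself vanishes. *)
Lemma nearby_const X q : nearby q (fun x => Dd X x 0) -> nearby q (fun x => X x = X q).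
Proof.
  intros H. destruct (Ceq_dec q 0) as [->|N].
  - destruct (nearby_ray _ H) as [r [Hr A]]. exists r. split; [exact Hr|]. intros x Hx.
    apply Dd_zero_ray. intros s Hs. apply A; assumption.
  - assert (Hc : Ccont (fun x => x) q) by exact (Cder_cont _ _ _ (Cder_id q)).
    destruct (nearby_and _ _ _ (nearby_neq (fun x => x) q 0 Hc N) H) as [r [Hr A]].
    exists r. split; [exact Hr|]. exact (Dd_zero_ball X q r A).
Qed.

(** This chains the identities: where the earlier ones, gathered in [G], hold, [X] is locally
    constant, so its value at the cusp can be added to them. *)
Lemma clopen_step G X : clopen G -> (forall q, Omega q -> G q -> Dd X q 0) ->
  clopen (fun q => G q /\ X q = X 0).
Proof.
  intros [C1 [C2 C3]] HX.
  assert (HD : forall q, Omega q -> G q -> nearby q (fun x => Dd X x 0)).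
  { intros q Hq Gq. eapply nearby_imp; [|exact (nearby_and _ _ _ (Omega_open q Hq) (C1 q Hq Gq))].
    intros x [Ox Gx]. apply HX; assumption. }
  repeat split.
  - intros q Hq [Gq Eq]. apply nearby_and; [apply C1; assumption|].
    rewrite <- Eq. apply nearby_const, HD; assumption.
  - intros q Hq NG. destruct (classic (G q)) as [Gq|Gq].
    + assert (N : X q <> X 0) by tauto.
      eapply nearby_imp; [|exact (nearby_neq X q (X 0) (Dd_cont _ _ _ (HX q Hq Gq)) N)].
      intros x; tauto.
    + eapply nearby_imp; [|exact (C2 q Hq Gq)]. intros x; tauto.
  - exact C3.
Qed.

Lemma nome_cont tau : Ccont nome tau.
Proof.
  unfold nome. eapply Cder_cont.
  apply (Cder_comp Cexp (fun z => 2 * PI * Ci * z)); [apply Cder_scal, Cder_id|apply Cder_Cexp].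
Qed.

Lemma nearby_nearby q G : nearby q G -> nearby q (fun x => nearby x G).
Proof.
  intros [r [Hr A]]. exists (r / 2)%R. split; [lra|]. intros x Hx.
  exists (r / 2)%R. split; [lra|]. intros y Hy. apply A.
  replace (y - q) with ((y - x) + (x - q)) by ring.
  eapply Rle_lt_trans; [apply Cmod_triangle|]. lra.
Qed.

Lemma nearby_open (U : C -> Prop) : (forall z, U z -> nearby z U) -> @open C_UniformSpace U.
Proof.
  intros H z Uz. destruct (H z Uz) as [r [Hr A]].
  (* Balls of [C_UniformSpace] are squares, and the square of half-side [r / 2] lies in the disc of
     radius [r]. *)
  assert (Hr2 : (0 < r / 2)%R) by lra.
  exists (mkposreal _ Hr2). intros y Hy. apply A.
  destruct Hy as [H1 H2].
  change (Rabs (Re y - Re z) < r / 2)%R in H1. change (Rabs (Im y - Im z) < r / 2)%R in H2.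
  eapply Rle_lt_trans; [apply Cmod_le_Re_Im|]. rewrite Re_minus, Im_minus. lra.
Qed.

Lemma disc_region_Omega tau : disc_region tau -> Omega (nome tau).
Proof.
  intros [[H _] H2]. split; [apply nome_disc, H|]. rewrite <- cubT_eq by exact H. exact H2.
Qed.

(** [connected] speaks of open sets of the plane, so the separating sets consist of the points
    around whose nome [G], respectively its negation, holds on a full neighbourhood. They are
    disjoint and cover the connecting set, and a point high in the half-plane lies in the first. *)
Lemma clopen_component G tau : clopen G -> C_inv_u_infty tau -> G (nome tau).
Proof.
  intros [C1 [C2 C3]] [Dtau Hcomp].
  destruct (nearby_nearby _ _ (C1 0 Omega_0 C3)) as [r [Hr A]].
  (* Since [|nome z| = exp (- 2 pi Im z)], above this height the nome is smaller than [r]. *)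
  destruct (Hcomp (- ln r / (2 * PI))%R) as [z [[B [HB [HBA [Btau Bz]]]] Hz]].
  assert (Hpi : (0 < 2 * PI)%R) by (pose proof PI_RGT_0; lra).
  set (U := fun z => nearby (nome z) G). set (V := fun z => nearby (nome z) (fun x => ~ G x)).
  assert (oU : forall w H, nearby (nome w) H -> nearby w (fun z => nearby (nome z) H)).
  { intros w H HH. apply (Ccont_nearby nome w (fun x => nearby x H) (nome_cont w)), nearby_nearby, HH. }
  assert (self : forall q H, nearby q H -> H q).
  { intros q H [s [Hs K]]. apply K. replace (q - q) with (RtoC 0) by ring. rewrite Cmod_0. exact Hs. }
  assert (cover : forall w, B w -> U w \/ V w).
  { intros w Bw. pose proof (disc_region_Omega w (HBA w Bw)) as Ow.
    destruct (classic (G (nome w))); [left; apply C1|right; apply C2]; assumption. }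
  destruct (cover tau Btau) as [Ut|Vt]; [exact (self _ _ Ut)|].
  exfalso.
  assert (Uz : U z).
  { apply A. replace (nome z - 0) with (nome z) by ring. rewrite Cmod_nome.
    rewrite <- (exp_ln r Hr). apply exp_increasing.
    apply (Rmult_lt_compat_l (2 * PI)) in Hz; [|exact Hpi].
    replace (2 * PI * (- ln r / (2 * PI)))%R with (- ln r)%R in Hz by (field; lra). lra. }
  destruct (HB U V) as [w [_ [Uw Vw]]].
  - apply nearby_open. intros w. apply oU.
  - apply nearby_open. intros w. apply oU.
  - exact cover.
  - exists z; auto.
  - exists tau; auto.
  - exact (self _ _ Vw (self _ _ Uw)).
Qed.

(** * The cubic relations between [a], [b], [e] and [t] *)

Definition cubic (q : C) : Prop :=
  cubE q = cubB q ^ 3 /\ cubA q ^ 3 = cubE q * (1 - cubT q).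

Lemma cubic_neq_0 q : Omega q -> cubic q -> cubA q <> 0 /\ cubE q <> 0.
Proof.
  intros [_ Ht] [H1 H2].
  assert (NE : cubE q <> 0) by (rewrite H1; apply Cpow_nz, cubB_neq_0).
  split; [|exact NE]. intros E. rewrite E in H2.
  apply (Cmult_neq_0 _ _ NE (one_minus_neq0 _ Ht)). rewrite <- H2. simpl. ring.
Qed.

Lemma cubE_Dd q : (Cmod q < 1)%R -> cubA q <> 0 ->
  Dd cubE q (cubE q * (eis2 q - cubA q * cubA q) / 4).
Proof.
  intros Hq N. eapply Dd_eq; [apply cubE_Dd', Hq|].
  destruct (cubic_weight6 q Hq) as [_ E].
  apply (lin_eq _ _ _ _ (/ cubA q) E). field. exact N.
Qed.

(* The first order equations for [cubV] and [cubE] need [cubA <> 0]; conversely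
   [cubic] forces [cubA <> 0] on [Omega].  This is why [cubic] is a clopen condition. *)
Definition cubV (q : C) : C := cubA q ^ 3 - cubE q * (1 - cubT q).

Lemma cubV_Dd q : (Cmod q < 1)%R -> cubA q <> 0 ->
  Dd cubV q (cubV q * (eis2 q + 3 * (cubA q * cubA q)) / 4).
Proof.
  intros Hq N. eapply Dd_eq.
  - apply Dd_minus; [apply Dd_pow, cubA_Dd, Hq|].
    apply Dd_mult; [apply cubE_Dd; assumption|apply Dd_minus; [apply Dd_const|apply cubT_Dd, Hq]].
  - unfold cubV. replace (RtoC (INR 3)) with (RtoC 3) by (f_equal; simpl; ring). field; cnz.
Qed.

(** Quotients of solutions of the same first order equation: [e] and [b^3] have logarithmic
    derivative [(P - a^2) / 4], while [cubV] and [t b^3] both satisfy [D y = y (P + 3 a^2) / 4]. *)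
Definition cubX (q : C) : C := cubE q / cubB q ^ 3.
Definition cubY (q : C) : C := cubV q / (cubT q * cubB q ^ 3).

Lemma cubX_Dd q : (Cmod q < 1)%R -> cubA q <> 0 -> Dd cubX q 0.
Proof.
  intros Hq N. pose proof (cubB_neq_0 q) as NB. eapply Dd_eq.
  - apply Dd_div; [apply Cpow_nz, NB|apply cubE_Dd; assumption|apply Dd_pow, cubB_Dd, Hq].
  - replace (RtoC (INR 3)) with (RtoC 3) by (f_equal; simpl; ring). field. repeat split; try exact NB; cnz.
Qed.

Lemma cubT_neq_0 (q : C) : q <> 0 -> cubT q <> 0.
Proof. intros N. apply Cmult_neq_0; [exact N|apply cubU_neq_0]. Qed.

Lemma cubY_Dd (q : C) : (Cmod q < 1)%R -> q <> 0 -> cubA q <> 0 -> Dd cubY q 0.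
Proof.
  intros Hq Nq N. pose proof (cubB_neq_0 q) as NB. pose proof (cubT_neq_0 q Nq) as NT. eapply Dd_eq.
  - apply Dd_div; [apply Cmult_neq_0; [exact NT|apply Cpow_nz, NB]|apply cubV_Dd; assumption|].
    apply Dd_mult; [apply cubT_Dd, Hq|apply Dd_pow, cubB_Dd, Hq].
  - replace (RtoC (INR 3)) with (RtoC 3) by (f_equal; simpl; ring). field. repeat split; try assumption; cnz.
Qed.

(** [cubY] divides by [t b^3], which has a simple zero at the cusp, so [cubV 0 = 0] alone would
    leave its value open. The linear coefficients agree: [3 * 6 = 18] for [a^3] and [-9 + 27 = 18]
    for [e (1 - t)]. *)
Lemma cubV_Cder_0 : Cder cubV 0 0.
Proof.
  assert (DA : Cder cubA 0 (0 + 6 * Xw 0 1)).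
  { apply Cder_plus; [apply Cder_const|apply Cder_scal, Lam_Cder_0, poly_bdd_Xw]. }
  assert (DE : Cder cubE 0 (0 - 9 * Xw 2 1)).
  { apply Cder_minus; [apply Cder_const|apply Cder_scal, Lam_Cder_0, poly_bdd_Xw]. }
  assert (H0 : (Cmod 0 < 1)%R) by (rewrite Cmod_0; lra).
  destruct (cubU_Dd 0 H0) as [u' [DU _]].
  assert (DT := Cder_mult _ _ _ _ _ (Cder_id 0) DU).
  assert (D := Cder_minus _ _ _ _ _ (Cder_pow _ _ _ 2 DA)
    (Cder_mult _ _ _ _ _ DE (Cder_minus _ _ _ _ _ (Cder_const 1 0) DT))).
  match type of D with Cder _ _ ?l => replace (RtoC 0) with l at 2 end.
  - exact D.
  - rewrite cubA_0, cubE_0, cubU_0. unfold Xw. rewrite chi_1.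
    replace (RtoC (INR 1)) with (RtoC 1) by reflexivity.
    replace (RtoC (INR 3)) with (RtoC 3) by (f_equal; simpl; ring). ring.
Qed.

(** [cubY] is constant on the ray from 0 to [x] without its origin and tends to 0 along it, because
    [cubV y = o(y)] while [t b^3] behaves like [-27 y]. The segments start at [s0 * x], since the
    quotient has no meaning at 0 itself. *)
Lemma cubY_small (x : C) (r : R) : (0 < r)%R -> (Cmod (x - 0) < r)%R -> x <> 0 ->
  (forall y : C, (Cmod (y - 0) < r)%R -> (Cmod y < 1)%R /\ cubA y <> 0) -> cubY x = 0.
Proof.
  intros Hr Hx Nx Hball.
  assert (Ax : (0 < Cmod x)%R) by (apply Cmod_gt_0; exact Nx).
  assert (Hray : forall s : R, (0 < s <= 1)%R -> cubY x = cubY (s * x)).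
  { intros s0 Hs0. apply (const_on_ray cubY (s0 * x) x (fun _ => 0)); [|reflexivity].
    intros s Hs.
    assert (E : s0 * x + s * (x - s0 * x) = RtoC (s0 + s * (1 - s0))%R * x).
    { rewrite RtoC_plus, RtoC_mult, RtoC_minus. ring. }
    rewrite E. assert (Hs1 : (0 < s0 + s * (1 - s0) <= 1)%R) by nra.
    set (k := (s0 + s * (1 - s0))%R) in *.
    destruct (Hball (k * x)) as [B1 B2].
    { replace (k * x - 0) with (k * (x - 0)) by ring.
      rewrite Cmod_mult, Cmod_R, Rabs_pos_eq by lra. pose proof (Cmod_ge_0 (x - 0)). nra. }
    assert (N : k * x <> 0).
    { apply Cmult_neq_0; [|exact Nx]. intros Ek. apply RtoC_inj in Ek. lra. }
    apply Dd_zero_Cder; [exact N|]. apply cubY_Dd; assumption. }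
  assert (H0 : (Cmod 0 < 1)%R) by (rewrite Cmod_0; lra).
  (* [cubY y = cubV y / (y m(y))] with [m 0 = -27], and [cubV y = o(y)]. *)
  set (m := fun y => cubU y * cubB y ^ 3).
  assert (Hm : Ccont m 0).
  { exact (Dd_cont _ _ _ (Dd_mult _ _ _ _ _ (cubU_Dd 0 H0) (Dd_pow _ _ _ 2 (cubB_Dd 0 H0)))). }
  assert (m0 : m 0 = -(27)) by (unfold m; rewrite cubU_0, cubB_0; simpl; ring).
  apply Cmod_eq_0. apply Rle_antisym; [|apply Cmod_ge_0].
  apply le_epsilon. intros eps Heps. rewrite Rplus_0_l.
  destruct (cubV_Cder_0 eps Heps) as [d1 [Hd1 B1]].
  destruct (Hm 1%R Rlt_0_1) as [d2 [Hd2 B2]].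
  set (s := Rmin 1 (Rmin (d1 / (2 * Cmod x)) (d2 / (2 * Cmod x)))).
  assert (Hs0 : (0 < s)%R).
  { unfold s. repeat apply Rmin_pos; try lra; apply Rdiv_lt_0_compat; lra. }
  assert (Hs1 : (s <= 1)%R) by apply Rmin_l.
  assert (Hs2 : (s <= d1 / (2 * Cmod x))%R) by (eapply Rle_trans; [apply Rmin_r|apply Rmin_l]).
  assert (Hs3 : (s <= d2 / (2 * Cmod x))%R) by (eapply Rle_trans; [apply Rmin_r|apply Rmin_r]).
  clearbody s.
  assert (Es : Cmod (s * x - 0) = (s * Cmod x)%R).
  { replace (s * x - 0) with (s * x) by ring. rewrite Cmod_mult, Cmod_R, Rabs_pos_eq by lra. reflexivity. }
  assert (L : forall d, (s <= d / (2 * Cmod x))%R -> (0 < d)%R -> (s * Cmod x < d)%R).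
  { intros d Hd Hd0. apply Rle_lt_trans with (d / (2 * Cmod x) * Cmod x)%R.
    - apply Rmult_le_compat_r; lra.
    - replace (d / (2 * Cmod x) * Cmod x)%R with (d / 2)%R by (field; lra). lra. }
  rewrite (Hray s) by lra.
  set (y := s * x) in *.
  assert (V0 : cubV 0 = 0).
  { unfold cubV. rewrite cubA_0, cubE_0, cubT_0. simpl. ring. }
  specialize (B1 y ltac:(rewrite Es; auto)). specialize (B2 y ltac:(rewrite Es; auto)).
  rewrite V0, m0 in *.
  replace (cubV y - 0 - 0 * (y - 0)) with (cubV y) in B1 by ring.
  replace (y - 0) with y in * by ring.
  assert (Ny : (0 < Cmod y)%R) by (rewrite Es; nra).
  assert (Nyc : y <> 0) by (apply Cmod_gt_0; exact Ny).
  assert (Hmy : (1 <= Cmod (m y))%R).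
  { assert (T : (Cmod (-(27)) <= Cmod (m y) + Cmod (m y - -(27)))%R).
    { replace (-(27)) with (m y - (m y - -(27))) at 1 by ring. apply Cmod_triangle_minus. }
    rewrite Cmod_opp, Cmod_R, Rabs_pos_eq in T by lra. lra. }
  assert (Nm : m y <> 0) by (apply Cmod_gt_0; lra).
  unfold cubY. replace (cubT y * cubB y ^ 3) with (y * m y) by (unfold cubT, m; ring).
  rewrite Cmod_div by (apply Cmult_neq_0; assumption). rewrite Cmod_mult.
  apply Rmult_le_reg_r with (Cmod y * Cmod (m y))%R; [nra|].
  unfold Rdiv. rewrite Rmult_assoc, Rinv_l, Rmult_1_r by nra.
  eapply Rle_trans; [exact B1|]. apply Rmult_le_compat_l; [lra|].
  rewrite <- (Rmult_1_r (Cmod y)) at 1. apply Rmult_le_compat_l; lra.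
Qed.

Lemma cubX_0 : cubX 0 = 1.
Proof. unfold cubX. rewrite cubE_0, cubB_0. simpl. field. Qed.

Lemma cubic_iff (q : C) : q <> 0 -> (cubic q <-> cubX q = 1 /\ cubY q = 0).
Proof.
  intros N. pose proof (cubB_neq_0 q) as NB. pose proof (cubT_neq_0 q N) as NT.
  assert (NB3 : cubB q ^ 3 <> 0) by (apply Cpow_nz, NB).
  unfold cubic, cubX, cubY. split.
  - intros [E1 E2]. split.
    + rewrite E1. field. exact NB.
    + unfold cubV. rewrite E2.
      replace (cubE q * (1 - cubT q) - cubE q * (1 - cubT q)) with (RtoC 0) by ring.
      unfold Cdiv. ring.
  - intros [E1 E2]. split.
    + apply (lin_eq _ _ _ _ (cubB q ^ 3) E1). field. exact NB.
    + apply (lin_eq _ _ _ _ (cubT q * cubB q ^ 3) E2). unfold cubV. field. split; assumption.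
Qed.

(** Openness rests on the local constancy of [cubX] and [cubY], available because [cubic] gives
    [a <> 0]. Where [cubic] fails, [a] may vanish, so there the continuity of [cubE] comes from
    [cubE_Dd']. *)
Lemma clopen_cubic : clopen cubic.
Proof.
  assert (HA : forall q, Omega q -> cubA q <> 0 -> nearby q (fun x => (Cmod x < 1)%R /\ cubA x <> 0)).
  { intros q [Hq _] N. apply nearby_and; [apply nearby_ball, Hq|].
    exact (nearby_neq cubA q 0 (Dd_cont _ _ _ (cubA_Dd q Hq)) N). }
  assert (C0 : cubic 0).
  { split; rewrite ?cubE_0, ?cubB_0, ?cubA_0, ?cubT_0; simpl; ring. }
  split; [|split; [|exact C0]].
  - intros q Hq Cq. destruct (cubic_neq_0 q Hq Cq) as [NA _].
    assert (NX : nearby q (fun x => cubX x = cubX q)).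
    { apply nearby_const. eapply nearby_imp; [|exact (HA q Hq NA)].
      intros x [Hx N]. apply cubX_Dd; assumption. }
    destruct (Ceq_dec q 0) as [->|Nq].
    + destruct (HA 0 Hq NA) as [r [Hr B]].
      destruct NX as [s [Hs BX]]. exists (Rmin r s). split; [apply Rmin_pos; assumption|].
      intros x Hx. destruct (Ceq_dec x 0) as [->|Nx]; [exact C0|].
      apply cubic_iff; [exact Nx|]. split.
      * rewrite <- cubX_0. apply BX. eapply Rlt_le_trans; [exact Hx|apply Rmin_r].
      * apply (cubY_small x r Hr); try assumption. eapply Rlt_le_trans; [exact Hx|apply Rmin_l].
    + assert (Hc : Ccont (fun x => x) q) by exact (Cder_cont _ _ _ (Cder_id q)).
      assert (NN := nearby_neq (fun x => x) q 0 Hc Nq).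
      assert (NY : nearby q (fun x => cubY x = cubY q)).
      { apply nearby_const. eapply nearby_imp; [|exact (nearby_and _ _ _ NN (HA q Hq NA))].
        intros x [Nx [Hx N]]. apply cubY_Dd; assumption. }
      eapply nearby_imp; [|exact (nearby_and _ _ _ NN (nearby_and _ _ _ NX NY))].
      apply (cubic_iff q Nq) in Cq. destruct Cq as [EX EY].
      intros x [Nx [E1 E2]]. apply cubic_iff; [exact Nx|]. rewrite E1, E2. auto.
  - intros q [Hq Ht] NC.
    destruct (classic (cubE q = cubB q ^ 3)) as [E1|E1].
    + assert (E2 : cubV q <> 0).
      { intros E. apply NC. split; [exact E1|]. apply Ceq_minus, E. }
      assert (Hc : Ccont cubV q).
      { exact (Dd_cont _ _ _ (Dd_minus _ _ _ _ _ (Dd_pow _ _ _ 2 (cubA_Dd q Hq))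
          (Dd_mult _ _ _ _ _ (cubE_Dd' q Hq) (Dd_minus _ _ _ _ _ (Dd_const 1 q) (cubT_Dd q Hq))))). }
      eapply nearby_imp; [|exact (nearby_neq cubV q 0 Hc E2)].
      intros x Nx [_ E]. apply Nx. unfold cubV. rewrite E. ring.
    + assert (Hc : Ccont (fun x => cubE x - cubB x ^ 3) q).
      { exact (Dd_cont _ _ _ (Dd_minus _ _ _ _ _ (cubE_Dd' q Hq) (Dd_pow _ _ _ 2 (cubB_Dd q Hq)))). }
      eapply nearby_imp; [|exact (nearby_neq _ q 0 Hc (Cminus_eq_contra _ _ E1))].
      intros x Nx [E _]. apply Nx. rewrite E. ring.
Qed.

(* Each of the next four functions has derivative zero once the previous ones are
   constant.  Their values say that [a^2 = b^2 (1 - t)^(2/3)], that the Wronskian of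
   [hypF t] and [b] vanishes, that [hypF t = b], and that
   [q = - (t / 27) exp (hypG t / hypF t)]. *)
Definition theta_ratio (q : C) : C := cubA q * cubA q * Cexp (2 / 3 * ell (cubT q)) / (cubB q * cubB q).

Lemma ell_cubT_Dd q : Omega q ->
  Dd (fun x => ell (cubT x)) q (geo (cubT q) * (cubA q * cubA q)).
Proof.
  intros [Hq Ht]. destruct (cubT_Dd q Hq) as [t' [T1 T2]].
  exists (/ (1 - cubT q) * t'). split; [apply (Cder_comp ell cubT); [exact T1|apply ell_Cder, Ht]|].
  transitivity (/ (1 - cubT q) * (q * t')); [ring|]. rewrite T2. unfold geo, Cdiv. ring.
Qed.

Lemma cubE_of_cubA q : Omega q -> cubic q -> cubE q = cubA q ^ 3 / (1 - cubT q).
Proof.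
  intros [_ Ht] [_ E]. rewrite E. field. apply one_minus_neq0, Ht.
Qed.

Lemma theta_ratio_Dd q : Omega q -> cubic q -> Dd theta_ratio q 0.
Proof.
  intros Oq Cq. destruct (cubic_neq_0 q Oq Cq) as [NA NE]. pose proof (cubB_neq_0 q) as NB.
  assert (EE := cubE_of_cubA q Oq Cq). assert (DL := ell_cubT_Dd q Oq).
  destruct Oq as [Hq Ht]. assert (NT := one_minus_neq0 _ Ht).
  eapply Dd_eq.
  - apply Dd_div; [apply Cmult_neq_0; assumption| |apply Dd_mult; apply cubB_Dd, Hq].
    apply Dd_mult; [apply Dd_mult; apply cubA_Dd, Hq|]. apply Dd_exp, Dd_scal, DL.
  - rewrite EE. unfold geo. field. repeat split; try assumption; cnz.
Qed.

Lemma theta_ratio_0 : theta_ratio 0 = 1.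
Proof.
  unfold theta_ratio. rewrite cubA_0, cubB_0, cubT_0, ell_0. replace (2 / 3 * 0) with (RtoC 0) by ring.
  rewrite Cexp_0. field; cnz.
Qed.

(** As [D t = a^2 t], the factor [b (P - a^2) / (12 a^2)] is [t d/dt] of [b]. The exponential is
    Abel's factor [(1 - t)^(2/3)]; it makes the Wronskian constant because [b] solves the
    hypergeometric equation in [t]. *)
Definition wronsk (q : C) : C :=
  (cubB q * hypF1 (cubT q)
    - hypF (cubT q) * (cubB q * ((eis2 q - cubA q * cubA q) / (12 * (cubA q * cubA q)))))
  * Cexp (- (2 / 3) * ell (cubT q)).

Lemma wronsk_Dd q : Omega q -> cubic q -> Dd wronsk q 0.
Proof.
  intros Oq Cq. destruct (cubic_neq_0 q Oq Cq) as [NA NE]. pose proof (cubB_neq_0 q) as NB.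
  assert (EE := cubE_of_cubA q Oq Cq). assert (DL := ell_cubT_Dd q Oq).
  destruct Oq as [Hq Ht]. assert (NT := one_minus_neq0 _ Ht).
  assert (DF : Dd (fun x => hypF (cubT x)) q (hypF1 (cubT q) * (cubA q * cubA q))).
  { apply Dd_PS_comp; [apply poly_bdd_hcoef|exact Ht|apply cubT_Dd, Hq]. }
  assert (DF1 : Dd (fun x => hypF1 (cubT x)) q (hypF2 (cubT q) * (cubA q * cubA q))).
  { apply Dd_PS_comp; [apply poly_bdd_thw, poly_bdd_hcoef|exact Ht|apply cubT_Dd, Hq]. }
  assert (NA12 : 12 * (cubA q * cubA q) <> 0) by (repeat apply Cmult_neq_0; try assumption; cnz).
  eapply Dd_eq.
  - apply Dd_mult; [|apply Dd_exp, Dd_scal, DL].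
    apply Dd_minus; [apply Dd_mult; [apply cubB_Dd, Hq|exact DF1]|].
    apply Dd_mult; [exact DF|]. apply Dd_mult; [apply cubB_Dd, Hq|].
    apply Dd_div; [exact NA12| |apply Dd_scal, Dd_mult; apply cubA_Dd, Hq].
    apply Dd_minus; [apply eis2_Dd, Hq|apply Dd_mult; apply cubA_Dd, Hq].
  - assert (V1 : hypF2 (cubT q) = cubT q * (2 / 3 * hypF1 (cubT q) + 1 / 9 * hypF (cubT q)) / (1 - cubT q)).
    { rewrite <- hypF_ode by exact Ht. field. exact NT. }
    rewrite V1, (eis4_cub q Hq), EE. unfold geo. field. repeat split; try assumption; cnz.
Qed.

Lemma wronsk_0 : wronsk 0 = 0.
Proof.
  unfold wronsk. rewrite cubT_0, cubA_0, cubB_0, eis2_0. unfold hypF1. rewrite PS_0. unfold thw.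
  simpl INR. unfold Cdiv. ring.
Qed.

Definition hyp_ratio (q : C) : C := hypF (cubT q) / cubB q.

Lemma hyp_ratio_Dd q : Omega q -> cubic q -> wronsk q = wronsk 0 -> Dd hyp_ratio q 0.
Proof.
  intros Oq Cq E3. destruct (cubic_neq_0 q Oq Cq) as [NA NE]. pose proof (cubB_neq_0 q) as NB.
  destruct Oq as [Hq Ht]. rewrite wronsk_0 in E3.
  eapply Dd_eq.
  - apply Dd_div; [exact NB|apply Dd_PS_comp; [apply poly_bdd_hcoef|exact Ht|apply cubT_Dd, Hq]|apply cubB_Dd, Hq].
  - fold hypF1 hypF. pose proof (Cexp_neq_0 (- (2 / 3) * ell (cubT q))) as NX.
    unfold wronsk in E3.
    apply (lin_eq _ _ _ _ (cubA q * cubA q / (cubB q * cubB q) / Cexp (- (2 / 3) * ell (cubT q))) E3).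
    unfold hypF, hypF1. field. repeat split; try assumption; cnz.
Qed.

Lemma hypF_0 : hypF 0 = 1.
Proof. unfold hypF. rewrite PS_0. unfold hcoef. rewrite hcoefR_0. reflexivity. Qed.

Lemma hyp_ratio_0 : hyp_ratio 0 = 1.
Proof. unfold hyp_ratio. rewrite cubT_0, cubB_0, hypF_0. field; cnz. Qed.

(** [cubU] is [t / q] continued to the cusp, so the quotient has a value at [q = 0]. *)
Definition nome_ratio (q : C) : C := Cexp (- (hypG (cubT q) / hypF (cubT q))) / cubU q.

Lemma nome_ratio_0 : nome_ratio 0 = 1 / -(27).
Proof.
  unfold nome_ratio. rewrite cubT_0, cubU_0. unfold hypG. rewrite PS_0. unfold hcoefG. simpl hharm.
  rewrite Cmult_0_r. replace (- (0 / hypF 0)) with (RtoC 0) by (unfold Cdiv; ring).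
  rewrite Cexp_0. reflexivity.
Qed.

Lemma nome_ratio_Dd q : Omega q -> theta_ratio q = theta_ratio 0 -> hyp_ratio q = hyp_ratio 0 -> Dd nome_ratio q 0.
Proof.
  intros [Hq Ht] E2 E4. pose proof (cubB_neq_0 q) as NB. pose proof (cubU_neq_0 q) as NU.
  rewrite theta_ratio_0 in E2. rewrite hyp_ratio_0 in E4.
  pose proof (hypF_neq_0 _ Ht) as NF. pose proof (hyp_wronskian _ Ht) as W.
  assert (DF : Dd (fun x => hypF (cubT x)) q (hypF1 (cubT q) * (cubA q * cubA q))).
  { apply Dd_PS_comp; [apply poly_bdd_hcoef|exact Ht|apply cubT_Dd, Hq]. }
  assert (DG : Dd (fun x => hypG (cubT x)) q (hypG1 (cubT q) * (cubA q * cubA q))).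
  { apply Dd_PS_comp; [apply poly_bdd_hcoefG|exact Ht|apply cubT_Dd, Hq]. }
  eapply Dd_eq.
  - apply Dd_div; [exact NU| |apply cubU_Dd, Hq]. apply Dd_exp.
    apply (Dd_ext (fun x => -(1) * (hypG (cubT x) / hypF (cubT x)))); [intros; ring|].
    apply Dd_scal, Dd_div; [exact NF|exact DG|exact DF].
  - assert (EF : hypF (cubT q) * hypF (cubT q) = cubA q * cubA q * (hypF (cubT q) * hypF (cubT q) + hypF (cubT q) * hypG1 (cubT q) - hypG (cubT q) * hypF1 (cubT q))).
    { rewrite W. unfold theta_ratio in E2. unfold hyp_ratio in E4.
      assert (EB : hypF (cubT q) = cubB q).
      { apply (lin_eq _ _ _ _ (cubB q) E4). field. exact NB. }
      rewrite EB. symmetry. apply (lin_eq _ _ _ _ (cubB q * cubB q) E2). field. exact NB. }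
    cbv beta. set (F := hypF (cubT q)) in *. set (X := Cexp (- (hypG (cubT q) / F))).
    apply (lin_eq _ _ _ _ (X / (cubU q * (F * F))) EF).
    field. split; assumption.
Qed.

(** * Branches and the final computation *)

Lemma Cexp_Clog (z : C) : z <> 0 -> Cexp (Clog z) = z.
Proof.
  intros Hz. assert (Hm : (0 < Cmod z)%R) by (apply Cmod_gt_0; exact Hz).
  change ((exp (ln (Cmod z)) * cos (Carg z), exp (ln (Cmod z)) * sin (Carg z))%R = z).
  rewrite exp_ln by exact Hm.
  assert (Hb : (-1 <= Re z / Cmod z <= 1)%R).
  { pose proof (re_le_Cmod z) as H. apply Rabs_le_between in H.
    split; apply Rmult_le_reg_r with (Cmod z); try exact Hm;
      unfold Rdiv; rewrite Rmult_assoc, Rinv_l; lra. }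
  assert (Hs : (sqrt (1 - Rsqr (Re z / Cmod z)) = Rabs (Im z) / Cmod z)%R).
  { replace (1 - Rsqr (Re z / Cmod z))%R with (Rsqr (Rabs (Im z) / Cmod z)).
    - apply sqrt_Rsqr. apply Rdiv_le_0_compat; [apply Rabs_pos|exact Hm].
    - pose proof (Cmod2_alt z) as H2. rewrite Rsqr_div', <- Rsqr_abs, Rsqr_div'.
      apply Rmult_eq_reg_r with (Rsqr (Cmod z)); [|unfold Rsqr; nra].
      unfold Rsqr in *. field_simplify; try lra. }
  apply C_eq;
    [change (Cmod z * cos (Carg z) = Re z)%R | change (Cmod z * sin (Carg z) = Im z)%R];
    unfold Carg; destruct (Rle_dec 0 (Im z)) as [L|L].
  - rewrite cos_acos by exact Hb. field. lra.
  - rewrite cos_neg, cos_acos by exact Hb. field. lra.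
  - rewrite sin_acos by exact Hb. rewrite Hs, Rabs_pos_eq by exact L. field. lra.
  - rewrite sin_neg, sin_acos by exact Hb. rewrite Hs, Rabs_left by lra. field. lra.
Qed.

(** Equal imaginary parts put both arguments in [[0, pi]] or both in [[- pi, 0]]. The case of
    interest is [u - 1] and [u]. *)
Lemma Carg_diff (z w : C) : Im z = Im w -> (Rabs (Carg z - Carg w) <= PI)%R.
Proof.
  intros E. unfold Carg. rewrite E.
  pose proof (acos_bound (Re z / Cmod z)). pose proof (acos_bound (Re w / Cmod w)).
  apply Rabs_le. destruct (Rle_dec 0 (Im w)); lra.
Qed.

(** [1 - s t] stays in the right half-plane, so the cosine of [Im (ell (s t))] is positive along the
    ray, and by the intermediate value theorem this imaginary part cannot reach [pi / 2]. The two
    values of [c] take care of the two signs. *)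
Lemma Re_ell_rot (c t : C) : (c = Ci \/ c = - Ci) -> (Cmod t < 1)%R -> (Re (c * ell t) < PI / 2)%R.
Proof.
  intros Hc Ht.
  assert (P : forall s : R, (0 <= s <= 1)%R -> (0 < cos (Re (c * ell (0 + s * t))))%R).
  { intros s Hs. replace (0 + s * t) with (s * t) by ring.
    pose proof (ray_disc t s Hs Ht) as Hst.
    assert (E := f_equal Re (Cexp_ell _ Hst)).
    assert (R1 : (0 < Re (1 - s * t))%R).
    { rewrite Re_minus. pose proof (re_le_Cmod (s * t)) as H. apply Rabs_le_between in H.
      rewrite (re_RtoC 1). lra. }
    rewrite <- E in R1.
    change (0 < exp (Re (- ell (s * t))) * cos (- Im (ell (s * t))))%R in R1.
    assert (EC : cos (Re (c * ell (s * t))) = cos (- Im (ell (s * t)))%R).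
    { set (x := ell (s * t)). destruct Hc as [-> | ->].
      - f_equal. unfold Re, Im, Ci, Cmult; simpl. ring.
      - rewrite cos_neg. f_equal. unfold Re, Im, Ci, Cmult, Copp; simpl. ring. }
    rewrite EC. apply (Rmult_lt_reg_l _ _ _ (exp_pos (Re (- ell (s * t))))).
    rewrite Rmult_0_r. exact R1. }
  set (f := fun s : R => (Re (c * ell (0 + s * t)) - PI / 2)%R).
  assert (E1 : 0 + 1%R * t = t) by ring.
  destruct (Rlt_le_dec (Re (c * ell t)) (PI / 2)) as [L|L]; [exact L|exfalso].
  destruct (Req_dec (Re (c * ell t)) (PI / 2)) as [E|N].
  - specialize (P 1%R ltac:(lra)). rewrite E1, E, cos_PI2 in P. lra.
  - destruct (Ranalysis5.IVT_interv f 0 1) as [s [Hs Es]].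
    + intros s Hs. apply continuity_pt_minus; [|apply continuity_pt_const; intros ? ?; reflexivity].
      apply continuity_pt_filterlim.
      apply (ex_derive_continuous (fun s : R => Re (c * ell (0 + s * t)))).
      eexists. apply (Cder_line_Re (fun x => c * ell x)). apply Cder_scal, ell_Cder.
      replace (0 + s * t) with (s * t) by ring. apply ray_disc; assumption.
    + lra.
    + unfold f. replace (0 + 0%R * t) with (RtoC 0) by ring. rewrite ell_0, Cmult_0_r.
      simpl. pose proof PI_RGT_0. lra.
    + unfold f. rewrite E1. lra.
    + specialize (P s Hs). unfold f in Es.
      replace (Re (c * ell (0 + s * t))) with (PI / 2)%R in P by lra. rewrite cos_PI2 in P. lra.
Qed.

Lemma Im_ell_bound (t : C) : (Cmod t < 1)%R -> (Rabs (Im (ell t)) < PI / 2)%R.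
Proof.
  intros Ht. pose proof (Re_ell_rot Ci t (or_introl eq_refl) Ht) as H1.
  pose proof (Re_ell_rot (- Ci) t (or_intror eq_refl) Ht) as H2.
  replace (Re (Ci * ell t)) with (- Im (ell t))%R in H1 by (unfold Re, Im, Ci, Cmult; simpl; ring).
  replace (Re (- Ci * ell t)) with (Im (ell t)) in H2 by (unfold Re, Im, Ci, Cmult, Copp; simpl; ring).
  apply Rabs_def1; lra.
Qed.

Lemma cos_eq_1 (x : R) : (Rabs x < 2 * PI)%R -> cos x = 1%R -> x = 0%R.
Proof.
  intros Hx E. assert (E2 : (cos x = 1 - 2 * Rsqr (sin (x / 2)))%R).
  { replace x with (2 * (x / 2))%R at 1 by field. rewrite cos_2a_sin. unfold Rsqr. ring. }
  assert (S : sin (x / 2) = 0%R) by (apply Rsqr_0_uniq; lra).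
  apply Rabs_def2 in Hx.
  destruct (Rtotal_order x 0) as [L|[L|L]]; [|exact L|].
  - pose proof (sin_gt_0 (- (x / 2)) ltac:(lra) ltac:(lra)) as T. rewrite sin_neg in T. lra.
  - pose proof (sin_gt_0 (x / 2) ltac:(lra) ltac:(lra)). lra.
Qed.

Lemma Cexp_eq_1 (w : C) : (Rabs (Im w) < 2 * PI)%R -> Cexp w = 1 -> w = 0.
Proof.
  intros Hw E. assert (Em := f_equal Cmod E). rewrite Cmod_Cexp, Cmod_1, <- exp_0 in Em.
  apply exp_inv in Em. apply (f_equal Re) in E. unfold Cexp in E. rewrite Em, exp_0 in E.
  simpl in E. rewrite Rmult_1_l in E. apply C_eq; [exact Em|]. apply cos_eq_1; assumption.
Qed.

(** Both sides have the same exponential, and the imaginary part of their difference is below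
    [pi / 2 + pi] in absolute value, which excludes nonzero multiples of [2 pi i]. *)
Lemma ell_Clog (u : C) : u <> 0 -> (Cmod (/ u) < 1)%R -> ell (/ u) = Clog u - Clog (u - 1).
Proof.
  intros Hu Ht.
  assert (Hu1 : u - 1 <> 0).
  { intros E. apply (one_minus_neq0 _ Ht). replace (1 - / u) with ((u - 1) / u) by (field; exact Hu).
    rewrite E. unfold Cdiv. ring. }
  assert (W : ell (/ u) + Clog (u - 1) - Clog u = 0).
  { apply Cexp_eq_1.
    - rewrite Im_minus, Im_plus.
      pose proof (Im_ell_bound _ Ht) as H1.
      assert (H2 : (Rabs (Im (Clog (u - 1)) - Im (Clog u)) <= PI)%R).
      { apply (Carg_diff (u - 1) u). rewrite Im_minus. simpl. ring. }
      pose proof PI_RGT_0.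
      replace (Im (ell (/ u)) + Im (Clog (u - 1)) - Im (Clog u))%R
        with (Im (ell (/ u)) + (Im (Clog (u - 1)) - Im (Clog u)))%R by ring.
      eapply Rle_lt_trans; [apply Rabs_triang|]. lra.
    - rewrite Cexp_minus, Cexp_plus, !Cexp_Clog by assumption.
      assert (E := Cexp_ell _ Ht). rewrite Cexp_opp in E.
      pose proof (Cexp_neq_0 (ell (/ u))) as N.
      replace (Cexp (ell (/ u))) with (/ (1 - / u)).
      + field. split; assumption.
      + rewrite <- E. field. exact N. }
  apply Ceq_minus. rewrite <- W. ring.
Qed.

(** By [ell_Clog], both sides are the exponential of [(2/3) log u + (1/3) log (u - 1)] with
    principal logarithms. *)
Lemma cube_root_branch (u : C) : u <> 0 -> (Cmod (/ u) < 1)%R ->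
  (u - 1) * Cexp (2 / 3 * ell (/ u)) = Cpower u (2 / 3) * Cpower (u - 1) (1 / 3).
Proof.
  intros Hu Ht. rewrite ell_Clog by assumption.
  assert (Hu1 : u - 1 <> 0).
  { intros E. apply (one_minus_neq0 _ Ht). replace (1 - / u) with ((u - 1) / u) by (field; exact Hu).
    rewrite E. unfold Cdiv. ring. }
  rewrite <- (Cexp_Clog (u - 1)) at 1 by exact Hu1.
  unfold Cpower. rewrite <- !Cexp_plus. f_equal.
  rewrite !RtoC_div by lra. field; cnz.
Qed.

Lemma component_identities tau : C_inv_u_infty tau -> let q := nome tau in
  cubic q /\ theta_ratio q = 1 /\ wronsk q = 0 /\ hyp_ratio q = 1 /\ nome_ratio q = 1 / -(27).
Proof.
  intros HC q.
  assert (K2 := clopen_step _ _ clopen_cubic theta_ratio_Dd).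
  assert (K3 := clopen_step _ _ K2 (fun q O G => wronsk_Dd q O (proj1 G))).
  assert (K4 := clopen_step _ _ K3 (fun q O G => hyp_ratio_Dd q O (proj1 (proj1 G)) (proj2 G))).
  assert (K5 := clopen_step _ _ K4
    (fun q O G => nome_ratio_Dd q O (proj2 (proj1 (proj1 G))) (proj2 G))).
  assert (H := clopen_component _ tau K5 HC). cbv beta in H.
  rewrite theta_ratio_0, wronsk_0, hyp_ratio_0, nome_ratio_0 in H. fold q in H. tauto.
Qed.

Lemma C_real (z : C) : Im z = 0%R -> z = RtoC (Re z).
Proof. intros H. apply C_eq; [reflexivity|exact H]. Qed.

Lemma Cexp_real (x : R) : Cexp x = RtoC (exp x).
Proof.
  unfold Cexp. simpl. rewrite cos_0, sin_0. unfold RtoC. f_equal; ring.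
Qed.

(* The nome is [- (t / 27) exp (G(t) / F(t))] with [t = 1 / u], so it is a negative
   real number if [u = 9]; this happens only on the line [Re tau = 1/2] (mod 1). *)
Lemma u_neq_9 tau : C_inv_u_infty tau -> u_3B tau <> 9.
Proof.
  intros HC Hu. destruct (component_identities tau HC) as [_ [_ [_ [_ E5]]]].
  destruct HC as [[[Him [_ [_ Hre]]] Hd] _].
  pose proof (cubT_eq tau Him) as ET. rewrite Hu in ET.
  assert (ET' : cubT (nome tau) = RtoC (/ 9)) by (rewrite <- ET, RtoC_inv by lra; reflexivity).
  assert (H9 : (Cmod (RtoC (/ 9)) < 1)%R) by (rewrite Cmod_R, Rabs_pos_eq; lra).
  unfold nome_ratio in E5. rewrite ET' in E5.
  (* At the real point [t = 1/9] the values of [F] and [G] are real, since their coefficients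
     are. *)
  assert (EG : hypG (RtoC (/ 9)) = RtoC (Re (hypG (RtoC (/ 9))))).
  { apply C_real, Im_PS_real. intros n. unfold hcoefG, hcoef. rewrite <- RtoC_mult. reflexivity. }
  assert (EF : hypF (RtoC (/ 9)) = RtoC (Re (hypF (RtoC (/ 9))))).
  { apply C_real, Im_PS_real. intros n. reflexivity. }
  set (g := Re (hypG (RtoC (/ 9)))) in *. set (f := Re (hypF (RtoC (/ 9)))) in *.
  assert (Nf : f <> 0%R).
  { intros E. apply (hypF_neq_0 _ H9). rewrite EF, E. reflexivity. }
  rewrite EG, EF, <- RtoC_div, <- RtoC_opp, Cexp_real in E5 by exact Nf.
  pose proof (cubU_neq_0 (nome tau)) as NU.
  assert (EU : cubU (nome tau) = -(27) * RtoC (exp (- (g / f)))).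
  { apply (lin_eq _ _ _ _ (27 * cubU (nome tau)) E5). field. exact NU. }
  unfold cubT in ET'. rewrite EU in ET'.
  pose proof (exp_pos (- (g / f))) as Hp. set (k := exp (- (g / f))) in *.
  (* [q = t / cubU] with [t = 1/9] and [cubU = -27 k], whence [243 = 9 * 27]. *)
  assert (EQ : nome tau = RtoC (- (/ (243 * k)))%R).
  { assert (Nk : RtoC k <> 0) by (intros E; apply RtoC_inj in E; lra).
    rewrite RtoC_opp, RtoC_inv, RtoC_mult by nra.
    rewrite RtoC_inv in ET' by lra.
    apply (lin_eq _ _ _ _ (- / (27 * k)) ET'). field. exact Nk. }
  assert (Hk : (0 < / (243 * k))%R) by (apply Rinv_0_lt_compat; lra).
  assert (ER := f_equal Re EQ). assert (EI := f_equal Im EQ).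
  unfold nome, Cexp in ER, EI. rewrite Re_2piI, Im_2piI in ER, EI. simpl in ER, EI.
  pose proof (exp_pos (- (2 * PI * Im tau))) as He.
  assert (Hs : sin (2 * PI * Re tau) = 0%R) by (apply Rmult_integral in EI; destruct EI; [lra|assumption]).
  assert (Hc : (cos (2 * PI * Re tau) < 0)%R) by nra.
  pose proof PI_RGT_0. apply Rabs_def2 in Hre. set (x := (2 * PI * Re tau)%R) in *.
  (* In this range the sine vanishes only at [x = 0], where the cosine is 1 and not negative. *)
  assert (Hx : (- PI < x < PI)%R) by (unfold x; nra).
  destruct (Rtotal_order x 0) as [L|[L|L]].
  - pose proof (sin_gt_0 (- x) ltac:(lra) ltac:(lra)) as T. rewrite sin_neg in T. lra.
  - rewrite L, cos_0 in Hc. lra.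
  - pose proof (sin_gt_0 x L ltac:(lra)). lra.
Qed.

(** * Assembling the identity *)

Lemma lambert_Lam k tau : lambert k tau = Lam (Sw k) (nome tau).
Proof.
  apply CSeries_ext. intros n. unfold Sw, lam, geo. cbv zeta. rewrite RtoC_pow. reflexivity.
Qed.

Theorem mainTheorem13 (a b c d : Z) (tau : C)
  (ha : (0 < a)%Z)
  (hcoprime : Z.gcd (Z.gcd a b) c = 1%Z)
  (hd : (- d = b ^ 2 - 4 * a * c)%Z)
  (htau : tau = ((- IZR b + Ci * sqrt (IZR d)) / (2 * IZR a))%C)
  (hquad : (IZR a * tau ^ 2 + IZR b * tau + IZR c = 0)%C)
  (hC : C_inv_u_infty tau)
  (hE6 : E6 tau <> 0%C) :
  let u := u_3B tau in
  let F := fun x : C => hyp2F1 (1 / 3) (1 / 3) 1 (/ x)%C in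
  (F u ^ 2 / 6 * ((u - 1) - (u ^ 2 + 18 * u - 27) / (u - 9) * s2 tau)
     - u * (u - 1) * C_derive (fun x : C => F x ^ 2) u
   = IZR a / (PI * sqrt (IZR d)) * (Cpower u (2 / 3) * Cpower (u - 1) (1 / 3)))%C.
Proof.
  intros u F.
  assert (N9 := u_neq_9 tau hC). fold u in N9.
  destruct (component_identities tau hC) as [Cq [S2 [S3 [S4 _]]]].
  destruct hC as [Dt _]. assert (Oq := disc_region_Omega _ Dt).
  assert (Him : (0 < Im tau)%R) by apply Dt.
  assert (ET := cubT_eq tau Him). fold u in ET.
  destruct (cubic_neq_0 _ Oq Cq) as [NA NE].
  assert (EE := cubE_of_cubA _ Oq Cq).
  set (q := nome tau) in *. destruct Oq as [Hq Ht].
  pose proof (cubB_neq_0 q) as NB.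
  assert (Nu : u <> 0).
  { unfold u. rewrite u_3B_eq by exact Him.
    assert (NT : cubT (nome tau) <> 0) by (apply cubT_neq_0, nome_neq_0).
    intros E. apply (f_equal (fun x => x * cubT (nome tau))) in E.
    rewrite Cinv_l, Cmult_0_l in E by exact NT. apply C1_nz, E. }
  rewrite <- ET in *.
  assert (Nu1 : u - 1 <> 0).
  { intros E. apply (one_minus_neq0 _ Ht). replace (1 - / u) with ((u - 1) / u) by (field; exact Nu).
    rewrite E. unfold Cdiv. ring. }
  assert (EFB : hypF (/ u) = cubB q).
  { unfold hyp_ratio in S4. rewrite <- ET in S4. apply (lin_eq _ _ _ _ (cubB q) S4). field. exact NB. }
  destruct (PS_Dd hcoef (/ u) poly_bdd_hcoef Ht) as [l [L1 L2]].
  fold hypF in L1. change (/ u * l = hypF1 (/ u)) in L2.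
  assert (DF : C_derive (fun x : C => F x ^ 2) u = INR 2 * hypF (/ u) ^ 1 * (l * (- / (u * u)))).
  { apply Cder_C_derive. apply (Cder_pow (fun x => hypF (/ x))).
    apply (Cder_comp hypF Cinv); [apply Cder_Cinv, Nu|exact L1]. }
  (* The vanishing Wronskian equates the logarithmic derivatives of [F] and [b] with respect to
     [t]. *)
  assert (EF1 : hypF1 (/ u) = hypF (/ u) * ((eis2 q - cubA q * cubA q) / (12 * (cubA q * cubA q)))).
  { unfold wronsk in S3. rewrite <- ET in S3.
    pose proof (Cexp_neq_0 (- (2 / 3) * ell (/ u))) as NX.
    apply (lin_eq _ _ _ _ (/ (cubB q * Cexp (- (2 / 3) * ell (/ u)))) S3).
    field. repeat split; try assumption. }
  assert (El : l = u * (hypF (/ u) * ((eis2 q - cubA q * cubA q) / (12 * (cubA q * cubA q))))).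
  { rewrite <- EF1, <- L2. field. exact Nu. }
  assert (EP : E2 tau = eis2 q) by (unfold E2, eis2; rewrite lambert_Lam; reflexivity).
  (* Insert [e = a^3 u / (u - 1)]: [9 - 8 u / (u - 1)] is [(u - 9) / (u - 1)], and in weight 6 the
     numerator [-27 (u - 1)^2 + 36 u (u - 1) - 8 u^2] is [u^2 + 18 u - 27]. *)
  assert (EQ : E4 tau = cubA q ^ 4 * (u - 9) / (u - 1)).
  { transitivity (eis4 q); [unfold E4, eis4; rewrite lambert_Lam; reflexivity|].
    rewrite eis4_cub, EE by exact Hq. field. split; assumption. }
  assert (ER : E6 tau = cubA q ^ 6 * (u ^ 2 + 18 * u - 27) / ((u - 1) * (u - 1))).
  { transitivity (eis6 q); [unfold E6, eis6; rewrite lambert_Lam; reflexivity|].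
    rewrite (proj1 (cubic_weight6 q Hq)), EE. field. split; assumption. }
  (* [E6 tau] has this polynomial as a factor, so [hE6] excludes its zeros. *)
  assert (NR : u ^ 2 + 18 * u - 27 <> 0).
  { intros E. apply hE6. rewrite ER, E. unfold Cdiv. ring. }
  assert (N9' : u - 9 <> 0) by (apply Cminus_eq_contra, N9).
  change (F u) with (hypF (/ u)). rewrite DF, El.
  unfold s2, E2star. rewrite EP, EQ, ER.
  assert (EA : hypF (/ u) ^ 2 = cubA q * cubA q * Cexp (2 / 3 * ell (/ u))).
  { unfold theta_ratio in S2. rewrite <- ET in S2. rewrite EFB. symmetry.
    apply (lin_eq _ _ _ _ (cubB q * cubB q) S2). field. exact NB. }
  rewrite <- cube_root_branch by assumption.
  assert (Ha : (0 < IZR a)%R) by (apply IZR_lt, ha).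
  (* Besides evaluating [Im tau], this makes [sqrt d] positive, since [tau] lies in the upper
     half-plane. *)
  assert (HI : (Im tau * (2 * IZR a) = sqrt (IZR d))%R).
  { assert (N2a : RtoC 2 * IZR a <> 0) by (rewrite <- RtoC_mult; intros E; apply RtoC_inj in E; lra).
    assert (E : tau * (2 * IZR a)%R = - IZR b + Ci * sqrt (IZR d)).
    { rewrite htau, RtoC_mult. field. intros E0; apply RtoC_inj in E0; lra. }
    apply (f_equal Im) in E. rewrite im_scal_r in E. rewrite E.
    unfold Im, Ci, Cmult, Cplus, Copp; simpl. ring. }
  assert (Hsd : (0 < sqrt (IZR d))%R) by nra.
  pose proof PI_RGT_0 as Hpi.
  assert (Npi : RtoC PI <> 0) by (intros E; apply RtoC_inj in E; lra).
  assert (Nim : RtoC (Im tau) <> 0) by (intros E; apply RtoC_inj in E; lra).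
  assert (NIa : RtoC (IZR a) <> 0) by (intros E; apply RtoC_inj in E; lra).
  rewrite <- HI, RtoC_div, !RtoC_mult by nra.
  set (Fu := hypF (/ u)) in *. set (A := cubA q) in *. set (X := Cexp (2 / 3 * ell (/ u))) in *.
  replace (RtoC (INR 2)) with (RtoC 2) by (f_equal; simpl; ring).
  (* The terms in [E2] cancel between [s2] and the derivative. What remains is
     [(u - 1) F^2 / (2 pi Im tau A^2)] on the left and [(u - 1) X / (2 pi Im tau)] on the right,
     which is [EA] multiplied by the given factor. *)
  apply (lin_eq _ _ _ _ ((u - 1) / (2 * PI * Im tau * (A * A))) EA).
  field. repeat split; try assumption; cnz.
Qed.
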